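(* Let $\{a_n\}_{n=1}^\infty$ be a sequence of positive numbers satisfying $\sup_{n\in\mathbb{N}}|a_n-n|\le C<\infty$. Let $\mu=1.508879\ldots$ be the positive solution of the equation $$\frac{\sqrt{x^2+1}}{x}=\log\left(\sqrt{x^2+1}+x\right).$$ Let $p\in(0,\infty]$, $\sigma_0>0$, and let $f$ be a measurable complex-valued function on $\mathbb{R}$ with $A_{\sigma_0}(f)_p<\infty$. Then for every $\sigma>\mu\sigma_0$ the following hold. (a) If $p=\infty$, then $$A_\sigma(f)_\infty\le \liminf_{n\to\infty}E_n\left(f,L_\infty([-a_n/\sigma,a_n/\sigma])\right)\le \limsup_{n\to\infty}E_n\left(f,L_\infty([-a_n/\sigma,a_n/\sigma])\right)\le A_{\sigma-0}(f)_\infty.$$ (b) If $p\in(0,\infty)$, then $$\lim_{n\to\infty}E_n\left(f,L_p([-a_n/\sigma,a_n/\sigma])\right)=A_\sigma(f)_p.$$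
   Context: $\mathbb{N}=\{1,2,\ldots\}$. $\mathcal{P}_n$ is the set of all algebraic polynomials with complex coefficients of degree at most $n$. For $\sigma\ge 0$, $B_\sigma$ is the set of all complex-valued entire functions of exponential type (at most) $\sigma$, i.e. entire $g$ such that for every $\varepsilon>0$ there is a constant $C_\varepsilon$ with $|g(z)|\le C_\varepsilon e^{(\sigma+\varepsilon)|z|}$ for all $z\in\mathbb{C}$. For measurable $\Omega\subseteq\mathbb{R}$, $\|f\|_{L_p(\Omega)}=\left(\int_\Omega|f(x)|^p\,dx\right)^{1/p}$ for $0<p<\infty$ and $\|f\|_{L_\infty(\Omega)}=\operatorname{ess\,sup}_{x\in\Omega}|f(x)|$; for $0<p<1$ this is a quasinorm. For $a>0$ and $f\in L_p([-a,a])$, $E_n(f,L_p([-a,a])):=\inf_{P\in\mathcal{P}_n}\|f-P\|_{L_p([-a,a])}$. For a measurable function $f$ on $\mathbb{R}$ (not necessarily in $L_p(\mathbb{R})$) and $\sigma>0$, $A_\sigma(f)_p:=\inf_{g\in B_\sigma}\|f-g\|_{L_p(\mathbb{R})}\in[0,\infty]$, and $A_{\sigma-0}(f)_p:=\lim_{\tau\to\sigma-}A_\tau(f)_p$. *)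

(* Defs.v *)
From HB Require Import structures.
From mathcomp Require Import all_boot all_order all_algebra.
From mathcomp Require Import complex.
From mathcomp Require Import all_classical all_reals all_analysis.

Set Implicit Arguments.
Unset Strict Implicit.
Unset Printing Implicit Defensive.

Import Order.TTheory GRing.Theory Num.Theory.
Import numFieldNormedType.Exports.

Local Open Scope classical_set_scope.
Local Open Scope ring_scope.
Local Open Scope complex_scope.

(* The real line with the sigma-algebra of Lebesgue (i.e. Caratheodory)
   measurable sets, the domain of completed_lebesgue_measure; the plain
   lebesgue_measure of the library lives on the Borel sigma-algebra. *)
Notation lebesgueType R := (caratheodory_type (mu_ext (wlength (@idfun R)))).

Definition lebesgue_measurable_fun (R : realType) (f : R -> R[i]) : Prop :=
  measurable_fun [set: lebesgueType R] (fun x => complex.Re (f x)) /\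
  measurable_fun [set: lebesgueType R] (fun x => complex.Im (f x)).

(* The (quasi)norm of L_p(D), obtained by extending |f| by 0 outside D. For
   p = +oo this gives the essential supremum of |f| over D when D is not null
   (and 0 when it is), since |f| >= 0. *)
Definition Lp_norm (R : realType) (p : \bar R) (D : set R) (f : R -> R[i]) :
    \bar R :=
  ('N[@completed_lebesgue_measure R]_p
     [(fun x : lebesgueType R => (Normc.normc (f x))%:E) \_ D])%E.

(* Complex differentiability at every point: R[i]^o is R[i] as a normed module
   over itself, so the increments in derivable range over R[i]. *)
Definition entire (R : realType) (g : R[i] -> R[i]) : Prop :=
  forall z : R[i], derivable (g : R[i]^o -> R[i]^o) z 1.

Definition expo_type (R : realType) (sigma : R) : set (R[i] -> R[i]) :=
  [set g | entire g /\
    forall eps : R, 0 < eps -> exists C : R, forall z : R[i],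
      Normc.normc (g z) <= C * expR ((sigma + eps) * Normc.normc z)].

Definition poly_upto (R : realType) (n : nat) : set {poly R[i]} :=
  [set P | (size P <= n.+1)%N].

Definition best_poly_approx (R : realType) (n : nat) (p : \bar R) (a : R)
    (f : R -> R[i]) : \bar R :=
  ereal_inf [set Lp_norm p `[- a, a] (fun x => f x - P.[x%:C]) |
    P in @poly_upto R n].

Definition best_expo_approx (R : realType) (sigma : R) (p : \bar R)
    (f : R -> R[i]) : \bar R :=
  ereal_inf [set Lp_norm p setT (fun x => f x - g x%:C) |
    g in expo_type sigma].

Definition best_expo_approx_left (R : realType) (sigma : R) (p : \bar R)
    (f : R -> R[i]) : \bar R :=
  lim (best_expo_approx tau p f @[tau --> sigma^'-]).

(* Main.v *)
Require Import Defs.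
From mathcomp Require Import all_boot all_order all_algebra.
From mathcomp Require Import complex cyclic separable cyclotomic.
From mathcomp Require Import all_classical all_reals all_analysis.
From mathcomp Require Import measurable_realfun ess_sup_inf.
From mathcomp Require Import ring lra.

(** Write [E_n] for the error of best approximation of [f] by polynomials of
    degree at most [n] on [[-a_n / sigma, a_n / sigma]].

    Upper bound. Fix [g0] of exponential type [sigma0] with [f - g0] in [L_p].
    If [g] has type less than [sigma] and [f - g] is in [L_p], then [g - g0] is
    of exponential type and in [L_p], hence bounded on the line
    ([Lp_expo_bounded]). It is enough to approximate [g0] and [g - g0] by
    polynomials of degree [n] on an interval of half-length [b], about
    [n / sigma], with an error that tends to [0]. Truncating a Chebyshev
    expansion on the ellipse of parameter [r > 1] gains [r ^ -n] and loses the
    maximum of the function on the ellipse ([ellipse_approx]). For [g0] this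
    maximum is about [exp (sigma0 * b * (r + r^-1) / 2)]; the best [r] makes
    the error geometric as soon as [sigma > mu * sigma0], where
    [mu = sinh u] for the solution [u] of [coth u = u] ([mu_radius],
    [expo_interval_approx]). For the bounded function [g - g0] the
    Phragmen-Lindelof principle ([phragmen_lindelof]) replaces the modulus by
    the imaginary part, the maximum becomes
    [exp (tau * b * (r - r^-1) / 2)], and [r] close to [1] works for every
    [tau < sigma] ([bounded_interval_approx]). Hence the upper limit of [E_n]
    is at most [A_tau(f)_p] for each [tau < sigma] ([best_poly_upper]). For
    finite [p], a dilation of [g - g0] shows that [tau = sigma] is allowed too
    ([expo_left_approx]).

    Lower bound. Suppose that polynomials [P_j] of degrees tending to infinity
    have errors at most [l]. Subtracting from [P_j] a geometric approximant of
    [g0] leaves a polynomial bounded in [L_p] on its interval, hence bounded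
    uniformly away from the end points ([lp_interior]). Bernstein's growth
    estimate ([bernstein_growth]) then bounds these polynomials in the whole
    plane by [M exp ((sigma + eps) |z|)] for every [eps], so a subsequence
    converges to a function of exponential type [sigma] ([poly_montel]), and
    lower semicontinuity of the norms ([Lp_lsc]) gives [A_sigma(f)_p <= l]
    ([best_expo_lower]).

    The complex analysis rests on Goursat's theorem for rectangles, proved for
    the real part of the contour integral only. It gives a mean value
    inequality, the maximum principle, and from it polynomial approximation of
    entire functions on discs by iterated difference quotients, without Cauchy
    integrals or power series. *)

Set Implicit Arguments.
Unset Strict Implicit.
Unset Printing Implicit Defensive.

Import Order.TTheory GRing.Theory Num.Theory.
Import numFieldNormedType.Exports.

Local Open Scope classical_set_scope.
Local Open Scope ring_scope.
Local Open Scope complex_scope.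

Local Notation normc := Normc.normc.

(** * Moduli, complex derivability and continuity *)

Section NormC.
Context {R : realType}.
Implicit Types (z w h : R[i]) (x y : R).

Lemma normcRE z : `|z| = (normc z)%:C.
Proof. by case: z. Qed.

Lemma normc_ge0 z : 0 <= normc z.
Proof. by case: z => a b /=; rewrite sqrtr_ge0. Qed.

Lemma normc_eq0 z : (normc z == 0) = (z == 0).
Proof.
apply/eqP/eqP => [/Normc.eq0_normc//|->]; exact: Normc.normc0.
Qed.

Lemma normc_gt0 z : (0 < normc z) = (z != 0).
Proof. by rewrite lt_def normc_ge0 normc_eq0 andbT. Qed.

Lemma normcX z n : normc (z ^+ n) = normc z ^+ n.
Proof.
elim: n => [|n IH]; first by rewrite !expr0 Normc.normc1.
by rewrite !exprS Normc.normcM IH.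
Qed.

Lemma normc_real x : normc x%:C = `|x|.
Proof. by rewrite /= expr0n /= addr0 sqrtr_sqr. Qed.

Lemma normc_i : normc ('i : R[i]) = 1.
Proof. by rewrite /= expr0n /= add0r expr1n sqrtr1. Qed.

Lemma normcB z w : normc (z - w) <= normc z + normc w.
Proof. by rewrite -(normcN w) le_normcD. Qed.

Lemma normc_distC z w : normc (z - w) = normc (w - z).
Proof. by rewrite -normcN opprB. Qed.

Lemma normc_triB z w : normc z - normc w <= normc (z - w).
Proof. by rewrite lerBlDr -{1}(subrK w z) le_normcD. Qed.

Lemma normc_dist3 z w h : normc (z - w) <= normc (z - h) + normc (h - w).
Proof. by rewrite (_ : z - w = (z - h) + (h - w)) ?le_normcD// addrA subrK. Qed.

Lemma normc_sum (I : Type) (r : seq I) (P : pred I) (F : I -> R[i]) :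
  normc (\sum_(i <- r | P i) F i) <= \sum_(i <- r | P i) normc (F i).
Proof.
elim/big_ind2 : _ => //; first by rewrite Normc.normc0.
by move=> x1 y1 x2 y2 H1 H2; rewrite (le_trans (le_normcD _ _))// lerD.
Qed.

Lemma Re_normc z : `|complex.Re z| <= normc z.
Proof. by case: z => a b /=; rewrite -sqrtr_sqr ler_wsqrtr// lerDl sqr_ge0. Qed.

Lemma Im_normc z : `|complex.Im z| <= normc z.
Proof. by case: z => a b /=; rewrite -sqrtr_sqr ler_wsqrtr// lerDr sqr_ge0. Qed.

Lemma normc_ReIm z : normc z <= `|complex.Re z| + `|complex.Im z|.
Proof.
rewrite [in leLHS](complexE z) (le_trans (le_normcD _ _))//.
by rewrite Normc.normcM !normc_real normc_i mul1r.
Qed.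

Lemma sqr_normc_ReIm z : normc z ^+ 2 = complex.Re z ^+ 2 + complex.Im z ^+ 2.
Proof. by case: z => a b /=; rewrite sqr_sqrtr// addr_ge0 ?sqr_ge0. Qed.

(** Complex derivability of [g] at [z], with the topology of [R[i]] unfolded
    into real epsilons. *)
Definition cdiff (g : R[i] -> R[i]) z d := forall e : R, 0 < e ->
  exists2 r : R, 0 < r & forall h, normc h < r ->
    normc (g (z + h) - g z - d * h) <= e * normc h.

Definition dv (g : R[i] -> R[i]) z := derivable (g : R[i]^o -> R[i]^o) z 1.

Lemma pos_complexP (e : R[i]) : 0 < e -> exists2 e' : R, 0 < e' & e = e'%:C.
Proof.
case: e => a b; rewrite ltcE /= => /andP[/eqP -> a0]; by exists a.
Qed.

Lemma dvP g z : dv g z <-> exists d, cdiff g z d.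
Proof.
split.
- move=> /cvg_ex [/= d /cvgrPdist_le H]; exists d => e e0.
  have /H : 0 < e%:C :> R[i] by rewrite ltcR.
  rewrite /dnbhs /= near_withinE => /nbhs_ballP [r' r'0 rb].
  have [r r0 rE] := pos_complexP r'0.
  exists r => // h hr; have [->|h0] := eqVneq h 0.
    by rewrite addr0 subrr mulr0 subrr Normc.normc0 mulr0.
  have := rb h; rewrite /ball /= sub0r normrN normcRE rE ltcR => /(_ hr h0).
  rewrite normcRE lecR /= => Hh.
  rewrite (_ : g (z + h) - g z - d * h = - (h * (d - h^-1 *: (g (h *: 1 + z) - g z)))).
    rewrite normcN Normc.normcM mulrC ler_wpM2r ?normc_ge0//.
  rewrite mulrBr /GRing.scale /= mulrA divff// mul1r mulr1 opprB [h + z]addrC.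
  by rewrite [h * d]mulrC.
- move=> [d H]; apply/cvg_ex; exists d; apply/cvgrPdist_le => e0 e00.
  have [e epos ->] := pos_complexP e00.
  have [r r0 rb] := H e epos.
  rewrite /dnbhs /= near_withinE; apply/nbhs_ballP; exists r%:C => /=.
    by rewrite ltcR.
  move=> h; rewrite /ball /= sub0r normrN normcRE ltcR => hr h0.
  rewrite normcRE lecR /=.
  have := rb h hr.
  rewrite (_ : g (z + h) - g z - d * h = - (h * (d - h^-1 *: (g (h *: 1 + z) - g z)))).
    rewrite normcN Normc.normcM mulrC ler_pM2r ?normc_gt0//.
  rewrite mulrBr /GRing.scale /= mulrA divff// mul1r mulr1 opprB [h + z]addrC.
  by rewrite [h * d]mulrC.
Qed.

Lemma dv_cst c z : dv (fun=> c) z.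
Proof. exact: derivable_cst. Qed.

Lemma dv_id z : dv id z.
Proof. exact: derivable_id. Qed.

Lemma dvD f g z : dv f z -> dv g z -> dv (fun w => f w + g w) z.
Proof. exact: derivableD. Qed.

Lemma dvN f z : dv f z -> dv (fun w => - f w) z.
Proof. exact: derivableN. Qed.

Lemma dvB f g z : dv f z -> dv g z -> dv (fun w => f w - g w) z.
Proof. exact: derivableB. Qed.

Lemma dvM f g z : dv f z -> dv g z -> dv (fun w => f w * g w) z.
Proof. exact: derivableM. Qed.

Lemma dvV f z : f z != 0 -> dv f z -> dv (fun w => (f w)^-1) z.
Proof. exact: derivableV. Qed.

Lemma dv_comp f g z : dv f z -> dv g (f z) -> dv (fun w => g (f w)) z.
Proof.
move=> /derivable1_diffP df /derivable1_diffP dg.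
by apply/derivable1_diffP; exact: (differentiable_comp df dg).
Qed.

Lemma dv_horner (p : {poly R[i]}) z : dv (fun w => p.[w]) z.
Proof.
elim/poly_ind: p => [|p c IH].
  have -> : (fun w : R[i] => (0 : {poly R[i]}).[w]) = fun=> 0.
    by apply/funext => w; rewrite horner0.
  exact: dv_cst.
have -> : (fun w : R[i] => (p * 'X + c%:P).[w]) = fun w => p.[w] * w + c.
  by apply/funext => w; rewrite hornerMXaddC.
exact (dvD (dvM IH (@dv_id z)) (@dv_cst c z)).
Qed.

(** Continuity at a point, with real epsilons. *)
Definition ccont (g : R[i] -> R[i]) z := forall e : R, 0 < e ->
  exists2 r : R, 0 < r & forall h, normc h < r -> normc (g (z + h) - g z) <= e.

Lemma dv_ccont g z : dv g z -> ccont g z.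
Proof.
move=> /dvP[d H] e e0; have [r r0 rb] := H 1 ltr01.
have D0 : 0 < 1 + normc d by rewrite (lt_le_trans ltr01)// lerDl normc_ge0.
exists (Num.min r (e / (1 + normc d))); first by rewrite lt_min r0 divr_gt0.
move=> h; rewrite lt_min => /andP[hr]; rewrite ltr_pdivlMr// => he.
rewrite -(subrK (d * h) (g (z + h) - g z)).
rewrite (le_trans (le_normcD _ _))// Normc.normcM.
rewrite (le_trans (lerD (rb _ hr) (lexx _)))// -mulrDl mulrC.
exact: ltW.
Qed.

End NormC.

(** * The complex exponential *)

Section ComplexExp.
Context {R : realType}.
Implicit Types (z w h : R[i]) (x y : R).

Lemma derive_eps (f : R -> R) x d : is_derive x 1 f d ->
  forall e, 0 < e -> exists2 r : R, 0 < r & forall h : R, `|h| < r ->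
    `|f (x + h) - f x - d * h| <= e * `|h|.
Proof.
move=> [df dE] e e0; move/cvg_ex: df => [l Hl].
have ld : l = d by rewrite -dE; apply/esym/cvg_lim.
move/cvgrPdist_le: Hl => /(_ e e0); rewrite /dnbhs /= near_withinE.
move=> /nbhs_ballP [r r0 rb]; exists r => // h hr.
have [->|h0] := eqVneq h 0; first by rewrite addr0 subrr mulr0 subrr normr0 mulr0.
have := rb h; rewrite /ball /= sub0r normrN => /(_ hr h0).
rewrite ld => H; rewrite (_ : _ - _ = - (h * (d - h^-1 * (f (h *: 1 + x) - f x)))).
  by rewrite normrN normrM mulrC ler_pM2r ?normr_gt0.
by rewrite mulrBr mulrA divff// mul1r /GRing.scale /= mulr1 [h + x]addrC; ring.
Qed.

Definition cexp z : R[i] :=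
  (expR (complex.Re z) * cos (complex.Im z)) +i*
  (expR (complex.Re z) * sin (complex.Im z)).

Lemma cexpD z w : cexp (z + w) = cexp z * cexp w.
Proof.
case: z => a b; case: w => c d; rewrite /cexp /=.
by apply/eqP; rewrite eq_complex /= cosD sinD expRD; apply/andP; split; apply/eqP; ring.
Qed.

Lemma cexp0 : cexp 0 = 1.
Proof. by rewrite /cexp /= expR0 cos0 sin0 mulr1 mulr0. Qed.

Lemma normc_cexp z : normc (cexp z) = expR (complex.Re z).
Proof.
case: z => a b; rewrite /cexp /= !exprMn -mulrDr cos2Dsin2 mulr1 sqrtr_sqr.
by rewrite gtr0_norm// expR_gt0.
Qed.

Lemma cexp_per x y : cexp (x +i* (y + pi *+ 2)) = cexp (x +i* y).
Proof. by rewrite /cexp /= cosD2pi sinD2pi. Qed.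

(** The remainders of [exp], [cos] and [sin] at [0], each at most [k] times the
    increment, combine to at most [8 k]. *)
Lemma cdiff_cexp0 : cdiff cexp 0 1.
Proof.
move=> e e0.
pose k : R := Num.min (e / 8) 1.
have k0 : 0 < k by rewrite lt_min ltr01 andbT divr_gt0.
have ke : k <= e / 8 by rewrite ge_min lexx.
have k1 : k <= 1 by rewrite ge_min lexx orbT.
have [r1 r10 H1] := derive_eps (is_derive_expR 0) k0.
have [r2 r20 H2] := derive_eps (is_derive_cos 0) k0.
have [r3 r30 H3] := derive_eps (is_derive_sin 0) k0.
exists (Num.min (Num.min r1 r2) (Num.min r3 (k / 2))).
  by rewrite !lt_min r10 r20 r30 divr_gt0.
move=> h; rewrite !lt_min => /andP[/andP[h1 h2] /andP[h3 h4]].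
have := H1 (complex.Re h); rewrite add0r expR0 mul1r => /(_ (le_lt_trans (Re_normc h) h1)) A1.
have := H2 (complex.Im h); rewrite add0r cos0 sin0 oppr0 mul0r subr0 => /(_ (le_lt_trans (Im_normc h) h2)) A2.
have := H3 (complex.Im h); rewrite add0r cos0 sin0 subr0 mul1r => /(_ (le_lt_trans (Im_normc h) h3)) A3.
have Rh := Re_normc h; have Ih := Im_normc h.
rewrite add0r cexp0 mul1r; apply: le_trans (normc_ReIm _) _.
have hge := normc_ge0 h.
case: h h1 h2 h3 h4 A1 A2 A3 Rh Ih hge => a b; set N := normc _; rewrite /cexp /=.
move=> _ _ _ N4 A1 A2 A3 Rh Ih Nge.
have C1 := cos_max b.
have B1 : `|expR a - 1| <= 2 * `|a|.
  rewrite (_ : expR a - 1 = (expR a - 1 - a) + a); last by ring.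
  rewrite (le_trans (ler_normD _ _))// (_ : 2 * `|a| = 1 * `|a| + `|a|); last by ring.
  by rewrite lerD2r (le_trans A1)// ler_wpM2r.
have B2 : `|expR a| <= 2.
  rewrite (_ : expR a = (expR a - 1) + 1); last by ring.
  rewrite (le_trans (ler_normD _ _))// normr1; nra.
rewrite (_ : expR a * cos b - 1 - a = (expR a - 1 - a) * cos b + (1 + a) * (cos b - 1)); last by ring.
rewrite (_ : expR a * sin b - 0 - b = expR a * (sin b - b) + (expR a - 1) * b); last by ring.
have D1 : `|(expR a - 1 - a) * cos b| <= k * N.
  rewrite normrM -[leRHS]mulr1 ler_pM//.
  by rewrite (le_trans A1)// ler_wpM2l// ltW.
have D2 : `|(1 + a) * (cos b - 1)| <= 2 * (k * N).
  rewrite normrM ler_pM//.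
    by rewrite (le_trans (ler_normD _ _))// normr1; lra.
  by rewrite (le_trans A2)// ler_wpM2l// ltW.
have D3 : `|expR a * (sin b - b)| <= 2 * (k * N).
  rewrite normrM ler_pM//.
  by rewrite (le_trans A3)// ler_wpM2l// ltW.
have D4 : `|(expR a - 1) * b| <= k * N.
  rewrite normrM ler_pM//.
  by rewrite (le_trans B1)//; lra.
have T1 := ler_normD ((expR a - 1 - a) * cos b) ((1 + a) * (cos b - 1)).
have T2 := ler_normD (expR a * (sin b - b)) ((expR a - 1) * b).
nra.
Qed.

Lemma dv_cexp z : dv cexp z.
Proof.
apply/dvP; exists (cexp z) => e e0.
have Ez : 0 < normc (cexp z) by rewrite normc_cexp expR_gt0.
have [r r0 H] := cdiff_cexp0 (divr_gt0 e0 Ez).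
exists r => // h hr; have := H h hr; rewrite add0r cexp0 mul1r => {}H.
rewrite cexpD (_ : _ - _ = cexp z * (cexp h - 1 - h)); last by ring.
by rewrite Normc.normcM mulrC -ler_pdivlMr// mulrAC.
Qed.

End ComplexExp.

(** * Integrals over segments *)

Section SegmentIntegrals.
Context {R : realType}.
Implicit Types (f : R -> R) (G : R[i] -> R[i]) (x y a b d e t : R).

Definition intR f a b : R :=
  (\int[@lebesgue_measure R]_(t in `[a, b]) f t)%R.

Lemma cont_integrable f a b : continuous f ->
  (@lebesgue_measure R).-integrable `[a, b] (EFin \o f).
Proof.
move=> cf; apply: continuous_compact_integrable; first exact: segment_compact.
exact/continuous_subspaceT.
Qed.

Lemma intR_split f a b c : a <= b -> b <= c -> continuous f ->
  intR f a c = intR f a b + intR f b c.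
Proof.
move=> ab bc cf; rewrite /intR.
have H := @Rintegral_itvB R f (BLeft a) (BRight c) b.
have Hi : (@lebesgue_measure R).-integrable [set` Interval (BLeft a) (BRight c)] (EFin \o f).
  exact: cont_integrable.
have := H Hi; rewrite !bnd_simp => /(_ ab bc) => E.
have F := @Rintegral_itv_obnd_cbnd R b (BRight c) f.
rewrite -F; first by rewrite -E addrC subrK.
apply: integrableS (cont_integrable b c cf) => //.
exact: subset_itv_oc_cc.
Qed.

Lemma intR_cst_dist f a b c eta : a <= b -> continuous f ->
  (forall t, a <= t <= b -> `|f t - c| <= eta) ->
  `|intR f a b - c * (b - a)| <= eta * (b - a).
Proof.
move=> ab cf H; rewrite /intR.
have mab : measurable `[a, b] by [].
have fi := cont_integrable a b cf.
have ci k : (@lebesgue_measure R).-integrable `[a, b] (EFin \o (fun=> k : R)).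
  by apply: cont_integrable => ?; exact: cvg_cst.
have cst k : (\int[@lebesgue_measure R]_(t in `[a, b]) k)%R = k * (b - a).
  rewrite Rintegral_cst//= lebesgue_measure_itv /= lte_fin.
  by case: ltP => // ba; rewrite /= (_ : b = a) ?subrr//; apply/eqP; rewrite eq_le ab ba.
rewrite ler_distl -mulrBl -mulrDl -!cst; apply/andP; split; apply: le_Rintegral => // t;
  rewrite /= in_itv /= => /H; rewrite ler_distl => /andP[]//.
Qed.

Definition ccontinuous G := forall z, ccont G z.

Lemma continuous_Re_line G z w : ccontinuous G ->
  continuous (fun t : R => complex.Re (G (z + t%:C * w))).
Proof.
move=> cG t; apply/cvgrPdist_le => e e0.
have [r r0 H] := cG (z + t%:C * w) e e0.
have W0 : 0 < 1 + normc w by rewrite ltr_pwDl// normc_ge0.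
apply/nbhs_ballP; exists (r / (1 + normc w)) => /=; first by rewrite divr_gt0.
move=> s; rewrite /ball /= ltr_pdivlMr// => ts.
rewrite distrC -raddfB (le_trans (Re_normc _))//.
have := H ((s - t)%:C * w); rewrite Normc.normcM normc_real.
rewrite (_ : z + t%:C * w + _ = z + s%:C * w); last first.
  by rewrite rmorphB /=; ring.
apply; rewrite distrC (le_lt_trans _ ts)// ler_wpM2l// lerDr ler01//.
Qed.

Lemma continuous_Im_line G z w : ccontinuous G ->
  continuous (fun t : R => complex.Im (G (z + t%:C * w))).
Proof.
move=> cG t; apply/cvgrPdist_le => e e0.
have [r r0 H] := cG (z + t%:C * w) e e0.
have W0 : 0 < 1 + normc w by rewrite ltr_pwDl// normc_ge0.
apply/nbhs_ballP; exists (r / (1 + normc w)) => /=; first by rewrite divr_gt0.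
move=> s; rewrite /ball /= ltr_pdivlMr// => ts.
rewrite distrC -raddfB (le_trans (Im_normc _))//.
have := H ((s - t)%:C * w); rewrite Normc.normcM normc_real.
rewrite (_ : z + t%:C * w + _ = z + s%:C * w); last first.
  by rewrite rmorphB /=; ring.
apply; rewrite distrC (le_lt_trans _ ts)// ler_wpM2l// lerDr ler01//.
Qed.

End SegmentIntegrals.

(** * Goursat's theorem on rectangles and the mean value inequality *)

Section Goursat.
Context {R : realType}.
Implicit Types (f : R -> R) (G : R[i] -> R[i]) (x y a b d e t : R).

Lemma intRD f g a b : continuous f -> continuous g ->
  intR (fun t => f t + g t) a b = intR f a b + intR g a b.
Proof. by move=> cf cg; apply: RintegralD => //; exact: cont_integrable. Qed.

Lemma cont_hRe G y : ccontinuous G -> continuous (fun t : R => complex.Re (G (t +i* y))).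
Proof.
move=> cG; rewrite (_ : (fun t => _) = fun t => complex.Re (G ((0 +i* y) + t%:C * 1))).
  exact: continuous_Re_line.
apply/funext => t; do 2 congr (_ _); rewrite mulr1.
by apply/eqP; rewrite eq_complex /= add0r addr0 !eqxx.
Qed.

Lemma cont_vIm G x : ccontinuous G -> continuous (fun t : R => complex.Im (G (x +i* t))).
Proof.
move=> cG; rewrite (_ : (fun t => _) = fun t => complex.Im (G (x%:C + t%:C * 'i))).
  exact: continuous_Im_line.
apply/funext => t; do 2 congr (_ _).
by apply/eqP; rewrite eq_complex /= !mulr0 !mulr1 subr0 !addr0 add0r !eqxx.
Qed.

Lemma cont_sub f g : continuous f -> continuous g -> continuous (fun t => f t - g t).
Proof. by move=> cf cg t; apply: cvgB; [exact: cf|exact: cg]. Qed.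

(** The real part of the integral of [G dz] along the boundary of the
    rectangle with lower left corner [x + iy] and sides [d], [e]. *)
Definition rectE G x y d e : R :=
  intR (fun t => complex.Re (G (t +i* y)) - complex.Re (G (t +i* (y + e)))) x (x + d)
  - intR (fun t => complex.Im (G ((x + d) +i* t)) - complex.Im (G (x +i* t))) y (y + e).

Lemma rectE_splitx G x y d d' e : ccontinuous G -> 0 <= d -> 0 <= d' ->
  rectE G x y (d + d') e = rectE G x y d e + rectE G (x + d) y d' e.
Proof.
move=> cG d0 d0'; rewrite /rectE.
have ch k := cont_hRe (y := k) cG; have cv k := cont_vIm (x := k) cG.
rewrite (@intR_split _ _ x (x + d) (x + (d + d')))//; first last.
- exact: cont_sub.
- by rewrite lerD2l lerDl.
- by rewrite lerDl.
set A1 := intR _ x _; rewrite [x + (d + d')]addrA; set A2 := intR _ (x + d) _.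
have -> : intR (fun t => complex.Im (G ((x + d + d') +i* t)) - complex.Im (G (x +i* t))) y (y + e) =
   intR (fun t => complex.Im (G ((x + d) +i* t)) - complex.Im (G (x +i* t))) y (y + e) +
   intR (fun t => complex.Im (G ((x + d + d') +i* t)) - complex.Im (G ((x + d) +i* t))) y (y + e).
  rewrite -intRD; try exact: cont_sub.
  by congr intR; apply/funext => t; rewrite [RHS]addrC addrA subrK.
by rewrite opprD addrACA.
Qed.

Lemma rectE_splity G x y d e e' : ccontinuous G -> 0 <= e -> 0 <= e' ->
  rectE G x y d (e + e') = rectE G x y d e + rectE G x (y + e) d e'.
Proof.
move=> cG e0 e0'; rewrite /rectE.
have ch k := cont_hRe (y := k) cG; have cv k := cont_vIm (x := k) cG.
rewrite [X in _ - X](@intR_split _ _ y (y + e) (y + (e + e')))//; first last.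
- exact: cont_sub.
- by rewrite lerD2l lerDl.
- by rewrite lerDl.
rewrite [y + (e + e')]addrA [x + d]lock; set A1 := intR _ y _; set A2 := intR _ (y + e) _; rewrite -lock.
have -> : intR (fun t => complex.Re (G (t +i* y)) - complex.Re (G (t +i* (y + e + e')))) x (x + d) =
   intR (fun t => complex.Re (G (t +i* y)) - complex.Re (G (t +i* (y + e)))) x (x + d) +
   intR (fun t => complex.Re (G (t +i* (y + e))) - complex.Re (G (t +i* (y + e + e')))) x (x + d).
  rewrite -intRD; try exact: cont_sub.
  by congr intR; apply/funext => t; rewrite addrA subrK.
by rewrite opprD addrACA.
Qed.

(** Bisecting both sides, one of the four quarters carries at least a quarter
    of the circulation. *)
Lemma rectE_quadrant G x y d e : ccontinuous G -> 0 <= d -> 0 <= e ->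
  exists q : R * R, [/\ x <= q.1, q.1 + d <= x + (d + d), y <= q.2,
    q.2 + e <= y + (e + e) &
    `|rectE G x y (d + d) (e + e)| <= 4 * `|rectE G q.1 q.2 d e|].
Proof.
move=> cG d0 e0; rewrite rectE_splitx// !rectE_splity//.
set E1 := rectE G x y d e; set E2 := rectE G x (y + e) d e.
set E3 := rectE G (x + d) y d e; set E4 := rectE G (x + d) (y + e) d e.
have T : `|E1 + E2 + (E3 + E4)| <= `|E1| + `|E2| + (`|E3| + `|E4|).
  by rewrite (le_trans (ler_normD _ _))// lerD// ler_normD.
apply: contrapT => H.
have N q : x <= q.1 -> q.1 + d <= x + (d + d) -> y <= q.2 ->
    q.2 + e <= y + (e + e) ->
    4 * `|rectE G q.1 q.2 d e| < `|E1 + E2 + (E3 + E4)|.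
  by move=> *; rewrite ltNge; apply/negP => h; apply: H; exists q.
have := N (x, y); have := N (x, y + e); have := N (x + d, y); have := N (x + d, y + e).
rewrite /= -/E1 -/E2 -/E3 -/E4 => h1 h2 h3 h4.
have {}h1 : 4 * `|E4| < `|E1 + E2 + (E3 + E4)| by apply: h1; lra.
have {}h2 : 4 * `|E3| < `|E1 + E2 + (E3 + E4)| by apply: h2; lra.
have {}h3 : 4 * `|E2| < `|E1 + E2 + (E3 + E4)| by apply: h3; lra.
have {}h4 : 4 * `|E1| < `|E1 + E2 + (E3 + E4)| by apply: h4; lra.
lra.
Qed.

Lemma nested_point (u l : nat -> R) : (forall n, u n <= u n.+1) ->
  (forall n, u n.+1 + l n.+1 <= u n + l n) -> (forall n, 0 <= l n) ->
  exists X, forall n, u n <= X <= u n + l n.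
Proof.
move=> um lm l0.
have um' m n : (m <= n)%N -> u m <= u n.
  by move=> mn; apply: (homo_leq (f := u) (r := <=%R)) => //; exact: le_trans.
have lm' m n : (m <= n)%N -> u n + l n <= u m + l m.
  move=> mn; apply: (@homo_leq _ (fun k => u k + l k) (fun x y : R => y <= x)) => //.
  by move=> ? ? ? h1 h2; exact: le_trans h2 h1.
have ub n m : u m <= u n + l n.
  case: (leqP m n) => mn; first by rewrite (le_trans (um' _ _ mn))// lerDl.
  by rewrite (le_trans _ (lm' _ _ (ltnW mn)))// lerDl.
exists (sup (range u)) => n; apply/andP; split.
- by apply: sup_upper_bound; [split; [exists (u 0%N), 0%N|exists (u 0%N + l 0%N) => _ [m _ <-]; exact: ub]|exists n].
- by apply: ge_sup; [exists (u 0%N), 0%N|move=> _ [m _ <-]; exact: ub].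
Qed.

(** Up to first order, [G] is affine near a point of derivability, and affine
    functions have zero circulation around rectangles. *)
Lemma rectE_small G x y d e (X : R[i]) c eta : ccontinuous G -> 0 <= d -> 0 <= e -> 0 <= eta ->
  (forall s t, x <= s <= x + d -> y <= t <= y + e ->
    normc (G (s +i* t) - G X - c * ((s +i* t) - X)) <= eta) ->
  `|rectE G x y d e| <= 2 * eta * (d + e).
Proof.
move=> cG d0 e0 eta0 H.
have ch k := cont_hRe (y := k) cG; have cv k := cont_vIm (x := k) cG.
have := @intR_cst_dist R (fun t => complex.Re (G (t +i* y)) - complex.Re (G (t +i* (y + e))))
  x (x + d) (complex.Im c * e) (2 * eta).
have := @intR_cst_dist R (fun t => complex.Im (G ((x + d) +i* t)) - complex.Im (G (x +i* t)))
  y (y + e) (complex.Im c * d) (2 * eta).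
rewrite !lerDl => /(_ e0 (cont_sub (cv _) (cv _))) I2 /(_ d0 (cont_sub (ch _) (ch _))) I1.
have {}I1 := I1 _; have {}I2 := I2 _.
have J1 : forall t, x <= t <= x + d ->
    `|complex.Re (G (t +i* y)) - complex.Re (G (t +i* (y + e))) - complex.Im c * e| <= 2 * eta.
  move=> t tx; have := H t y tx; rewrite lexx lerDl => /(_ e0) h1.
  have := H t (y + e) tx; rewrite lexx lerDl e0 => /(_ isT) h2.
  have := le_trans (Re_normc _) (le_trans (normcB _ _) (lerD h1 h2)).
  rewrite -mulr2n mulr_natl; apply: le_trans; rewrite le_eqVlt; apply/orP; left; apply/eqP; congr `|_|.
  case: (G (t +i* y)) => ? ?; case: (G (t +i* _)) => ? ?; case: (G X) => ? ?.
  by case: c {H h1 h2 I1 I2} => ? ?; case: X => ? ? /=; ring.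
have J2 : forall t, y <= t <= y + e ->
    `|complex.Im (G ((x + d) +i* t)) - complex.Im (G (x +i* t)) - complex.Im c * d| <= 2 * eta.
  move=> t ty; have := H x t _ ty; rewrite lexx lerDl => /(_ d0) h1.
  have := H (x + d) t _ ty; rewrite lexx lerDl d0 => /(_ isT) h2.
  have := le_trans (Im_normc _) (le_trans (normcB _ _) (lerD h2 h1)).
  rewrite -mulr2n mulr_natl; apply: le_trans; rewrite le_eqVlt; apply/orP; left; apply/eqP; congr `|_|.
  case: (G ((x + d) +i* t)) => ? ?; case: (G (x +i* _)) => ? ?; case: (G X) => ? ?.
  by case: c {H h1 h2 I1 I2 J1} => ? ?; case: X => ? ? /=; ring.
have {I1 J1}I1 := I1 J1; have {I2 J2}I2 := I2 J2.
rewrite /rectE; move: I1 I2; set E1 := intR _ x _; set E2 := intR _ y _.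
rewrite [x + d - x]addrAC [y + e - y]addrAC !subrr !add0r => I1 I2.
rewrite (_ : E1 - E2 = (E1 - complex.Im c * e * d) - (E2 - complex.Im c * d * e)); last by ring.
rewrite (le_trans (ler_normB _ _))//; lra.
Qed.

(** The circulation around the nested quarters is at least [4 ^ -n] times the
    initial one, while at their common point derivability makes it
    [o(4 ^ -n)]. *)
Theorem goursat G x y d e : ccontinuous G -> 0 <= d -> 0 <= e ->
  (forall s t, x <= s <= x + d -> y <= t <= y + e -> dv G (s +i* t)) ->
  rectE G x y d e = 0.
Proof.
move=> cG d0 e0 H.
pose dn n : R := d / 2 ^+ n; pose en n : R := e / 2 ^+ n.
have p2 n : 0 < 2 ^+ n :> R by rewrite exprn_gt0.
have dn0 n : 0 <= dn n by rewrite divr_ge0// ltW.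
have en0 n : 0 <= en n by rewrite divr_ge0// ltW.
have dnS n : dn n = dn n.+1 + dn n.+1.
  by rewrite /dn exprS; field; rewrite gt_eqF.
have enS n : en n = en n.+1 + en n.+1.
  by rewrite /en exprS; field; rewrite gt_eqF.
have [nxt Hn] := choice (fun np : nat * (R * R) =>
  @rectE_quadrant G np.2.1 np.2.2 (dn np.1.+1) (en np.1.+1) cG (dn0 _) (en0 _)).
pose S := fix S n : R * R := if n is m.+1 then nxt (m, S m) else (x, y).
have HS n : [/\ (S n).1 <= (S n.+1).1, (S n.+1).1 + dn n.+1 <= (S n).1 + dn n,
   (S n).2 <= (S n.+1).2, (S n.+1).2 + en n.+1 <= (S n).2 + en n &
   `|rectE G (S n).1 (S n).2 (dn n) (en n)| <=
      4 * `|rectE G (S n.+1).1 (S n.+1).2 (dn n.+1) (en n.+1)|].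
  by have := Hn (n, S n); rewrite /= -dnS -enS.
have [X HX] := @nested_point (fun n => (S n).1) dn
  (fun n => let: And5 h _ _ _ _ := HS n in h) (fun n => let: And5 _ h _ _ _ := HS n in h) dn0.
have [Y HY] := @nested_point (fun n => (S n).2) en
  (fun n => let: And5 _ _ h _ _ := HS n in h) (fun n => let: And5 _ _ _ h _ := HS n in h) en0.
have HE n : `|rectE G x y d e| <= 4 ^+ n * `|rectE G (S n).1 (S n).2 (dn n) (en n)|.
  elim: n => [|n IH]; first by rewrite /dn /en /= !divr1 mul1r.
  rewrite (le_trans IH)// exprSr -mulrA ler_wpM2l ?exprn_ge0//.
  by have [] := HS n.
have HXY : dv G (X +i* Y).
  by apply: H; [have := HX 0%N|have := HY 0%N]; rewrite /dn /en /= divr1.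
have [c Hc] := (dvP _ _).1 HXY.
apply/eqP; rewrite -normr_le0; apply/ler_addgt0Pl => eps eps0; rewrite addr0.
pose L := d + e + 1; have L0 : 0 < L by rewrite /L; lra.
have k0 : 0 < eps / (2 * L ^+ 2) by rewrite divr_gt0// mulr_gt0// exprn_gt0.
have [r r0 Hr] := Hc _ k0.
have [n Hnr] : exists n, L / 2 ^+ n < r.
  exists (Num.bound (L / r)).
  by rewrite ltr_pdivrMr ?p2// mulrC -ltr_pdivrMr//; exact: upper_nthrootP.
have Hde : dn n + en n <= L / 2 ^+ n.
  by rewrite /dn /en -mulrDl ler_pM2r ?invr_gt0// /L; lra.
have hX := HX n; have hY := HY n.
have B : `|rectE G (S n).1 (S n).2 (dn n) (en n)| <=
    2 * (eps / (2 * L ^+ 2) * (L / 2 ^+ n)) * (dn n + en n).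
  apply: (@rectE_small _ _ _ _ _ (X +i* Y) c) => //.
    by rewrite mulr_ge0 ?divr_ge0 ?ltW// mulr_gt0// exprn_gt0.
  move=> s t hs ht; set h := (s +i* t) - (X +i* Y).
  have hE : (s +i* t) = (X +i* Y) + h by rewrite /h addrC subrK.
  have hn : normc h <= L / 2 ^+ n.
    rewrite (le_trans _ Hde)// (le_trans (normc_ReIm _))// /h /= lerD// ler_norml; lra.
  have := Hr h (le_lt_trans hn Hnr); rewrite -hE => /le_trans; apply.
  by rewrite ler_wpM2l// ltW.
rewrite (le_trans (HE n))// (le_trans (ler_wpM2l _ B)) ?exprn_ge0//.
have -> : (4 : R) ^+ n = 2 ^+ n * 2 ^+ n by rewrite -exprMn -natrM.
have p2n := p2 n.
apply: (@le_trans _ _ (2 ^+ n * 2 ^+ n * (2 * (eps / (2 * L ^+ 2) * (L / 2 ^+ n)) * (L / 2 ^+ n)))).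
  apply: ler_wpM2l; first by rewrite mulr_ge0 ?ltW.
  apply: ler_wpM2l => //; rewrite mulr_ge0// mulr_ge0 ?(ltW k0)//.
  by rewrite divr_ge0 ?(ltW L0)// ltW.
rewrite le_eqVlt; apply/orP; left; apply/eqP; field.
by rewrite !gt_eqF.
Qed.

Lemma intR_ge_cst f a b c : a <= b -> continuous f -> (forall t, a <= t <= b -> c <= f t) ->
  c * (b - a) <= intR f a b.
Proof.
move=> ab cf H; have mab : measurable `[a, b] by [].
have fi := cont_integrable a b cf.
have ci k : (@lebesgue_measure R).-integrable `[a, b] (EFin \o (fun=> k : R)).
  by apply: cont_integrable => ?; exact: cvg_cst.
have -> : c * (b - a) = (\int[@lebesgue_measure R]_(t in `[a, b]) c)%R.
  rewrite Rintegral_cst//= lebesgue_measure_itv /= lte_fin.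
  by case: ltP => // ba; rewrite /= (_ : b = a) ?subrr//; apply/eqP; rewrite eq_le ab ba.
by apply: le_Rintegral => // t; rewrite /= in_itv /= => /H.
Qed.

(** Mean value property in the form needed for the maximum principle. In the
    coordinate [w = log (z - z0)] the circles around [z0] are vertical
    segments of length [2 pi], and shrinking them corresponds to [Re w] going
    to [-oo]; this is why [g] need not be derivable at [z0] itself. *)
Lemma mean_value_le (g : R[i] -> R[i]) (z0 : R[i]) (r c : R) : ccontinuous g -> 0 < r ->
  (forall h, 0 < normc h -> normc h <= r -> dv g (z0 + h)) ->
  (forall h, normc h = r -> complex.Re (g (z0 + h)) <= c) ->
  complex.Re (g z0) <= c.
Proof.
move=> cg r0 dg gc; apply/ler_addgt0Pl => eta eta0.
have [r1 r10 H1] := cg z0 eta eta0.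
pose r2 := Num.min r (r1 / 2).
have r20 : 0 < r2 by rewrite lt_min r0 divr_gt0.
have r2r : r2 <= r by rewrite ge_min lexx.
have r21 : r2 < r1 by rewrite gt_min; apply/orP; right; rewrite ltr_pdivrMr// ltr_pMr// ltr1n.
pose G w : R[i] := 'i * g (z0 + cexp w).
have cexpc : ccontinuous (@cexp R) by move=> z; apply: dv_ccont; exact: dv_cexp.
have cG : ccontinuous G.
  move=> z e e0; have [a a0 Ha] := cg (z0 + cexp z) e e0.
  have a20 : 0 < a / 2 by rewrite divr_gt0.
  have [b b0 Hb] := cexpc z _ a20; exists b => // h hb.
  rewrite /G -mulrBr Normc.normcM normc_i mul1r.
  have := Ha (cexp (z + h) - cexp z).
  rewrite -addrA [cexp z + _]addrC subrK; apply.
  by rewrite (le_lt_trans (Hb _ hb))// ltr_pdivrMr// ltr_pMr// ltr1n.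
have lr : ln r2 <= ln r by rewrite ler_ln// posrE.
have := @goursat G (ln r2) 0 (ln r - ln r2) (pi *+ 2) cG.
rewrite subr_ge0 lr mulrn_wge0 ?pi_ge0// => /(_ isT isT).
have dG s t : ln r2 <= s <= ln r2 + (ln r - ln r2) -> 0 <= t <= 0 + pi *+ 2 -> dv G (s +i* t).
  rewrite addrC subrK => /andP[_ sr] _; apply: dvM; first exact: dv_cst.
  apply: (@dv_comp _ (fun w => z0 + cexp w)); first by apply: dvD; [exact: dv_cst|exact: dv_cexp].
  apply: dg; rewrite normc_cexp ?expR_gt0//=.
  by rewrite -[leRHS]lnK ?posrE// ler_expR.
move=> /(_ dG); rewrite /rectE.
rewrite (_ : (fun t => _) = fun=> 0); last first.
  by apply/funext => t; rewrite /G cexp_per subrr.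
rewrite [ln r2 + _]addrC subrK add0r.
have -> : intR (fun=> 0) (ln r2) (ln r) = 0 :> R.
  by rewrite /intR Rintegral_cst// mul0r.
rewrite sub0r; set f := (X in intR X); move=> /eqP; rewrite oppr_eq0 => /eqP E0.
have cf : continuous f by apply: cont_sub; exact: cont_vIm.
rewrite leNgt; apply/negP => H.
have ImG w : complex.Im (G w) = complex.Re (g (z0 + cexp w)).
  by rewrite /G mulrC ImiRe.
have := @intR_ge_cst (fun t => - f t) 0 (pi *+ 2) (complex.Re (g z0) - eta - c).
have mf : continuous (fun t => - f t).
  by move=> t; apply: cvgN; exact: cf.
rewrite mulrn_wge0 ?pi_ge0// => /(_ isT mf).
have -> : intR (fun t => - f t) 0 (pi *+ 2) = 0.
  have := intRD 0 (pi *+ 2) cf mf; rewrite E0 add0r => <-.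
  by rewrite (_ : (fun t => f t + - f t) = fun=> 0) ?/intR ?Rintegral_cst// ?mul0r//; apply/funext => t; rewrite subrr.
rewrite subr0 => P; suff : (complex.Re (g z0) - eta - c) * (pi *+ 2) <= 0.
  by apply/negP; rewrite -ltNge mulr_gt0//; [lra|rewrite pmulrn_lgt0 ?pi_gt0].
apply: P => t _; rewrite /f opprB !ImG.
have A : complex.Re (g (z0 + cexp (ln r +i* t))) <= c.
  by apply: gc; rewrite normc_cexp /= lnK// posrE.
have := H1 (cexp (ln r2 +i* t)); rewrite normc_cexp /= lnK ?posrE// => /(_ r21) B.
have := le_trans (Re_normc _) B; rewrite raddfB /= ler_norml; lra.
Qed.

End Goursat.

(** * Maximum principle *)

Section MaximumPrinciple.
Context {R : realType}.
Implicit Types (z w h : R[i]) (g : R[i] -> R[i]) (K : set R[i]).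

Definition cclosed K := forall z,
  (forall e : R, 0 < e -> exists2 w, K w & normc (w - z) < e) -> K z.

Definition cbounded K := exists rho : R, forall z, K z -> normc z <= rho.

Definition crcont (v : R[i] -> R) := forall z (e : R), 0 < e ->
  exists2 r : R, 0 < r & forall h, normc h < r -> `|v (z + h) - v z| <= e.

Lemma compact_argmax K (v : R[i] -> R) : cclosed K -> cbounded K -> crcont v ->
  K !=set0 -> exists2 z, K z & forall w, K w -> v w <= v z.
Proof.
move=> clK [rho bK] cv [k0 Kk0].
pose pr (p : R * R) : R[i] := p.1 +i* p.2.
pose K' := [set p : R * R | K (pr p)].
have prB (p q : R * R) (e : R) : ball p (e / 2) q -> normc (pr q - pr p) < e.
  move=> [b1 b2]; rewrite (le_lt_trans (normc_ReIm _))// [e]splitr ltrD//=.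
    by rewrite distrC.
  by rewrite distrC.
have cK' : compact K'.
  apply: (@subclosed_compact _ _ (`[- rho, rho] `*` `[- rho, rho])).
  - move=> p Hp; apply: clK => e e0.
    have e20 : 0 < e / 2 by rewrite divr_gt0.
    have [q [Kq bq]] := Hp _ (nbhsx_ballx p (e / 2) e20).
    by exists (pr q) => //; exact: prB.
  - by apply: compact_setX; exact: segment_compact.
  - move=> p /= /bK Kp; rewrite !in_itv /= -!ler_norml.
    by split; [have := Re_normc (pr p)|have := Im_normc (pr p)] => /le_trans; apply.
have cf : continuous (v \o pr).
  move=> p; apply/cvgrPdist_le => e e0; have [r r0 Hr] := cv (pr p) e e0.
  have r20 : 0 < r / 2 by rewrite divr_gt0.
  apply: filterS (nbhsx_ballx p (r / 2) r20) => q /prB bq /=.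
  by have := Hr _ bq; rewrite [pr p + _]addrC subrK distrC.
have K'0 : K' !=set0.
  by exists (complex.Re k0, complex.Im k0); rewrite /K' /= /pr /=; case: (k0) Kk0.
have [c] := compact_EVT_max K'0 cK' (continuous_subspaceT cf).
rewrite inE => Kc Hc; exists (pr c) => // w Kw.
have := Hc (complex.Re w, complex.Im w).
by rewrite inE /K' /= /pr /=; case: w Kw => a b /= Kw; apply.
Qed.

Lemma crcont_normc g : ccontinuous g -> crcont (fun z => normc (g z)).
Proof.
move=> cg z e e0; have [r r0 H] := cg z e e0; exists r => // h /H {}H.
rewrite ler_norml lerNl opprB; apply/andP; split.
  by rewrite (le_trans (normc_triB _ _))// normc_distC.
exact: le_trans (normc_triB _ _) H.
Qed.

Lemma unimodular_rot z : exists2 u : R[i], normc u = 1 & u * z = (normc z)%:C.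
Proof.
have [->|z0] := eqVneq z 0.
  by exists 1; rewrite ?Normc.normc1// mulr0 Normc.normc0.
exists ((normc z)%:C / z).
  by rewrite Normc.normcM Normc.normcV normc_real ger0_norm ?normc_ge0// divff// normc_eq0.
by rewrite divfK.
Qed.

(** The maximum of [|g| + eps |z|^2] over [K] cannot be attained in the
    interior: there, the mean value property applied to [g] plus a linear
    term contradicts the strict subharmonicity of [eps |z|^2]. *)
Theorem maximum_principle K g (s : seq R[i]) (m : R) :
  cclosed K -> cbounded K -> ccontinuous g -> (forall z, z \notin s -> dv g z) ->
  (forall z, K z -> normc (g z) <= m \/
     exists2 e : R, 0 < e & forall w, normc (w - z) <= e -> K w) ->
  forall z, K z -> normc (g z) <= m.
Proof.
move=> clK bK cg dg bdK z1 Kz1; rewrite leNgt; apply/negP => mz1.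
have [rho Hrho] := bK.
have rho0 : 0 <= rho by rewrite (le_trans (normc_ge0 z1))// Hrho.
pose eps := (normc (g z1) - m) / (2 * (rho ^+ 2 + 1)).
have den0 : 0 < 2 * (rho ^+ 2 + 1) by rewrite mulr_gt0// ltr_wpDl// sqr_ge0.
have eps0 : 0 < eps by rewrite divr_gt0// subr_gt0.
have epsE : eps * rho ^+ 2 < normc (g z1) - m.
  rewrite /eps mulrAC ltr_pdivrMr// ltr_pM2l ?subr_gt0//.
  by have := sqr_ge0 rho; lra.
pose v z := normc (g z) + eps * normc z ^+ 2.
have cv : crcont v.
  have cid : ccontinuous (fun z => z * z) by move=> z; apply/dv_ccont/dvM; exact: dv_id.
  move=> z e e0; have e20 : 0 < e / 2 by rewrite divr_gt0.
  have [r1 r10 H1] := crcont_normc cg z e20.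
  have [r2 r20 H2] := crcont_normc cid z (divr_gt0 e20 eps0).
  exists (Num.min r1 r2); first by rewrite lt_min r10.
  move=> h; rewrite lt_min => /andP[/H1 {}H1 /H2 {}H2].
  have {}H2 : `|eps * normc (z + h) ^+ 2 - eps * normc z ^+ 2| <= e / 2.
    rewrite -mulrBr normrM gtr0_norm// mulrC -ler_pdivlMr//.
    by move: H2; rewrite !Normc.normcM.
  rewrite /v opprD addrACA (le_trans (ler_normD _ _))//.
  by rewrite [leRHS]splitr lerD.
have [z0 Kz0 Hz0] := compact_argmax clK bK cv (ex_intro _ z1 Kz1).
have vz1 := Hz0 z1 Kz1.
have gz1 : normc (g z1) <= v z1 by rewrite lerDl; apply: mulr_ge0; [exact: ltW|exact: sqr_ge0].
have [gm|[e e0 eK]] := bdK z0 Kz0.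
  have : v z0 <= m + eps * rho ^+ 2.
    apply: lerD => //; apply: ler_wpM2l; first exact: ltW.
    by rewrite lerXn2r ?nnegrE ?normc_ge0// Hrho.
  lra.
have [r [r0 re rs]] : exists r, [/\ 0 < r, r <= e &
    forall h, 0 < normc h -> normc h <= r -> z0 + h \notin s].
  elim: s {dg} => [|a s [r [r0 re IH]]]; first by exists e; split.
  have [az|az] := eqVneq a z0.
    exists r; split => // h h0 hr; rewrite inE negb_or IH// andbT az.
    by rewrite -subr_eq0 addrAC subrr add0r -normc_gt0.
  have na : 0 < normc (a - z0) by rewrite normc_gt0 subr_eq0.
  exists (Num.min r (normc (a - z0) / 2)); split.
  - by rewrite lt_min r0 divr_gt0.
  - by rewrite ge_min re.
  - move=> h h0; rewrite le_min => /andP[hr ha]; rewrite inE negb_or IH// andbT.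
    apply/eqP => E; move: ha; rewrite -E [z0 + h]addrC addrK; lra.
have [u u1 uE] := unimodular_rot (g z0).
pose c2 : R[i] := (2 * eps)%:C * (z0^*)%C.
pose G z := u * g z + c2 * (z - z0).
have cG : ccontinuous G.
  have cl : ccontinuous (fun z => c2 * (z - z0)).
    move=> z; apply: dv_ccont; apply: dvM; first exact: dv_cst.
    by apply: dvB; [exact: dv_id|exact: dv_cst].
  move=> z d d0; have d20 : 0 < d / 2 by rewrite divr_gt0.
  have [r1 r10 H1] := cg z _ d20; have [r2 r20 H2] := cl z _ d20.
  exists (Num.min r1 r2); first by rewrite lt_min r10.
  move=> h; rewrite lt_min => /andP[/H1 {}H1 /H2 {}H2].
  rewrite /G opprD addrACA (le_trans (le_normcD _ _))// [leRHS]splitr lerD//.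
  by rewrite -mulrBr Normc.normcM u1 mul1r.
have dG h : 0 < normc h -> normc h <= r -> dv G (z0 + h).
  move=> h0 hr; apply: dvD; first by apply: dvM; [exact: dv_cst|exact/dg/rs].
  apply: dvM; first exact: dv_cst.
  by apply: dvB; [exact: dv_id|exact: dv_cst].
have := @mean_value_le R G z0 r (normc (g z0) - eps * r ^+ 2) cG r0 dG.
have -> : G z0 = (normc (g z0))%:C by rewrite /G subrr mulr0 addr0.
rewrite /= => P; suff : normc (g z0) <= normc (g z0) - eps * r ^+ 2.
  by apply/negP; rewrite -ltNge ltrBlDr ltrDl mulr_gt0// exprn_gt0.
apply: P => h hr; rewrite /G raddfD /= [z0 + h]addrC addrK [h + z0]addrC.
have Kzh : K (z0 + h) by apply: eK; rewrite addrAC subrr add0r hr.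
have := Hz0 _ Kzh; rewrite /v.
have := Re_normc (u * g (z0 + h)); rewrite Normc.normcM u1 mul1r.
move=> /(le_trans (ler_norm _)) A.
rewrite !sqr_normc_ReIm -hr sqr_normc_ReIm /c2.
case: (z0) (h) A => a b [c d] /= A; rewrite !(mul0r, mulr0, subr0, addr0) => B.
have E : eps * ((a + c) ^+ 2 + (b + d) ^+ 2) = eps * (a ^+ 2 + b ^+ 2) +
  (2 * eps * a * c - 2 * eps * - b * d) + eps * (c ^+ 2 + d ^+ 2) by ring.
rewrite E in B; lra.
Qed.

Lemma cclosed_disc (rho : R) : cclosed [set z | normc z <= rho].
Proof.
move=> z H /=; apply/ler_addgt0Pl => e /H [w /= wr wz].
have := normc_triB z w; rewrite normc_distC in wz; lra.
Qed.

Lemma cbounded_disc (rho : R) : cbounded [set z | normc z <= rho].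
Proof. by exists rho. Qed.

Lemma maximum_principle_disc g (s : seq R[i]) (rho m : R) : ccontinuous g ->
  (forall z, z \notin s -> dv g z) ->
  (forall z, normc z = rho -> normc (g z) <= m) ->
  forall z, normc z <= rho -> normc (g z) <= m.
Proof.
move=> cg dg H z zr.
apply: (maximum_principle (cclosed_disc (rho := rho)) (cbounded_disc rho) cg dg) zr => w /= wr.
have [e|ne] := eqVneq (normc w) rho; first by left; exact: H.
right; exists (rho - normc w); first by rewrite subr_gt0 lt_neqAle ne.
by move=> w' h; have := normc_triB w' w; lra.
Qed.

Lemma ccontinuous_horner (p : {poly R[i]}) : ccontinuous (horner p).
Proof. by move=> z; apply: dv_ccont; exact: dv_horner. Qed.

Lemma maximum_principle_poly (p : {poly R[i]}) (rho m : R) :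
  (forall z, normc z = rho -> normc p.[z] <= m) ->
  forall z, normc z <= rho -> normc p.[z] <= m.
Proof.
apply: (@maximum_principle_disc _ [::]); first exact: ccontinuous_horner.
by move=> z _; exact: dv_horner.
Qed.

End MaximumPrinciple.

(** * Polynomial approximation of entire functions on discs *)

Section PolyApprox.
Context {R : realType}.
Implicit Types (z w h : R[i]) (g : R[i] -> R[i]).

Lemma dv_local f g z (r : R) : 0 < r ->
  (forall h, normc h < r -> f (z + h) = g (z + h)) -> dv g z -> dv f z.
Proof.
move=> r0 E /dvP[d H]; apply/dvP; exists d => e e0.
have [r1 r10 H1] := H e e0; exists (Num.min r r1); first by rewrite lt_min r0.
move=> h; rewrite lt_min => /andP[hr hr1]; rewrite E//.
by have := E 0; rewrite Normc.normc0 addr0 => ->//; exact: H1.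
Qed.

Lemma ccont_local f g z (r : R) : 0 < r ->
  (forall h, normc h < r -> f (z + h) = g (z + h)) -> ccont g z -> ccont f z.
Proof.
move=> r0 E H e e0.
have [r1 r10 H1] := H e e0; exists (Num.min r r1); first by rewrite lt_min r0.
move=> h; rewrite lt_min => /andP[hr hr1]; rewrite E//.
by have := E 0; rewrite Normc.normc0 addr0 => ->//; exact: H1.
Qed.

Lemma ccontM f g z : ccont f z -> ccont g z -> ccont (fun w => f w * g w) z.
Proof.
move=> cf cg e e0.
pose F := normc (f z); pose G := normc (g z).
have F0 : 0 <= F := normc_ge0 _; have G0 : 0 <= G := normc_ge0 _.
pose k := e / (F + G + 1 + e).
have k0 : 0 < k by rewrite divr_gt0//; lra.
have k1 : k <= 1 by rewrite ler_pdivrMr; lra.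
have kE : k * (F + G + 1) <= e.
  by rewrite /k mulrAC ler_pdivrMr; [rewrite ler_pM2l//; lra|lra].
have [r1 r10 H1] := cf k k0; have [r2 r20 H2] := cg k k0.
exists (Num.min r1 r2); first by rewrite lt_min r10.
move=> h; rewrite lt_min => /andP[/H1 {}H1 /H2 {}H2].
rewrite (_ : _ - _ = (f (z + h) - f z) * (g (z + h) - g z) + (f z * (g (z + h) - g z) +
  (f (z + h) - f z) * g z)); last by ring.
rewrite (le_trans (le_normcD _ _))//; apply: le_trans kE.
have T := le_normcD (f z * (g (z + h) - g z)) ((f (z + h) - f z) * g z).
have A : normc ((f (z + h) - f z) * (g (z + h) - g z)) <= k * 1.
  by rewrite Normc.normcM ler_pM ?normc_ge0// (le_trans H2).
have B : normc (f z * (g (z + h) - g z)) <= F * k.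
  by rewrite Normc.normcM ler_wpM2l.
have D : normc ((f (z + h) - f z) * g z) <= k * G.
  by rewrite Normc.normcM ler_wpM2r.
lra.
Qed.

Lemma ccontB f g z : ccont f z -> ccont g z -> ccont (fun w => f w - g w) z.
Proof.
move=> cf cg e e0; have e20 : 0 < e / 2 by rewrite divr_gt0.
have [r1 r10 H1] := cf _ e20; have [r2 r20 H2] := cg _ e20.
exists (Num.min r1 r2); first by rewrite lt_min r10.
move=> h; rewrite lt_min => /andP[/H1 {}H1 /H2 {}H2].
rewrite (_ : _ - _ = (f (z + h) - f z) - (g (z + h) - g z)); last by ring.
by rewrite (le_trans (normcB _ _))// [leRHS]splitr lerD.
Qed.

(** The difference quotient at [a] extends continuously to [a], but may fail
    to be derivable there; this is why finitely many exceptional points are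
    allowed throughout. *)
Lemma difference_quotient g (s : seq R[i]) a : ccontinuous g ->
  (forall z, z \notin s -> dv g z) -> a \notin s ->
  exists q : R[i] -> R[i], [/\ ccontinuous q, forall z, z \notin a :: s -> dv q z &
    forall z, g z = g a + (z - a) * q z].
Proof.
move=> cg dg as_; have [d Hd] := (dvP _ _).1 (dg _ as_).
pose q z := if z == a then d else (g z - g a) * (z - a)^-1.
have qE z : g z = g a + (z - a) * q z.
  rewrite /q; case: eqP => [->|/eqP za]; first by rewrite subrr mul0r addr0.
  by rewrite mulrCA mulfV ?subr_eq0// mulr1 addrC subrK.
have far z : z != a -> exists2 r : R, 0 < r & forall h, normc h < r ->
    q (z + h) = (g (z + h) - g a) * (z + h - a)^-1.
  move=> za; exists (normc (z - a)); first by rewrite normc_gt0 subr_eq0.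
  move=> h hz; rewrite /q; case: eqP => // E; move: hz.
  by rewrite -E opprD addrA subrr sub0r normcN ltxx.
exists q; split => // z.
- have [->|za] := eqVneq z a.
    move=> e e0; have [r r0 Hr] := Hd e e0; exists r => // h hr.
    rewrite {2}/q eqxx /q; case: eqP => [|/eqP ah].
      by rewrite subrr Normc.normc0 ltW.
    have h0 : h != 0 by move: ah; apply: contra => /eqP ->; rewrite addr0.
    have -> : a + h - a = h by rewrite addrAC subrr add0r.
    rewrite -[X in _ - X](mulfK h0) -mulrBl Normc.normcM Normc.normcV.
    by rewrite ler_pdivrMr ?normc_gt0//; exact: Hr.
  have [r r0 Hr] := far z za.
  apply: (@ccont_local _ (fun w => (g w - g a) * (w - a)^-1) _ _ r0 Hr).
  apply: ccontM.
    by apply: ccontB => //; apply: dv_ccont; exact: dv_cst.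
  apply: dv_ccont; apply: dvV; first by rewrite subr_eq0.
  by apply: dvB; [exact: dv_id|exact: dv_cst].
- rewrite inE negb_or => /andP[za zs].
  have [r r0 Hr] := far z za.
  apply: (@dv_local _ (fun w => (g w - g a) * (w - a)^-1) _ _ r0 Hr).
  apply: dvM; first by apply: dvB; [exact: dg|exact: dv_cst].
  apply: dvV; first by rewrite subr_eq0.
  by apply: dvB; [exact: dv_id|exact: dv_cst].
Qed.

(** By the maximum principle it is enough to divide on the circle of radius
    [rho], which stays at distance [rho - r] from [a]. *)
Lemma difference_quotient_bound g q (s : seq R[i]) a (r rho M : R) : ccontinuous q ->
  (forall z, z \notin s -> dv q z) -> (forall z, g z = g a + (z - a) * q z) ->
  normc a <= r -> r < rho ->
  (forall z, normc z <= rho -> normc (g z) <= M) ->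
  forall z, normc z <= rho -> normc (q z) <= 2 * M / (rho - r).
Proof.
move=> cq dq E ar rr HM; apply: (@maximum_principle_disc _ _ s) => // z zr.
have rr0 : 0 < rho - r by rewrite subr_gt0.
have Hza : rho - r <= normc (z - a) by have := normc_triB z a; lra.
rewrite ler_pdivlMr// (le_trans (ler_wpM2l (normc_ge0 _) Hza))//.
rewrite mulrC -Normc.normcM (_ : _ * _ = g z - g a); last by rewrite [g z]E addrAC subrr add0r.
rewrite (le_trans (normcB _ _))// mulr_natl mulr2n lerD// HM ?zr//.
by rewrite (le_trans ar)// ltW.
Qed.

Lemma fresh_point (s : seq R[i]) (r : R) : 0 < r -> exists2 a, normc a <= r & a \notin s.
Proof.
move=> r0; apply: contrapT => H.
pose t := [seq (r / k.+1%:R)%:C | k <- iota 0 (size s).+1] : seq R[i].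
have ut : uniq t.
  rewrite map_inj_in_uniq ?iota_uniq// => i j _ _ /complexI /(mulfI (lt0r_neq0 r0)).
  by move/invr_inj/eqP; rewrite eqr_nat eqSS => /eqP.
have ts : {subset t <= s}.
  move=> z /mapP[k _ ->]; apply: contrapT => /negP ks; apply: H; exists (r / k.+1%:R)%:C => //.
  rewrite normc_real ger0_norm; last by rewrite divr_ge0// ltW.
  by rewrite ler_pdivrMr// ler_peMr ?ler1n// ltW.
by have := uniq_leq_size ut ts; rewrite size_map size_iota ltnn.
Qed.

(** Newton interpolation at [N] distinct nodes of the disc of radius [r]: each
    node costs a factor [2 r] on the small disc and [2 / (rho - r)] for the
    difference quotient. *)
Lemma newton_interpolation (r rho : R) N : 0 < r -> r < rho ->
  forall g (s : seq R[i]) (M : R), ccontinuous g -> (forall z, z \notin s -> dv g z) ->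
  (forall z, normc z <= rho -> normc (g z) <= M) ->
  exists P : {poly R[i]}, forall z, normc z <= r ->
    normc (g z - P.[z]) <= M * (4 * r / (rho - r)) ^+ N.
Proof.
move=> r0 rr; elim: N => [|N IH] g s M cg dg HM.
  exists 0 => z zr; rewrite horner0 subr0 mulr1 HM//.
  by rewrite (le_trans zr)// ltW.
have [a ar as_] := fresh_point s r0.
have [q [cq dq E]] := difference_quotient cg dg as_.
have [P HP] := IH q _ _ cq dq (difference_quotient_bound cq dq E ar rr HM).
exists ((g a)%:P + ('X - a%:P) * P) => z zr.
rewrite !hornerE E (_ : _ - _ = (z - a) * (q z - P.[z])); last by ring.
rewrite Normc.normcM.
have za : normc (z - a) <= 2 * r.
  by rewrite (le_trans (normcB _ _))// mulr_natl mulr2n lerD.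
rewrite (le_trans (ler_pM (normc_ge0 _) (normc_ge0 _) za (HP z zr)))//.
rewrite le_eqVlt; apply/orP; left; apply/eqP; rewrite exprS.
by ring.
Qed.

Definition polyapp g := forall r e : R, 0 < e ->
  exists P : {poly R[i]}, forall z, normc z <= r -> normc (g z - P.[z]) <= e.

Lemma ccontinuous_bounded g (rho : R) : ccontinuous g ->
  exists2 M, 0 < M & forall z, normc z <= rho -> normc (g z) <= M.
Proof.
move=> cg; have [rho0|rho0] := leP 0 rho; last first.
  by exists 1 => // z zr; have := le_lt_trans (le_trans (normc_ge0 z) zr) rho0; rewrite ltxx.
have [|z0 _ H] := compact_argmax (cclosed_disc (rho := rho)) (cbounded_disc rho) (crcont_normc cg).
  by exists 0; rewrite /mkset Normc.normc0.
exists (normc (g z0) + 1); first by rewrite ltr_wpDl// normc_ge0.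
by move=> z /H Hz; rewrite (le_trans Hz)// lerDl.
Qed.

Theorem entire_polyapp g : entire g -> polyapp g.
Proof.
move=> eg; have cg : ccontinuous g by move=> z; apply: dv_ccont; exact: eg.
suff H (r e : R) : 0 < r -> 0 < e ->
    exists P : {poly R[i]}, forall z, normc z <= r -> normc (g z - P.[z]) <= e.
  move=> r e e0; have [|P HP] := H (Num.max r 1) e _ e0; first by rewrite lt_max ltr01 orbT.
  by exists P => z zr; apply: HP; rewrite le_max zr.
move=> r0 e0.
have [M M0 HM] := ccontinuous_bounded (9 * r) cg.
(* with [rho = 9 r] each node contributes a factor [1 / 2] *)
have [P HP] := @newton_interpolation r (9 * r) (Num.bound (M / e)) r0 ltac:(lra) g [::] M cg (fun z _ => eg z) HM.
exists P => z /HP /le_trans; apply.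
rewrite (_ : 4 * r / (9 * r - r) = 2^-1); last by field; rewrite gt_eqF//; lra.
rewrite exprVn ler_pdivrMr ?exprn_gt0// mulrC -ler_pdivrMr//.
by rewrite ltW// upper_nthrootP.
Qed.

End PolyApprox.

(** * Joukowski map and growth of polynomials *)

Section Joukowski.
Context {R : realType}.
Implicit Types (z w : R[i]) (a u x : R) (n : nat).

Lemma sinh_ge u : 0 <= u -> 2 * u <= expR u - expR (- u).
Proof.
move=> u0; pose f (t : R) := expR t - expR (- t) - 2 * t.
have df (t : R) : is_derive t 1 f (expR t + expR (- t) - 2).
  have d1 : is_derive t 1 (expR \o -%R) (expR (- t) * -1) by apply: is_derive1_comp.
  have d2 : is_derive t 1 (2 \*: (id : R -> R)) (2 *: 1) by apply: is_deriveZ.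
  apply: (is_derive_eq (is_deriveB (is_deriveB (is_derive_expR t) d1) d2)).
  by rewrite mulrN1 opprK [_ *: _]mulr1.
suff : f 0 <= f u by rewrite /f oppr0 subrr mulr0 subr0 subr_ge0.
apply: (@ger0_derive1_ndecr _ f 0 u) => //.
- move=> t _; rewrite derive1E; have [_ ->] := df t.
  rewrite expRN; set e := expR t; have e0 : 0 < e := expR_gt0 t.
  have -> : e + e^-1 - 2 = (e - 1) ^+ 2 / e by field; rewrite gt_eqF.
  by rewrite divr_ge0 ?sqr_ge0// ltW.
- by apply: derivable_within_continuous => t _; case: (df t).
Qed.

(** The Joukowski map sends the unit circle onto [[-a, a]] and the circle of
    radius [r > 1] onto the ellipse with foci [-a], [a] and half-axes
    [a (r + r^-1) / 2], [a (r - r^-1) / 2]. *)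
Definition jouk a z := a%:C / 2 * (z + z^-1).

Lemma jouk_surj a w : a != 0 -> exists2 z, z != 0 /\ normc z <= 1 & w = jouk a z.
Proof.
move=> a0; pose v := w / a%:C; pose s := sqrtc (v ^+ 2 - 1).
have aC0 : a%:C != 0 :> R[i] by rewrite eq_complex /= eqxx andbT.
have ss : s ^+ 2 = v ^+ 2 - 1 by rewrite sqr_sqrtc.
have pq : (v + s) * (v - s) = 1 by rewrite mulrC -subr_sqr ss; ring.
have H z z' : z * z' = 1 -> z + z' = 2 * v -> normc z <= 1 ->
    exists2 z, z != 0 /\ normc z <= 1 & w = jouk a z.
  move=> zz' sz z1; have z0 : z != 0.
    by apply/eqP => z0; move: zz'; rewrite z0 mul0r => /eqP; rewrite eq_sym oner_eq0.
  exists z => //; rewrite /jouk (_ : z^-1 = z').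
    by rewrite sz /v; field.
  by apply: (mulfI z0); rewrite divff.
have [h|h] := leP (normc (v + s)) 1.
  by apply: (H _ _ pq) => //; ring.
rewrite mulrC in pq; apply: (H _ _ pq); first by ring.
have := congr1 (@normc R) pq; rewrite Normc.normcM Normc.normc1 => E.
rewrite -E ler_peMr ?normc_ge0//; exact: ltW.
Qed.

Lemma jouk_unit a z : normc z = 1 -> jouk a z = (a * complex.Re z)%:C.
Proof.
move=> z1; rewrite /jouk; have -> : z^-1 = z^*%C.
  by rewrite invc_norm normcRE z1 /= expr1n invr1 mul1r.
by rewrite addcJ rmorphM /=; field.
Qed.

Lemma jouk_interval a x : 0 < a -> `|x| <= a -> exists2 z, normc z = 1 & x%:C = jouk a z.
Proof.
move=> a0 xa; pose c := x / a.
have c1 : c ^+ 2 <= 1.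
  rewrite -[leRHS](expr1n _ 2) -[c ^+ 2]real_normK ?num_real// lerXn2r ?nnegrE//.
  by rewrite /c normrM normfV (gtr0_norm a0) ler_pdivrMr// mul1r.
pose z := c +i* Num.sqrt (1 - c ^+ 2).
have z1 : normc z = 1.
  by rewrite /z /= sqr_sqrtr ?subr_ge0// addrC subrK sqrtr1.
exists z => //; rewrite jouk_unit//= /c; congr (_ %:C).
by rewrite mulrCA divff ?mulr1// gt_eqF.
Qed.

(** On the circle [|z| = t] the modulus of [jouk a z] is at least the minor
    half-axis [a * sinh u] of the image ellipse, with [u = ln t^-1], and
    [sinh u >= u]. *)
Lemma jouk_radius a z : 0 < a -> z != 0 -> normc z <= 1 ->
  (normc z)^-1 <= expR (normc (jouk a z) / a).
Proof.
move=> a0 z0 z1; set t := normc z.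
have t0 : 0 < t by rewrite /t normc_gt0.
have ti0 : 0 < t^-1 by rewrite invr_gt0.
pose u := ln t^-1.
have u0 : 0 <= u by rewrite /u ln_ge0// invf_ge1.
have eu : expR u = t^-1 by rewrite /u lnK// posrE.
rewrite -eu ler_expR ler_pdivlMr// /jouk Normc.normcM.
have -> : normc (a%:C / 2) = a / 2.
  rewrite Normc.normcM Normc.normcV normc_real gtr0_norm//.
  by rewrite (_ : 2 = 2%:C) ?normc_real ?ger0_norm// rmorph_nat.
have : 2 * u <= normc (z + z^-1).
  rewrite (le_trans (sinh_ge u0))// expRN eu invrK.
  have := normc_triB z^-1 (- z); rewrite normcN opprK Normc.normcV -/t.
  by rewrite [z^-1 + z]addrC.
by move=> /(ler_wpM2l (ltW a0)); lra.
Qed.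

(** On [|z| = 1] the function [z^n P (jouk a z)] only sees [P] on [-a, a], and
    it is a polynomial, so the maximum principle transports the bound into
    the disc. *)
Theorem bernstein_growth (P : {poly R[i]}) n a M : 0 < a -> (size P <= n.+1)%N ->
  (forall x, `|x| <= a -> normc P.[x%:C] <= M) ->
  forall w, normc P.[w] <= M * expR (n%:R * (normc w / a)).
Proof.
move=> a0 sP HP w.
have [z [z0 z1] ->] := jouk_surj w (lt0r_neq0 a0).
pose V : {poly R[i]} := \sum_(k < n.+1)
  (P`_k * (a%:C / 2) ^+ k) *: (('X ^+ 2 + 1) ^+ k * 'X^(n - k)).
have VE y : y != 0 -> V.[y] = y ^+ n * P.[jouk a y].
  move=> y0; rewrite (horner_coef_wide _ sP) mulr_sumr /V horner_sum.
  apply: eq_bigr => k _; rewrite hornerZ hornerM !horner_exp !hornerE.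
  have kn : (k <= n)%N by rewrite -ltnS.
  have -> : y ^+ n = y ^+ (n - k) * y ^+ k by rewrite -exprD subnK.
  have -> : jouk a y ^+ k = (a%:C / 2) ^+ k * ((y ^+ 2 + 1) ^+ k / y ^+ k).
    rewrite /jouk exprMn -expr_div_n; congr (_ * _ ^+ k); field; exact: y0.
  have yk : y ^+ k != 0 by rewrite expf_neq0.
  move: (a%:C / 2) ((y ^+ 2 + 1) ^+ k) (y ^+ k) (y ^+ (n - k)) yk => b A B D B0.
  by rewrite /=; field.
have M0 : 0 <= M by rewrite (le_trans (normc_ge0 _) (HP 0 _))// normr0 ltW.
have B : normc V.[z] <= M.
  apply: (@maximum_principle_poly _ V 1 M) => // y y1.
  have y0 : y != 0 by rewrite -normc_gt0 y1.
  rewrite VE// Normc.normcM normcX y1 expr1n mul1r jouk_unit//; apply: HP.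
  rewrite normrM gtr0_norm// ler_piMr//; first exact: ltW.
  by rewrite (le_trans (Re_normc _))// y1.
have t0 : 0 < normc z by rewrite normc_gt0.
move: B; rewrite VE// Normc.normcM normcX mulrC -ler_pdivlMr ?exprn_gt0// => B.
rewrite (le_trans B)// ler_wpM2l// -exprVn.
rewrite expRM_natl lerXn2r ?nnegrE ?expR_ge0//; first by rewrite invr_ge0 ltW.
exact: jouk_radius.
Qed.

Lemma poly_diff_quotient (P : {poly R[i]}) z : exists Q : {poly R[i]},
  forall w, P.[w] - P.[z] = (w - z) * Q.[w].
Proof.
have /factor_theorem [Q E] : root (P - P.[z]%:P) z.
  by rewrite /root !hornerE subrr.
exists Q => w; have := congr1 (horner^~ w) E; rewrite !hornerE => ->.
by rewrite mulrC.
Qed.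

Lemma maximum_principle_disc_poly (P : {poly R[i]}) z (rho m : R) :
  (forall w, normc (w - z) = rho -> normc P.[w] <= m) ->
  forall w, normc (w - z) <= rho -> normc P.[w] <= m.
Proof.
move=> H w wz; have := @maximum_principle_poly _ (P \Po ('X + z%:P)) rho m _ (w - z) wz.
rewrite horner_comp !hornerE subrK; apply => y yr.
by rewrite horner_comp !hornerE; apply: H; rewrite addrK.
Qed.

(** Schwarz lemma, in the form iterated to get a second order Taylor bound. *)
Lemma schwarz_quotient (P Q : {poly R[i]}) z (rho S : R) : 0 < rho ->
  (forall w, P.[w] - P.[z] = (w - z) * Q.[w]) ->
  (forall w, normc (w - z) <= rho -> normc P.[w] <= S) ->
  forall w, normc (w - z) <= rho -> normc Q.[w] <= 2 * S / rho.
Proof.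
move=> rho0 E HS; apply: maximum_principle_disc_poly => w wr.
rewrite ler_pdivlMr// -{1}wr mulrC -Normc.normcM -E (le_trans (normcB _ _))//.
rewrite mulr_natl mulr2n lerD ?HS ?wr//.
by rewrite subrr Normc.normc0 ltW.
Qed.

Lemma poly_lipschitz (P : {poly R[i]}) z (rho S : R) : 0 < rho ->
  (forall w, normc (w - z) <= rho -> normc P.[w] <= S) ->
  forall w, normc (w - z) <= rho -> normc (P.[w] - P.[z]) <= 2 * S / rho * normc (w - z).
Proof.
move=> rho0 HS w wr; have [Q E] := poly_diff_quotient P z.
by rewrite E Normc.normcM mulrC ler_wpM2r ?normc_ge0// (schwarz_quotient rho0 E HS).
Qed.

Lemma poly_taylor2 (P : {poly R[i]}) z (rho S : R) : 0 < rho ->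
  (forall w, normc (w - z) <= rho -> normc P.[w] <= S) ->
  exists2 d, normc d <= 2 * S / rho & forall h, normc h <= rho ->
    normc (P.[z + h] - P.[z] - d * h) <= 4 * S / rho ^+ 2 * normc h ^+ 2.
Proof.
move=> rho0 HS; have [Q E] := poly_diff_quotient P z.
have HQ := schwarz_quotient rho0 E HS.
exists Q.[z]; first by apply: HQ; rewrite subrr Normc.normc0 ltW.
move=> h hr; have zh : z + h - z = h by rewrite addrAC subrr add0r.
rewrite E zh mulrC -mulrBl Normc.normcM expr2 mulrA ler_wpM2r ?normc_ge0//.
have := poly_lipschitz rho0 HQ (w := z + h); rewrite zh => /(_ hr) /le_trans; apply.
rewrite ler_wpM2r ?normc_ge0// le_eqVlt; apply/orP; left; apply/eqP; field.
by rewrite gt_eqF.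
Qed.

End Joukowski.

(** * Chebyshev expansions on ellipses *)

Section EllipseApprox.
Context {R : realType}.
Implicit Types (z w : R[i]) (a u x : R) (n k m : nat).

Lemma prim_root_exists m : (0 < m)%N -> exists w : R[i], m.-primitive_root w.
Proof.
pose p : {poly R[i]} := 'X^m - 1; have [r Dp] := closed_field_poly_normal p.
move=> m_gt0; rewrite (monicP _) ?monicXnsubC // scale1r in Dp.
have rn1 : all m.-unity_root r by apply/allP=> z; rewrite -root_prod_XsubC -Dp.
have sz_r : (m < (size r).+1)%N.
  by rewrite -(size_prod_XsubC r id) -Dp size_XnsubC.
have [|z] := hasP (has_prim_root m_gt0 rn1 _ sz_r); last by exists z.
by rewrite -separable_prod_XsubC -Dp separable_Xn_sub_1 // pnatr_eq0 -lt0n.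
Qed.

(** Chebyshev polynomials for [-a, a], normalised to be [z^k + z^-k] in the
    Joukowski coordinate; consecutive ones are paired for the three-term
    recurrence. *)
Fixpoint cheb a k : {poly R[i]} * {poly R[i]} :=
  if k is k'.+1 then
    let p := cheb a k' in (p.2, (2 / a%:C) *: ('X * p.2) - p.1)
  else (2%:P, (2 / a%:C) *: 'X).

Definition chebp a k := (cheb a k).1.
Local Arguments chebp : simpl never.

Lemma cheb_jouk a k z : a != 0 -> z != 0 ->
  (chebp a k).[jouk a z] = z ^+ k + z^-1 ^+ k.
Proof.
move=> a0 z0; have aC0 : a%:C != 0 :> R[i] by rewrite eq_complex /= eqxx andbT.
suff : (cheb a k).1.[jouk a z] = z ^+ k + z^-1 ^+ k /\
   (cheb a k).2.[jouk a z] = z ^+ k.+1 + z^-1 ^+ k.+1 by case.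
elim: k => [|k [IH1 IH2]] /=.
  by rewrite !hornerE !expr0 !expr1 /jouk; split => //=; field; exact/andP.
split => //; rewrite !hornerE IH1 IH2 /jouk !exprS.
move: (z ^+ k) (z^-1 ^+ k) => A B /=; field; exact/andP.
Qed.

Lemma size_cheb a k : a != 0 -> size (chebp a k) = k.+1.
Proof.
move=> a0; have c0 : 2 / a%:C != 0 :> R[i].
  rewrite mulf_neq0 ?invr_eq0//.
  by rewrite eq_complex /= eqxx andbT.
suff : size (cheb a k).1 = k.+1 /\ size (cheb a k).2 = k.+2 by case.
elim: k => [|k [IH1 IH2]] /=.
  by rewrite size_polyC pnatr_eq0 size_scale// size_polyX.
split => //; have p20 : (cheb a k).2 != 0 by rewrite -size_poly_gt0 IH2.
have S : size ((2 / a%:C) *: ('X * (cheb a k).2)) = k.+3.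
  by rewrite size_scale// mulrC size_mulX// IH2.
by rewrite size_polyDl S// size_polyN IH1.
Qed.

Lemma cheb_basis a N (T : {poly R[i]}) : a != 0 -> (size T <= N)%N ->
  exists t : nat -> R[i], T = \sum_(k < N) t k *: chebp a k.
Proof.
move=> a0; elim: N T => [|N IH] T sT.
  by exists (fun=> 0); rewrite big_ord0; apply/eqP; rewrite -size_poly_leq0.
pose C := chebp a N; have sC : size C = N.+1 by exact: size_cheb.
have ld0 : C`_N != 0.
  by rewrite -[N]/(N.+1.-1) -sC -lead_coefE lead_coef_eq0 -size_poly_gt0 sC.
have sT' : (size (T - (T`_N / C`_N) *: C)%R <= N)%N.
  apply/leq_sizeP => j; rewrite leq_eqVlt => /orP[/eqP <-|Nj].
    by rewrite coefB coefZ divfK// subrr.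
  by rewrite coefB coefZ (nth_default _ (leq_trans sT Nj)) [C`_j]nth_default ?sC// mulr0 subr0.
have [t tE] := IH _ sT'.
exists (fun k => if (k < N)%N then t k else T`_N / C`_N).
rewrite big_ord_recr /= ltnn -[LHS](subrK ((T`_N / C`_N) *: C)) tE; congr (_ + _).
by apply: eq_bigr => i _; rewrite ltn_ord.
Qed.

Lemma sum_unity_root_pow m (y : R[i]) : y ^+ m = 1 ->
  \sum_(j < m) (y ^+ j) = if y == 1 then m%:R else 0.
Proof.
move=> ym; case: eqP => [->|/eqP y1].
  by rewrite (eq_bigr (fun=> 1)) => [|i _]; rewrite ?expr1n// sumr_const card_ord.
have /eqP := subrX1 y m; rewrite ym subrr eq_sym mulf_eq0 subr_eq0 (negPf y1) /=.
by move/eqP.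
Qed.

(** Cauchy estimate for the Chebyshev coefficients on the ellipse of parameter
    [r]. Averaging over [2 N] equally spaced points replaces the contour
    integral; it is exact because the Laurent polynomial at hand has its
    exponents strictly between [-N] and [N]. *)
Lemma cheb_coef_bound a N (t : nat -> R[i]) (r S : R) k : a != 0 -> 0 < r ->
  (forall z, normc z = r ->
    normc (\sum_(k < N) t k *: chebp a k).[jouk a z] <= S) ->
  (0 < k < N)%N -> normc (t k) <= S / r ^+ k.
Proof.
move=> a0 r0 HS /andP[k0 kN].
pose m := (2 * N)%N.
have m0 : (0 < m)%N by rewrite /m muln_gt0 (leq_ltn_trans _ kN).
have [w pw] := prim_root_exists m0.
have wm := prim_expr_order pw.
have w0 : w != 0.
  by apply/eqP => w0; move: wm; rewrite w0 expr0n gtn_eqF// => /eqP; rewrite eq_sym oner_eq0.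
have nw : normc w = 1.
  have : normc w ^+ m = 1 by rewrite -normcX wm Normc.normc1.
  by move/eqP; rewrite pexpr_eq1 ?normc_ge0// => /eqP.
pose y j : R[i] := r%:C * w ^+ j.
have rC0 : r%:C != 0 :> R[i] by rewrite eq_complex /= eqxx andbT gt_eqF.
have y0 j : y j != 0 by rewrite mulf_neq0// expf_neq0.
have ny j : normc (y j) = r by rewrite Normc.normcM normc_real normcX nw expr1n mulr1 gtr0_norm.
pose F j := (\sum_(k < N) t k *: chebp a k).[jouk a (y j)].
have FE j : F j = \sum_(l < N) t l * (y j ^+ l + (y j)^-1 ^+ l).
  by rewrite /F horner_sum; apply: eq_bigr => l _; rewrite hornerZ cheb_jouk.
have key : \sum_(j < m) F j * (y j)^-1 ^+ k = m%:R * t k.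
  under eq_bigr => j _ do rewrite FE mulr_suml.
  have T (l : nat) : (l < N)%N ->
      \sum_(j < m) t l * (y j ^+ l + (y j)^-1 ^+ l) * (y j)^-1 ^+ k = if l == k then m%:R * t k else 0.
    move=> lN.
    have E (j : nat) : t l * (y j ^+ l + (y j)^-1 ^+ l) * (y j)^-1 ^+ k =
        (t l * (r%:C ^+ l * r%:C^-1 ^+ k)) * (w ^+ l * w^-1 ^+ k) ^+ j +
        (t l * (r%:C^-1 ^+ l * r%:C^-1 ^+ k)) * (w^-1 ^+ l * w^-1 ^+ k) ^+ j.
      rewrite /y invfM -exprVn !exprMn -!exprM ![(j * _)%N]mulnC.
      by ring.
    under eq_bigr => j _ do rewrite E.
    rewrite big_split /= -!mulr_sumr.
    have P1 q : (w ^+ q) ^+ m = 1 by rewrite -exprM mulnC exprM wm expr1n.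
    have wVm : w^-1 ^+ m = 1 by rewrite exprVn wm invr1.
    have P2 q : (w^-1 ^+ q) ^+ m = 1 by rewrite -exprM mulnC exprM wVm expr1n.
    have Y1 : (w ^+ l * w^-1 ^+ k) ^+ m = 1 by rewrite exprMn P1 P2 mulr1.
    have Y2 : (w^-1 ^+ l * w^-1 ^+ k) ^+ m = 1 by rewrite exprMn !P2 mulr1.
    rewrite [X in _ * X + _](sum_unity_root_pow Y1) [X in _ + _ * X](sum_unity_root_pow Y2).
    have -> : (w^-1 ^+ l * w^-1 ^+ k == 1) = false.
      rewrite -exprD exprVn invr_eq1 -(prim_order_dvd pw); apply/negP => /dvdn_leq.
      rewrite addn_gt0 k0 orbT => /(_ isT); rewrite /m; apply/negP; rewrite -ltnNge.
      by rewrite mul2n -addnn -addSn leq_add// ltnW.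
    have -> : (w ^+ l * w^-1 ^+ k == 1) = (l == k).
      rewrite exprVn -[LHS](inj_eq (mulIf (expf_neq0 k w0))) mul1r mulfVK ?expf_neq0//.
      rewrite (eq_prim_root_expr pw) !modn_small// /m; apply: leq_trans (leq_pmull _ _) => //.
    rewrite mulr0 addr0; case: eqP => [->|_]; last by rewrite mulr0.
    by rewrite -exprMn divff// expr1n mulr1 mulrC.
  rewrite exchange_big /= (bigD1 (Ordinal kN)) //= T// eqxx big1 ?addr0// => l lk.
  by rewrite T ?ltn_ord// ifF//; apply/negbTE; apply: contra lk => /eqP lk; apply/eqP/val_inj.
have B : normc (m%:R * t k) <= m%:R * (S / r ^+ k).
  rewrite -key (le_trans (normc_sum _ _ _))//.
  rewrite mulr_natl -[in leRHS](card_ord m) -sumr_const ler_sum// => j _.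
  rewrite Normc.normcM normcX Normc.normcV ny exprVn; apply: ler_wpM2r.
    by rewrite invr_ge0 exprn_ge0// ltW.
  by apply: HS; exact: ny.
move: B; rewrite Normc.normcM (_ : normc m%:R = m%:R); last first.
  by rewrite -(rmorph_nat (real_complex R)) normc_real normr_nat.
by rewrite ler_pM2l// ltr0n.
Qed.

(** A polynomial [T] of unknown degree, uniformly close to [g] on the solid
    ellipse, reduces the claim to a finite expansion. Its coefficients decay
    like [2 S / r ^ k], and the Chebyshev polynomials are at most [2] on
    [[-a, a]], so that dropping the terms of index above [n] costs a geometric
    tail. *)
Theorem ellipse_approx (g : R[i] -> R[i]) a (r S : R) n : polyapp g -> 0 < a -> 1 < r -> 0 < S ->
  (forall z, normc z = r -> normc (g (jouk a z)) <= S) ->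
  exists2 P : {poly R[i]}, (size P <= n.+1)%N &
    forall x, `|x| <= a -> normc (g x%:C - P.[x%:C]) <= (1 + 4 / (1 - r^-1)) * S / r ^+ n.
Proof.
move=> ag a0 r1 S0 HS.
have r0 : 0 < r by lra.
have q1 : r^-1 < 1 by rewrite invf_lt1.
have e0 : 0 < S / r ^+ n by rewrite divr_gt0// exprn_gt0.
have eS : S / r ^+ n <= S by rewrite ler_pdivrMr ?exprn_gt0// ler_peMr ?(ltW S0)// exprn_ege1// ltW.
have [T HT] := ag (a * r) _ e0.
have aN0 : a != 0 by rewrite gt_eqF.
have nj z : normc z <= r -> 1 <= normc z -> normc (jouk a z) <= a * r.
  move=> zr z1; rewrite /jouk Normc.normcM.
  have -> : normc (a%:C / 2) = a / 2.
    rewrite Normc.normcM Normc.normcV normc_real gtr0_norm//.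
    by rewrite (_ : 2 = 2%:C) ?normc_real ?ger0_norm// rmorph_nat.
  rewrite -mulrA ler_pM2l// ler_pdivrMl// (le_trans (le_normcD _ _))// Normc.normcV.
  rewrite mulr_natl mulr2n lerD// (le_trans _ (ltW r1))// invf_le1//; lra.
pose N := (maxn (size T) n.+1).
have [t tE] := cheb_basis aN0 (leq_maxl (size T) n.+1 : (size T <= N)%N).
have HT2 z : normc z = r -> normc T.[jouk a z] <= 2 * S.
  move=> zr; have A := HT (jouk a z) (nj z _ _); rewrite zr in A.
  have {}A := A (lexx _) (ltW r1).
  have := normc_triB T.[jouk a z] (g (jouk a z)); rewrite normc_distC.
  have := HS z zr; lra.
have tb k : (0 < k < N)%N -> normc (t k) <= 2 * S / r ^+ k.
  by apply: (cheb_coef_bound aN0 r0) => z zr; rewrite -tE; exact: HT2.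
pose P := \sum_(k < n.+1) t k *: chebp a k.
exists P.
  rewrite (leq_trans (size_sum _ _ _))//; apply/bigmax_leqP => k _.
  by rewrite (leq_trans (size_scale_leq _ _))// size_cheb.
move=> x xa; have [z z1 xE] := jouk_interval a0 xa.
have z0 : z != 0 by rewrite -normc_gt0 z1.
have A : normc (g x%:C - T.[x%:C]) <= S / r ^+ n.
  by rewrite xE; apply/HT/nj; rewrite z1// ltW.
have B : normc (T.[x%:C] - P.[x%:C]) <= 4 / (1 - r^-1) * S / r ^+ n.
  have nN : (n.+1 <= N)%N by exact: leq_maxr.
  rewrite tE /P -(subnKC nN) big_split_ord /= [\sum_(i < n.+1) _ + _]addrC -hornerN -hornerD addrK.
  rewrite horner_sum (le_trans (normc_sum _ _ _))//.
  apply: (@le_trans _ _ (\sum_(i < N - n.+1) (4 * S / r ^+ n) * r^-1 ^+ i)).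
    apply: ler_sum => i _; rewrite hornerZ xE cheb_jouk// Normc.normcM.
    have c2 : normc (z ^+ (n.+1 + i) + z^-1 ^+ (n.+1 + i)) <= 2.
      by rewrite (le_trans (le_normcD _ _))// !normcX Normc.normcV z1 invr1 expr1n.
    have ti := tb (n.+1 + i)%N.
    rewrite addSn /= -addSn -{2}(subnKC nN) ltn_add2l ltn_ord in ti.
    rewrite (le_trans (ler_pM (normc_ge0 _) (normc_ge0 _) (ti isT) c2))//.
    have -> : 2 * S / r ^+ (n.+1 + i) * 2 = (4 * S / r ^+ n * r^-1 ^+ i) * r^-1.
      by rewrite addSn exprS exprD exprVn; field; rewrite !expf_neq0 ?gt_eqF.
    rewrite ler_piMr ?(ltW q1)// mulr_ge0 ?exprn_ge0 ?invr_ge0 ?(ltW r0)//.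
    by rewrite divr_ge0 ?exprn_ge0 ?(ltW r0)//; lra.
  rewrite -mulr_sumr; set G := \sum_(i < _) _.
  have GE : (1 - r^-1) * G = 1 - r^-1 ^+ (N - n.+1).
    by rewrite -opprB mulNr -subrX1 opprB.
  have Gle : G <= (1 - r^-1)^-1.
    rewrite -[leRHS]mulr1 ler_pdivlMl ?subr_gt0// GE lerBlDr lerDl.
    by rewrite exprn_ge0// invr_ge0 ltW.
  rewrite (_ : 4 / (1 - r^-1) * S / r ^+ n = 4 * S / r ^+ n * (1 - r^-1)^-1); last by ring.
  rewrite ler_wpM2l// divr_ge0 ?exprn_ge0 ?(ltW r0)//; lra.
have := le_normcD (g x%:C - T.[x%:C]) (T.[x%:C] - P.[x%:C]).
by rewrite addrA subrK !mulrDl mul1r; lra.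
Qed.

End EllipseApprox.

(** * Phragmen-Lindelof principle *)

Section PhragmenLindelof.
Context {R : realType}.
Implicit Types (F : R[i] -> R[i]) (z w : R[i]).

(** In the sector [0 <= y <= T x] the factor [cexp (- d (1 - i T) z^2)] decays
    faster than any exponential grows, because [Re ((1 - i T) z^2) >= |z|^2]
    there. The slope [T] is taken so large that outside of the sector [|z|] is
    at most [t' / t] times [y]. *)
Lemma phragmen_lindelof_quadrant F (t t' C M : R) : entire F ->
  0 < t -> t < t' -> 0 < C ->
  (forall z, normc (F z) <= C * expR (t * normc z)) ->
  (forall x : R, normc (F x%:C) <= M) ->
  forall x y : R, 0 <= x -> 0 <= y -> normc (F (x +i* y)) <= Num.max M C * expR (t' * y).
Proof.
move=> eF t0 tt' C0 HF HM x y x0 y0.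
set B := Num.max M C; have MB : M <= B by rewrite le_max lexx.
have CB : C <= B by rewrite le_max lexx orbT.
have B0 : 0 < B by lra.
have t'0 : 0 < t' by lra.
pose T := t / (t' - t); have T0 : 0 < T by rewrite divr_gt0// subr_gt0.
have TE : T * (t' - t) = t by rewrite /T divfK// gt_eqF// subr_gt0.
have steep a b : 0 <= a -> 0 <= b -> T * a <= b -> t * normc (a +i* b) <= t' * b.
  move=> a0 b0 ab; apply: (@le_trans _ _ (t * (a + b))).
    by rewrite ler_pM2l// (le_trans (normc_ReIm _))//= !ger0_norm.
  have : (t' - t) * (T * a) <= (t' - t) * b by rewrite ler_wpM2l// subr_ge0 ltW.
  by rewrite mulrA [_ * T]mulrC TE; lra.
have out a b : 0 <= a -> 0 <= b -> T * a <= b -> normc (F (a +i* b)) <= C * expR (t' * b).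
  by move=> a0 b0 ab; rewrite (le_trans (HF _))// ler_pM2l// ler_expR steep.
have [|xy] := leP (T * x) y.
  by move=> xy; rewrite (le_trans (out _ _ x0 y0 xy))// ler_wpM2r// expR_ge0.
pose q (a b : R) := a ^+ 2 - b ^+ 2 + 2 * T * a * b.
have qge a b : 0 <= b -> b <= T * a -> a ^+ 2 + b ^+ 2 <= q a b.
  by move=> b0 ba; have := ler_wpM2r b0 ba; rewrite /q; nra.
have key d : 0 < d -> normc (F (x +i* y)) * expR (- (t' * y) - d * q x y) <= B.
  move=> d0.
  pose E z : R[i] := ('i * t'%:C) * z - (d%:C * (1 -i* T)) * (z * z).
  pose Phi z := F z * cexp (E z).
  have EE a b : complex.Re (E (a +i* b)) = - (t' * b) - d * q a b.
    by rewrite /E /q /=; ring.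
  have PhiE a b : normc (Phi (a +i* b)) = normc (F (a +i* b)) * expR (- (t' * b) - d * q a b).
    by rewrite /Phi Normc.normcM normc_cexp EE.
  have dPhi z : dv Phi z.
    apply: dvM; first exact: eF.
    apply: dv_comp; last exact: dv_cexp.
    apply: dvB; apply: dvM; [exact: dv_cst|exact: dv_id|exact: dv_cst|].
    by apply: dvM; exact: dv_id.
  pose rho := x + t / d.
  pose K := [set z : R[i] | [/\ 0 <= complex.Im z, complex.Im z <= T * complex.Re z &
     complex.Re z <= rho]].
  have near_Re z w e : normc (w - z) < e -> complex.Re z - e < complex.Re w < complex.Re z + e.
    by move=> /(le_lt_trans (Re_normc _)); rewrite raddfB /= ltr_distl.
  have near_Im z w e : normc (w - z) < e -> complex.Im z - e < complex.Im w < complex.Im z + e.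
    by move=> /(le_lt_trans (Im_normc _)); rewrite raddfB /= ltr_distl.
  have clK : cclosed K.
    move=> z H; split; apply/ler_addgt0Pr => e e0.
    - have [w [w1 _ _] /near_Im] := H e e0; lra.
    - have e1 : 0 < e / (T + 1) by rewrite divr_gt0//; lra.
      have [w [_ w1 _] wz] := H _ e1; have := near_Im _ _ _ wz; have := near_Re _ _ _ wz.
      set e' := e / (T + 1) in e1 wz *.
      have e'E : e = e' * T + e' by rewrite -[e in LHS](@divfK _ (T + 1)) -/e'; [ring|rewrite gt_eqF//; lra].
      move=> /andP[h1 h2] /andP[h3 h4].
      have : T * complex.Re w < T * (complex.Re z + e') by rewrite ltr_pM2l.
      by rewrite e'E; lra.
    - have [w [_ _ w1] /near_Re] := H e e0; lra.
  have rho0 : x < rho by rewrite ltrDl divr_gt0.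
  have bK : cbounded K.
    exists (rho + T * rho) => z [z1 z2 z3]; rewrite (le_trans (normc_ReIm _))//.
    have zR : 0 <= complex.Re z by rewrite -(pmulr_rge0 _ T0); lra.
    by rewrite !ger0_norm// lerD// (le_trans z2)// ler_pM2l.
  have bd z : K z -> normc (Phi z) <= B \/
     exists2 e : R, 0 < e & forall w, normc (w - z) <= e -> K w.
    case: z => a b [/= b0 ba ar].
    have a0 : 0 <= a by rewrite -(pmulr_rge0 _ T0); lra.
    have qn := qge a b b0 ba.
    have dq : 0 <= d * q a b by rewrite mulr_ge0 ?(ltW d0)// (le_trans _ qn)// addr_ge0// sqr_ge0.
    have [b00|b00] := eqVneq b 0.
      left; rewrite PhiE b00 (le_trans _ MB)//.
      rewrite -[leRHS]mulr1 ler_pM ?normc_ge0 ?expR_ge0//; first exact: HM.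
      by rewrite -expR0 ler_expR; rewrite b00 in dq; lra.
    have [bT|bT] := eqVneq b (T * a).
      left; rewrite PhiE (le_trans _ CB)//.
      rewrite (le_trans (ler_wpM2r (expR_ge0 _) (out a b a0 b0 _))) ?bT//.
      rewrite -mulrA -expRD -[leRHS]mulr1 ler_pM2l// -expR0 ler_expR -bT; lra.
    have [arho|arho] := eqVneq a rho.
      left; rewrite PhiE (le_trans _ CB)//.
      rewrite (le_trans (ler_wpM2r (expR_ge0 _) (HF _)))//.
      rewrite -mulrA -expRD -[leRHS]mulr1 ler_pM2l// -expR0 ler_expR.
      have N2 : normc (a +i* b) ^+ 2 = a ^+ 2 + b ^+ 2 by rewrite sqr_normc_ReIm.
      have Na : t / d <= normc (a +i* b).
        apply: le_trans (Re_normc _); rewrite /= ger0_norm// arho /rho; lra.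
      have : t * normc (a +i* b) <= d * normc (a +i* b) ^+ 2.
        rewrite expr2 mulrA ler_wpM2r ?normc_ge0// mulrC -ler_pdivrMr//.
      have : d * (a ^+ 2 + b ^+ 2) <= d * q a b by rewrite ler_pM2l.
      have : 0 <= t' * b by rewrite mulr_ge0// ltW.
      by rewrite -N2; lra.
    right.
    have b1 : 0 < b by rewrite lt_neqAle eq_sym b00.
    have b2 : b < T * a by rewrite lt_neqAle bT.
    have a1 : a < rho by rewrite lt_neqAle arho.
    pose m := Num.min (b / 2) (Num.min ((rho - a) / 2) ((T * a - b) / (2 * (T + 1)))).
    have T1 : 0 < T + 1 by lra.
    have m0 : 0 < m.
      by rewrite !lt_min !divr_gt0// ?subr_gt0// mulr_gt0.
    exists m => // w wm; have wm' : normc (w - (a +i* b)) < m * 2 by lra.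
    have := near_Im _ _ _ wm'; have := near_Re _ _ _ wm'.
    have mb : m <= b / 2 by rewrite ge_min lexx.
    have mr : m <= (rho - a) / 2 by rewrite !ge_min lexx orbT.
    have mT : m <= (T * a - b) / (2 * (T + 1)) by rewrite !ge_min lexx !orbT.
    rewrite ler_pdivlMr ?mulr_gt0// in mT.
    move=> /= /andP[h1 h2] /andP[h3 h4]; split; [lra| |lra].
    have : T * (a - m * 2) < T * complex.Re w by rewrite ltr_pM2l.
    by lra.
  have cPhi : ccontinuous Phi by move=> z; apply: dv_ccont; exact: dPhi.
  have := @maximum_principle R K Phi [::] B clK bK cPhi (fun z _ => dPhi z) bd (x +i* y).
  by rewrite PhiE; apply; split; rewrite //= ltW.
rewrite leNgt; apply/negP => H.
pose A := normc (F (x +i* y)) * expR (- (t' * y)).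
have AB : B < A.
  by rewrite /A expRN ltr_pdivlMr ?expR_gt0.
have q0 : 0 <= q x y.
  by rewrite (le_trans _ (qge x y y0 (ltW xy)))// addr_ge0// sqr_ge0.
have L0 : 0 < ln (A / B) by rewrite ln_gt0// ltr_pdivlMr// mul1r.
have d0 : 0 < ln (A / B) / (q x y + 1) by rewrite divr_gt0//; lra.
have := key _ d0; rewrite expRD mulrA -/A expRN ler_pdivrMr ?expR_gt0//.
apply/negP; rewrite -ltNge mulrC -ltr_pdivlMr// -[ltRHS]lnK ?posrE ?divr_gt0//; last by lra.
by rewrite ltr_expR mulrAC ltr_pdivrMr; [rewrite ltr_pM2l//; lra|lra].
Qed.

Lemma entire_opp F : entire F -> entire (fun z => F (- z)).
Proof.
move=> eF z; apply: (@dv_comp _ (fun w => - w)); last exact: eF.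
by apply: dvN; exact: dv_id.
Qed.

Lemma normc_conj z : normc z^*%C = normc z.
Proof. by case: z => a b /=; rewrite sqrrN. Qed.

Lemma entire_conj F : entire F -> entire (fun z => (F z^*%C)^*%C).
Proof.
move=> eF z; apply/dvP; have [d H] := (dvP F z^*%C).1 (eF _).
exists d^*%C => e e0; have [r r0 Hr] := H e e0; exists r => // h hr.
have := Hr h^*%C; rewrite !normc_conj => /(_ hr).
move=> E; apply: le_trans E; rewrite le_eqVlt; apply/orP; left; apply/eqP.
have -> : (F (z + h)^*)^* - (F z^*)^* - d^* * h =
    (F (z^* + h^*) - F z^* - d * h^*)^* :> R[i].
  by rewrite [RHS]rmorphB [X in _ = X - _]rmorphB rmorphM /= conjcK -[z^* + h^*]rmorphD.
exact: normc_conj.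
Qed.

(** The reflections [conj (F (conj z))] and [conj (F (- conj z))] reduce to the first quadrant. *)
Theorem phragmen_lindelof F (t t' C M : R) : entire F ->
  0 < t -> t < t' -> 0 < C ->
  (forall z, normc (F z) <= C * expR (t * normc z)) ->
  (forall x : R, normc (F x%:C) <= M) ->
  forall z, normc (F z) <= Num.max M C * expR (t' * `|complex.Im z|).
Proof.
move=> eF t0 tt' C0 HF HM [x y] /=.
wlog y0 : F eF HF HM y / 0 <= y => [hw|].
  have [|y0] := leP 0 y; first exact: hw.
  have := hw _ (entire_conj eF) _ _ (- y); rewrite /= normrN opprK normc_conj oppr_ge0.
  apply; last exact: ltW.
    by move=> z; rewrite normc_conj -(normc_conj z).
  by move=> u; rewrite normc_conj; have := HM u; rewrite -{1}(conjc_real u); exact.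
rewrite (ger0_norm y0).
wlog x0 : F eF HF HM x / 0 <= x => [hw|]; last exact: (phragmen_lindelof_quadrant (t := t)).
have [|x0] := leP 0 x; first exact: hw.
have := hw _ (entire_conj (entire_opp eF)) _ _ (- x).
rewrite (_ : - (- x +i* y)^*%C = x +i* y); last first.
  by apply/eqP; rewrite eq_complex /= !opprK !eqxx.
rewrite normc_conj oppr_ge0; apply; last exact: ltW.
  by move=> z; rewrite normc_conj (le_trans (HF _))// normcN normc_conj.
move=> u; rewrite normc_conj; have := HM (- u).
by rewrite rmorphN /= -{1}(conjc_real u); exact.
Qed.

End PhragmenLindelof.

(** * Quasinorms of measurable functions *)

Section LpNorm.
Context {R : realType}.
Implicit Types (F G : R -> R[i]) (D : set R) (p : \bar R) (r l : R).
Local Notation T := (lebesgueType R).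
Local Notation mu := (@completed_lebesgue_measure R).
Local Notation lmeas := (@lebesgue_measurable_fun R).

Definition lset D := measurable (D : set T).

Lemma lset_borel (D : set (measurableTypeR R)) : measurable D -> lset D.
Proof. exact: sub_caratheodory. Qed.

Lemma lset_itv (a b : R) : lset `[a, b].
Proof. by apply: lset_borel; exact: measurable_itv. Qed.

Lemma lset_setT : lset setT.
Proof. exact: measurableT. Qed.

Lemma mu_itv (a b : R) : a <= b -> mu `[a, b]%classic = (b - a)%:E.
Proof.
move=> ab; have -> : mu `[a, b]%classic = @lebesgue_measure R `[a, b]%classic by [].
rewrite lebesgue_measure_itv /= lte_fin; case: ltP => // ba.
by rewrite (_ : b = a) ?subrr//; apply/eqP; rewrite eq_le ab ba.
Qed.

Lemma mu_setT_gt0 : (0 < mu [set: T])%E.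
Proof.
apply: (@lt_le_trans _ _ (mu `[0, 1]%classic)).
  by rewrite mu_itv// subr0 lte01.
by apply: le_measure; rewrite ?inE//; exact: lset_itv.
Qed.

Lemma continuous_lmeas (h : R -> R) : continuous h -> measurable_fun [set: T] (h : T -> R).
Proof.
move=> /continuous_measurable_fun mh _ Y mY; rewrite setTI; apply: lset_borel.
by rewrite -[X in measurable X]setTI; exact: mh.
Qed.

Lemma lmeas_ccontinuous (g : R[i] -> R[i]) : ccontinuous g -> lmeas (fun x => g x%:C).
Proof.
move=> cg; have E (x : R) : x%:C = 0 + x%:C * 1 :> R[i] by rewrite add0r mulr1.
split; apply: continuous_lmeas.
- rewrite (_ : (fun x => _) = fun x => complex.Re (g (0 + x%:C * 1))); first exact: continuous_Re_line.
  by apply/funext => x; rewrite -E.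
- rewrite (_ : (fun x => _) = fun x => complex.Im (g (0 + x%:C * 1))); first exact: continuous_Im_line.
  by apply/funext => x; rewrite -E.
Qed.

Lemma lmeasD F G : lmeas F -> lmeas G -> lmeas (fun x => F x + G x).
Proof.
move=> [F1 F2] [G1 G2]; split.
- by under eq_fun do rewrite raddfD; exact: measurable_funD.
- by under eq_fun do rewrite raddfD; exact: measurable_funD.
Qed.

Lemma lmeasB F G : lmeas F -> lmeas G -> lmeas (fun x => F x - G x).
Proof.
move=> [F1 F2] [G1 G2]; split.
- by under eq_fun do rewrite raddfB; exact: measurable_funB.
- by under eq_fun do rewrite raddfB; exact: measurable_funB.
Qed.

Definition trunc D F : T -> R := (fun x : T => normc (F x)) \_ D.

Lemma truncE D F x : trunc D F x = if x \in D then normc (F x) else 0.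
Proof. by []. Qed.

Lemma trunc_ge0 D F x : 0 <= trunc D F x.
Proof. by rewrite truncE; case: ifP => // _; exact: normc_ge0. Qed.

Lemma mtrunc D F : lset D -> lmeas F -> measurable_fun [set: T] (trunc D F).
Proof.
move=> mD [F1 F2]; apply/(measurable_restrictT _ mD); apply: measurable_funTS.
rewrite (_ : (fun x : T => _) = fun x => Num.sqrt (complex.Re (F x) ^+ 2 + complex.Im (F x) ^+ 2)).
  apply: (@measurableT_comp _ _ _ _ _ _ (@Num.sqrt R)).
    by apply: continuous_measurable_fun; exact: sqrt_continuous.
  by apply: measurable_funD; exact: measurable_funX.
by apply/funext => x; rewrite -sqr_normc_ReIm sqrtr_sqr ger0_norm// normc_ge0.
Qed.

Lemma Lp_normE p D F : Lp_norm p D F = ('N[mu]_p[EFin \o trunc D F])%E.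
Proof. by rewrite /Lp_norm /trunc restrict_EFin. Qed.

Definition energy r D F : \bar R := (\int[mu]_x ((trunc D F x) `^ r)%:E)%E.

Lemma energy_ge0 r D F : (0 <= energy r D F)%E.
Proof. by apply: integral_ge0 => x _; rewrite lee_fin powR_ge0. Qed.

Lemma Lp_fin r D F : Lp_norm r%:E D F = (energy r D F `^ r^-1)%E.
Proof.
rewrite Lp_normE unlock /energy; congr (poweR _ _); apply: eq_integral => x _ /=.
by rewrite ger0_norm// trunc_ge0.
Qed.

(** Comparing the integral of the [r]-th power with [l `^ r] avoids roots of
    possibly infinite integrals. *)
Lemma LpP_fin r l D F : 0 < r -> 0 <= l ->
  (Lp_norm r%:E D F <= l%:E)%E <-> (energy r D F <= (l `^ r)%:E)%E.
Proof.
move=> r0 l0; rewrite Lp_fin; have := energy_ge0 r D F; case: (energy r D F) => [a a0|_|//].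
- rewrite poweR_EFin !lee_fin; have a0' : 0 <= a by [].
  split => H.
  + have -> : a = (a `^ r^-1) `^ r by rewrite -powRrM mulVf ?powRr1// gt_eqF.
    by apply: ge0_ler_powR; rewrite ?nnegrE ?powR_ge0// ltW.
  + have -> : l = (l `^ r) `^ r^-1 by rewrite -powRrM divff ?powRr1// gt_eqF.
    by apply: ge0_ler_powR; rewrite ?nnegrE ?powR_ge0// invr_ge0 ltW.
- by rewrite poweRyr ?invr_eq0 ?gt_eqF// !leye_eq.
Qed.

Lemma LpP_oo l D F : 0 <= l ->
  (Lp_norm +oo%E D F <= l%:E)%E <-> (\forall x \ae mu, trunc D F x <= l).
Proof.
move=> l0; rewrite Lp_normE unlock mu_setT_gt0.
split => [/ess_supP|] H.
- by apply: filterS H => x /=; rewrite lee_fin ger0_norm// trunc_ge0.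
- rewrite /=; apply/(@ess_supP _ _ _ mu).
  by apply: filterS H => x /=; rewrite lee_fin ger0_norm// trunc_ge0.
Qed.

Lemma Lp_ge0 p D F : (0 <= Lp_norm p D F)%E.
Proof. by rewrite Lp_normE Lnorm_ge0. Qed.

Lemma m_energy r D F : lset D -> lmeas F ->
  measurable_fun [set: T] (fun x => ((trunc D F x) `^ r)%:E).
Proof.
move=> mD mF; apply/measurable_EFinP.
by apply: (measurableT_comp (measurable_powR r)); exact: mtrunc.
Qed.

Lemma powR_homo r (x y : R) : 0 < r -> 0 <= x -> x <= y -> x `^ r <= y `^ r.
Proof.
move=> r0 x0 xy; have y0 : 0 <= y := le_trans x0 xy.
by apply: (ge0_ler_powR (ltW r0)); rewrite ?nnegrE.
Qed.

Lemma int_homo (D : set T) (f1 f2 : T -> R) : lset D -> measurable_fun D f1 -> measurable_fun D f2 ->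
  (forall x, D x -> 0 <= f1 x) -> (forall x, D x -> f1 x <= f2 x) ->
  (\int[mu]_(x in D) (f1 x)%:E <= \int[mu]_(x in D) (f2 x)%:E)%E.
Proof.
move=> mD m1 m2 f0 f12.
have e1 : measurable_fun D (EFin \o f1) by apply/measurable_EFinP.
have e2 : measurable_fun D (EFin \o f2) by apply/measurable_EFinP.
by apply: (ge0_le_integral mu mD _ e1 e2) => x Dx; rewrite lee_fin ?f0 ?f12.
Qed.

Lemma m_truncX r D F : lset D -> lmeas F ->
  measurable_fun [set: T] (fun x => (trunc D F x) `^ r).
Proof.
by move=> mD mF; apply: (measurableT_comp (measurable_powR r)); exact: mtrunc.
Qed.

Lemma Lp_le p D D' F F' l : (0 < p)%E -> 0 <= l -> lset D -> lset D' -> lmeas F -> lmeas F' ->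
  (forall x, trunc D F x <= trunc D' F' x) ->
  (Lp_norm p D' F' <= l%:E)%E -> (Lp_norm p D F <= l%:E)%E.
Proof.
case: p => [r| |//] + l0 mD mD' mF mF' tt.
- rewrite lte_fin => r0 /(LpP_fin _ _ r0 l0) H; apply/(LpP_fin _ _ r0 l0); apply: le_trans H.
  apply: int_homo; [exact: lset_setT|exact: m_truncX|exact: m_truncX| |] => x _.
    exact: powR_ge0.
  exact: powR_homo (trunc_ge0 _ _ _) _.
- move=> _ /(LpP_oo _ _ l0) H; apply/(LpP_oo _ _ l0); apply: filterS H => x; exact: le_trans.
Qed.

Lemma trunc_D D F G x : trunc D (fun x => F x + G x) x <= trunc D F x + trunc D G x.
Proof. by rewrite !truncE; case: ifP => _; rewrite ?addr0// le_normcD. Qed.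

(** The factor of [x `^ r] can be taken arbitrarily close to [1], which is what
    makes small perturbations harmless. *)
Lemma powR_quasi r e : 0 < r -> 0 < e -> exists2 K, 0 < K &
  forall x y : R, 0 <= x -> 0 <= y -> (x + y) `^ r <= (1 + e) * x `^ r + K * y `^ r.
Proof.
move=> r0 e0; pose c := (1 + e) `^ r^-1.
have c1 : 1 < c.
  have := @gt0_ltr_powR R r^-1; rewrite invr_gt0 => /(_ r0 1 (1 + e)); rewrite !nnegrE powR1.
  by apply; lra.
have cr : c `^ r = 1 + e by rewrite -powRrM mulVf ?gt_eqF// powRr1//; lra.
pose K := (1 + (c - 1)^-1) `^ r.
have c10 : 0 < c - 1 by rewrite subr_gt0.
have ci0 : 0 < (c - 1)^-1 by rewrite invr_gt0.
exists K; first by rewrite powR_gt0//; lra.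
move=> x y x0 y0; have [yx|xy] := leP y ((c - 1) * x).
- have H : x + y <= c * x by lra.
  apply: (@le_trans _ _ ((1 + e) * x `^ r)); last by rewrite lerDl mulr_ge0 ?powR_ge0.
  rewrite -cr -powRM//; last by lra.
  by apply: powR_homo => //; lra.
- have H : x + y <= (1 + (c - 1)^-1) * y.
    rewrite mulrDl mul1r addrC lerD2l mulrC ler_pdivlMr// mulrC; exact: ltW.
  apply: (@le_trans _ _ (K * y `^ r)); last by rewrite lerDr mulr_ge0 ?powR_ge0//; lra.
  rewrite -powRM//; last by lra.
  by apply: powR_homo => //; lra.
Qed.

Lemma energy_D r e K D F G : 0 < r -> 0 <= e -> 0 <= K -> lset D -> lmeas F -> lmeas G ->
  (forall x y : R, 0 <= x -> 0 <= y -> (x + y) `^ r <= e * x `^ r + K * y `^ r) ->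
  (energy r D (fun x => F x + G x)%R <= e%:E * energy r D F + K%:E * energy r D G)%E.
Proof.
move=> r0 e0 K0 mD mF mG H.
have m1 := m_energy r mD mF; have m2 := m_energy r mD mG.
have p1 k D' F' : 0 <= k -> forall x, setT x -> (0 <= k%:E * ((trunc D' F' x) `^ r)%:E)%E.
  by move=> k0 x _; rewrite -EFinM lee_fin mulr_ge0// powR_ge0.
have p2 D' F' x : setT x -> (0 <= ((trunc D' F' x) `^ r)%:E)%E.
  by move=> _; rewrite lee_fin powR_ge0.
rewrite /energy -(ge0_integralZl mu lset_setT m1 (p2 D F))// -(ge0_integralZl mu lset_setT m2 (p2 D G))//.
rewrite -(ge0_integralD mu lset_setT (p1 e D F e0) (measurable_funeM _ m1) (p1 K D G K0) (measurable_funeM _ m2)).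
under [leRHS]eq_integral => x _ do rewrite -!EFinM -EFinD.
apply: int_homo; first exact: lset_setT.
- exact: (m_truncX r mD (lmeasD mF mG)).
- exact: (measurable_funD (measurable_funM (measurable_cst _) (m_truncX r mD mF))
    (measurable_funM (measurable_cst _) (m_truncX r mD mG))).
- by move=> x _; exact: powR_ge0.
- move=> x _; apply: le_trans (H _ _ (trunc_ge0 _ _ _) (trunc_ge0 _ _ _)).
  by apply: powR_homo => //; [exact: trunc_ge0|exact: trunc_D].
Qed.

(** For [p < 1] the triangle inequality fails; stability under small
    perturbations and boundedness of sums hold for all [0 < p <= +oo]. *)
Lemma Lp_perturb p l l' : (0 < p)%E -> 0 <= l -> l < l' -> exists2 eta, 0 < eta &
  forall D F G, lset D -> lmeas F -> lmeas G ->
  (Lp_norm p D F <= l%:E)%E -> (Lp_norm p D G <= eta%:E)%E ->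
  (Lp_norm p D (fun x => F x + G x)%R <= l'%:E)%E.
Proof.
case: p => [r| |//]; last first.
  move=> _ l0 ll'; exists (l' - l); first by rewrite subr_gt0.
  move=> D F G mD mF mG; have l'0 : 0 <= l' by lra.
  have d0 : 0 <= l' - l by lra.
  move=> /(LpP_oo _ _ l0) HF /(LpP_oo _ _ d0) HG; apply/(LpP_oo _ _ l'0); apply: filterS2 HF HG => x h1 h2.
  by rewrite (le_trans (trunc_D _ _ _ _))//; lra.
rewrite lte_fin => r0 l0 ll'; have l'0 : 0 < l' by lra.
have lr : l `^ r < l' `^ r by rewrite gt0_ltr_powR ?nnegrE// ltW.
have lr0 : 0 <= l `^ r := powR_ge0 _ _.
pose d := l' `^ r - l `^ r; have d0 : 0 < d by rewrite subr_gt0.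
pose e := d / (2 * (l `^ r + 1)).
have e0 : 0 < e by rewrite divr_gt0// mulr_gt0//; lra.
have eE : e * l `^ r <= d / 2.
  by rewrite /e mulrAC ler_pdivrMr ?mulr_gt0//; [nra|lra].
have [K K0 HK] := powR_quasi r0 e0.
pose eta := (d / (2 * K)) `^ r^-1.
have eta0 : 0 < eta by rewrite powR_gt0// divr_gt0// mulr_gt0.
have etaE : eta `^ r = d / (2 * K).
  by rewrite -powRrM mulVf ?gt_eqF// powRr1// divr_ge0 ?mulr_ge0 ?(ltW K0) ?(ltW d0).
exists eta => // D F G mD mF mG.
move=> /(LpP_fin _ _ r0 l0) HF /(LpP_fin _ _ r0 (ltW eta0)) HG.
apply/(LpP_fin _ _ r0 (ltW l'0)).
have H := energy_D r0 (ltac:(lra) : 0 <= 1 + e) (ltW K0) mD mF mG HK.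
apply: le_trans H _.
apply: (@le_trans _ _ ((1 + e)%:E * (l `^ r)%:E + K%:E * (eta `^ r)%:E)%E).
  by apply: leeD; apply: lee_pmul => //; rewrite ?lee_fin ?energy_ge0//; lra.
rewrite -!EFinM -EFinD lee_fin etaE.
have -> : K * (d / (2 * K)) = d / 2 by field; rewrite gt_eqF.
have -> : l' `^ r = l `^ r + d by rewrite /d; ring.
lra.
Qed.

Lemma Lp_bounded_D p A B : (0 < p)%E -> 0 <= A -> 0 <= B -> exists2 K, 0 <= K &
  forall D F G, lset D -> lmeas F -> lmeas G ->
  (Lp_norm p D F <= A%:E)%E -> (Lp_norm p D G <= B%:E)%E ->
  (Lp_norm p D (fun x => F x + G x)%R <= K%:E)%E.
Proof.
case: p => [r| |//]; last first.
  move=> _ A0 B0; exists (A + B); first by lra.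
  move=> D F G mD mF mG /(LpP_oo _ _ A0) HF /(LpP_oo _ _ B0) HG.
  have AB0 : 0 <= A + B by lra.
  apply/(LpP_oo _ _ AB0); apply: filterS2 HF HG => x h1 h2.
  by rewrite (le_trans (trunc_D _ _ _ _))// lerD.
rewrite lte_fin => r0 A0 B0.
have [K K0 HK] := powR_quasi r0 ltr01.
pose S := (1 + 1) * A `^ r + K * B `^ r.
have S0 : 0 <= S by rewrite addr_ge0// mulr_ge0 ?powR_ge0//; lra.
exists (S `^ r^-1); first exact: powR_ge0.
move=> D F G mD mF mG /(LpP_fin _ _ r0 A0) HF /(LpP_fin _ _ r0 B0) HG.
apply/(LpP_fin _ _ r0 (powR_ge0 _ _)); rewrite -powRrM mulVf ?gt_eqF// powRr1//.
have H := energy_D r0 (ltac:(lra) : 0 <= 1 + 1 :> R) (ltW K0) mD mF mG HK.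
apply: le_trans H _.
have -> : S%:E = ((1 + 1)%:E * (A `^ r)%:E + K%:E * (B `^ r)%:E)%E by rewrite -!EFinM -EFinD.
apply: leeD; apply: lee_pmul => //; rewrite ?lee_fin ?energy_ge0//; lra.
Qed.

(** The factor is [(2 b) ^ (1 / p)] rounded up to an integral power of [1 + 2 b],
    with an exponent that depends on [p] only. *)
Lemma Lp_sup_bound p : (0 < p)%E -> exists m : nat, forall (b s : R) F, 0 <= b -> 0 <= s ->
  lmeas F -> (forall x, `|x| <= b -> normc (F x) <= s) ->
  (Lp_norm p `[(- b)%R, b] F <= (s * (1 + 2 * b) ^+ m)%:E)%E.
Proof.
case: p => [r| |//]; last first.
  move=> _; exists 0%N => b s F b0 s0 mF H; rewrite expr0 mulr1; apply/(LpP_oo _ _ s0).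
  apply: aeW => x; rewrite truncE; case: ifP => // xb; apply: H.
  by move: xb; rewrite inE /= in_itv /= ler_norml.
rewrite lte_fin => r0; exists (Num.bound r^-1) => b s F b0 s0 mF H.
have b1 : 1 <= 1 + 2 * b by lra.
have P0 : 0 <= (1 + 2 * b) ^+ Num.bound r^-1 by rewrite exprn_ge0//; lra.
apply/(LpP_fin _ _ r0 (mulr_ge0 s0 P0)).
have -> : energy r `[(- b)%R, b] F = (\int[mu]_(x in `[(- b)%R, b]) ((normc (F x)) `^ r)%:E)%E.
  rewrite integral_mkcond /energy; apply: eq_integral => x _.
  rewrite truncE patchE; case: ifP => //; rewrite powR0// gt_eqF//.
apply: (@le_trans _ _ (\int[mu]_(x in `[(- b)%R, b]) (s `^ r)%:E)%E).
  apply: int_homo; first exact: lset_itv.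
  - apply: (measurableT_comp (measurable_powR r)).
    apply: measurable_funTS; have := mtrunc lset_setT mF.
    by rewrite (_ : trunc setT F = fun x => normc (F x))//; apply/funext => x; rewrite truncE in_setT.
  - exact: measurable_cst.
  - by move=> x _; exact: powR_ge0.
  - move=> x /=; rewrite in_itv /= -ler_norml => /H h.
    exact: powR_homo (normc_ge0 _) h.
have bb : - b <= b by lra.
rewrite (integral_cst mu (lset_itv (- b) b)) [X in (_ * X <= _)%E](mu_itv bb).
rewrite -EFinM lee_fin powRM// ler_wpM2l ?powR_ge0//.
have h1 : 1 <= (Num.bound (r^-1))%:R * r.
  by rewrite -ler_pdivrMr// div1r ltW// archi_boundP// invr_ge0 ltW.
apply: (@le_trans _ _ ((1 + 2 * b) `^ 1)); first by rewrite powRr1; lra.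
rewrite -powR_mulrn; last by lra.
by rewrite -powRrM ler_powR.
Qed.

End LpNorm.

(** * Semicontinuity of the norms and interior bounds for polynomials *)

Section LpLimits.
Context {R : realType}.
Implicit Types (F G : R -> R[i]) (D : set R) (p : \bar R) (r l : R).
Local Notation T := (lebesgueType R).
Local Notation mu := (@completed_lebesgue_measure R).
Local Notation lmeas := (@lebesgue_measurable_fun R).

Lemma powR_cvg I (F : set_system I) (FF : Filter F) (u : I -> R) (h r : R) : 0 < r ->
  (forall i, 0 <= u i) -> 0 <= h -> u @ F --> h -> (fun i => u i `^ r) @ F --> h `^ r.
Proof.
move=> r0 u0; rewrite le_eqVlt => /predU1P[<- uh|h0 uh].
  apply/cvgrPdist_lt => e e0; rewrite powR0 ?gt_eqF//.
  have e1 : 0 < e `^ r^-1 by rewrite powR_gt0.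
  have /cvgrPdist_lt /(_ _ e1) := uh; apply: filterS => i.
  rewrite !sub0r !normrN !ger0_norm ?powR_ge0// => ui.
  have -> : e = (e `^ r^-1) `^ r by rewrite -powRrM mulVf ?gt_eqF// powRr1// ltW.
  by apply: (gt0_ltr_powR r0); rewrite ?nnegrE// ltW.
have dh : derivable (@powR R ^~ r) h 1 by apply: derivable_powR; rewrite in_itv /= andbT.
have ch : {for h, continuous (@powR R ^~ r)}.
  by apply: differentiable_continuous; exact/derivable1_diffP.
by apply: (@continuous_cvg _ _ _ F FF u (@powR R ^~ r) h).
Qed.

Lemma limn_einf_le (v : nat -> \bar R) (l : \bar R) :
  (forall n, v n <= l)%E -> (limn_einf v <= l)%E.
Proof.
move=> vl; rewrite limn_einf_lim; apply: lime_le; first exact: is_cvg_einfs.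
apply: nearW => n; apply: le_trans (vl n); apply: ereal_inf_lbound.
by exists n => /=.
Qed.

(** Lower semicontinuity of the norms under pointwise convergence on sets
    exhausting the line (Fatou). *)
Lemma Lp_lsc p l (Fn : nat -> R -> R[i]) (Dn : nat -> set R) F : (0 < p)%E -> 0 <= l ->
  (forall j, lset (Dn j)) -> (forall j, lmeas (Fn j)) -> lmeas F ->
  (forall x, \forall j \near \oo, Dn j x) ->
  (forall x, normc (Fn j x) @[j --> \oo] --> normc (F x)) ->
  (forall j, (Lp_norm p (Dn j) (Fn j) <= l%:E)%E) -> (Lp_norm p setT F <= l%:E)%E.
Proof.
move=> p0 l0 mD mFn mF HD HF HL.
have tc x : trunc (Dn j) (Fn j) x @[j --> \oo] --> trunc setT F x.
  rewrite truncE in_setT; apply: cvg_trans (HF x); apply: near_eq_cvg.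
  by apply: filterS (HD x) => j Djx; rewrite truncE mem_set.
case: p p0 HL => [r| |//]; last first.
  move=> _ HL; apply/(LpP_oo _ _ l0).
  have /ae_foralln : forall j, \forall x \ae mu, trunc (Dn j) (Fn j) x <= l.
    by move=> j; apply/(LpP_oo _ _ l0)/HL.
  apply: filterS => x H; rewrite leNgt; apply/negP => lx.
  have := tc x => /cvgrPdist_lt /(_ (trunc setT F x - l)).
  rewrite subr_gt0 => /(_ lx) [n _ /(_ n (leqnn n))] /=.
  by have := H n; rewrite ltr_norml; lra.
rewrite lte_fin => r0 HL; apply/(LpP_fin _ _ r0 l0).
have mfn n : measurable_fun [set: T] (fun x : T => ((trunc (Dn n) (Fn n) x) `^ r)%:E).
  exact: m_energy.
have fn0 n (x : T) : setT x -> (0 <= ((trunc (Dn n) (Fn n) x) `^ r)%:E)%E.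
  by move=> _; rewrite lee_fin powR_ge0.
have := fatou mu lset_setT mfn fn0.
have -> : energy r setT F = (\int[mu]_x limn_einf (fun n => ((trunc (Dn n) (Fn n) x) `^ r)%:E))%E.
  apply: eq_integral => x _; apply/esym.
  have H : ((trunc (Dn n) (Fn n) x) `^ r)%:E @[n --> \oo] --> ((trunc setT F x) `^ r)%:E.
    apply: cvg_EFin; first exact: nearW.
    by apply: powR_cvg => //; [move=> j; exact: trunc_ge0|exact: trunc_ge0].
  by rewrite (cvg_limn_einf_sup H).1.
move=> /le_trans; apply; apply: limn_einf_le => n.
exact/(LpP_fin _ _ r0 l0).
Qed.

Lemma ae_interval (Q : T -> Prop) (a b : R) : a < b -> (\forall x \ae mu, Q x) ->
  exists2 x : R, a <= x <= b & Q x.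
Proof.
move=> ab [N [mN N0 HN]]; apply: contrapT => H.
have sub : `[a, b]%classic `<=` N.
  move=> x /=; rewrite in_itv /= => xab; apply: HN => Qx; apply: H; by exists x.
have : (mu `[a, b]%classic <= mu N)%E by apply: le_measure; rewrite ?inE//; exact: lset_itv.
rewrite mu_itv ?(ltW ab)// N0 lee_fin subr_le0; lra.
Qed.

Lemma horner_lmeas (P : {poly R[i]}) : lmeas (fun x => P.[x%:C]).
Proof. by apply: lmeas_ccontinuous; exact: ccontinuous_horner. Qed.

Lemma continuous_normc_real (g : R[i] -> R[i]) : ccontinuous g ->
  continuous (fun x : R => normc (g x%:C)).
Proof.
move=> cg x; apply/cvgrPdist_le => e e0; have [s s0 Hs] := crcont_normc cg x%:C e0.
apply/nbhs_ballP; exists s => //= y; rewrite /ball /= => xy.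
rewrite distrC in xy; have := Hs (y - x)%:C; rewrite normc_real => /(_ xy).
by rewrite -rmorphD /= [x + _]addrC subrK distrC.
Qed.

(** The weight vanishes to order [k] at the ends of the interval, which
    compensates the possible growth of [P] there; near the maximum [x0] of
    the weighted polynomial, [P] is at most [2^k |P x0|] on an interval of
    radius proportional to the weight, and a Bernstein type estimate bounds
    its variation. *)
Lemma nikolskii_fin r (delta Lam : R) : 0 < r -> 0 < delta -> delta < 1 -> 0 < Lam ->
  exists2 K, 0 <= K & forall n b (P : {poly R[i]}) A, 1 <= b -> n%:R <= Lam * b ->
  (size P <= n.+1)%N -> 0 <= A ->
  (Lp_norm r%:E `[(- b)%R, b] (fun x => P.[x%:C]) <= A%:E)%E ->
  forall x : R, `|x| <= (1 - delta) * b -> normc P.[x%:C] <= K * A.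
Proof.
move=> r0 d0 d1 L0; pose k := Num.bound (r^-1).
have kr : 1 <= k%:R * r.
  by rewrite -ler_pdivrMr// div1r ltW// archi_boundP// invr_ge0 ltW.
pose c : R := 8 * expR 1 * 2 ^+ k.
have c0 : 0 < c by rewrite mulr_gt0 ?exprn_gt0// mulr_gt0// expR_gt0.
pose K1 := 2 `^ r * c * (Lam + 1).
have K10 : 0 <= K1 by rewrite mulr_ge0 ?mulr_ge0 ?powR_ge0 ?(ltW c0)//; lra.
exists (K1 `^ r^-1 / delta ^+ k); first by rewrite divr_ge0 ?powR_ge0// exprn_ge0// ltW.
move=> n b P A b1 nL sP A0 HA.
have b0 : 0 < b by lra.
pose rho (x : R) := 1 - (x / b) ^+ 2.
pose phi x := normc P.[x%:C] * rho x ^+ k.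
have cphi : continuous phi.
  move=> x; apply: cvgM; first exact: (continuous_normc_real (ccontinuous_horner P)).
  have cr : rho y @[y --> x] --> rho x.
    apply: cvgB; first exact: cvg_cst.
    have cxb : (y / b : R) @[y --> x] --> x / b by apply: cvgM; [exact: cvg_id|exact: cvg_cst].
    by rewrite expr2; under eq_fun do rewrite expr2; exact: cvgM.
  by apply: (@continuous_cvg _ _ _ _ _ rho (fun y : R => y ^+ k) (rho x)) => //; exact: exprn_continuous.
have bb : - b <= b by lra.
have [x0 x0b Hmax] := EVT_max bb (continuous_subspaceT cphi).
move: x0b; rewrite in_itv /= => x0b.
have rho_ge0 x : - b <= x <= b -> 0 <= rho x.
  move=> xb; rewrite subr_ge0 -[leRHS](expr1n _ 2) -[_ ^+ 2]real_normK ?num_real//.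
  by rewrite lerXn2r ?nnegrE// normrM normfV (gtr0_norm b0) ler_pdivrMr// mul1r ler_norml.
have rho_inner x : `|x| <= (1 - delta) * b -> delta <= rho x.
  move=> xd; have xb : `|x / b| <= 1 - delta by rewrite normrM normfV (gtr0_norm b0) ler_pdivrMr.
  rewrite /rho -[_ ^+ 2]real_normK ?num_real//.
  have : `|x / b| ^+ 2 <= (1 - delta) ^+ 2 by rewrite lerXn2r ?nnegrE//; lra.
  nra.
suff main : phi x0 <= K1 `^ r^-1 * A.
  move=> x xd; have xb : - b <= x <= b.
    by rewrite -ler_norml (le_trans xd)// ler_piMl ?(ltW b0)//; lra.
  have := Hmax x; rewrite in_itv /= => /(_ xb) /le_trans /(_ main).
  rewrite /phi => H; rewrite mulrAC ler_pdivlMr ?exprn_gt0// (le_trans _ H)//.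
  rewrite ler_wpM2l ?normc_ge0// lerXn2r ?nnegrE ?(ltW d0) ?rho_inner// (rho_ge0 x xb).
  by [].
have r00 := rho_ge0 x0 x0b.
have [z|nz] := eqVneq (phi x0) 0; first by rewrite z mulr_ge0// powR_ge0.
have m00 : normc P.[x0%:C] != 0 by move: nz; rewrite /phi mulf_eq0 negb_or => /andP[].
have m0 : 0 < normc P.[x0%:C] by rewrite lt_def m00 normc_ge0.
set m := normc P.[x0%:C] in m00 m0.
have k_gt0 : (0 < k)%N by rewrite lt0n; apply/eqP => k0; move: kr; rewrite k0 mul0r; lra.
have rp : 0 < rho x0.
  rewrite lt_def r00 andbT; apply/eqP => z; move: nz.
  by rewrite /phi z expr0n gtn_eqF// mulr0 eqxx.
have rle1 : rho x0 <= 1 by rewrite lerBlDr lerDl sqr_ge0.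
pose d := b * rho x0 / 4.
have dd0 : 0 < d by rewrite divr_gt0// mulr_gt0.
have rhoE x : b ^+ 2 * rho x = b ^+ 2 - x ^+ 2.
  by rewrite /rho expr_div_n; field; rewrite gt_eqF.
have near x : `|x - x0| <= d -> - b <= x <= b /\ rho x0 / 2 <= rho x.
  move=> xx0; have xb : - b <= x <= b.
    move: xx0; rewrite ler_norml => /andP[h1 h2].
    have E := rhoE x0; move/andP: x0b => [h3 h4].
    have e1 : b * d * 4 = b ^+ 2 - x0 ^+ 2 by rewrite -E /d; field.
    have e2 : 2 * d <= b - x0 by rewrite -(ler_pM2l b0); nra.
    have e3 : 2 * d <= b + x0 by rewrite -(ler_pM2l b0); nra.
    by apply/andP; split; lra.
  split=> //; rewrite -(ler_pM2l (exprn_gt0 2 b0)) mulrA [b ^+ 2 * rho x]rhoE.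
  have E := rhoE x0; rewrite E.
  have e1 : b * d * 4 = b ^+ 2 - x0 ^+ 2 by rewrite -E /d; field.
  move: xx0 xb x0b; rewrite ler_norml => /andP[h1 h2] /andP[h3 h4] /andP[h5 h6].
  have : (x - x0) * (x + x0) <= d * (2 * b).
    have [s|s] := leP 0 (x + x0); nra.
  by lra.
have Bn x : `|x| <= d -> normc (P \Po ('X + (x0%:C)%:P)).[x%:C] <= 2 ^+ k * m.
  move=> xd; rewrite horner_comp hornerD hornerX hornerC -rmorphD /=.
  have [yb yr] := near (x + x0) (ltac:(by rewrite addrK)).
  have := Hmax (x + x0); rewrite in_itv /= => /(_ yb); rewrite /phi -/m.
  have ry : 0 < rho (x + x0) by lra.
  have : (rho x0 / 2) ^+ k <= rho (x + x0) ^+ k by rewrite lerXn2r ?nnegrE; lra.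
  move=> h1 h2; rewrite -(ler_pM2r (exprn_gt0 k ry)) (le_trans h2)//.
  have -> : rho x0 ^+ k = 2 ^+ k * (rho x0 / 2) ^+ k by rewrite -exprMn mulrC divfK.
  rewrite mulrCA mulrA; apply: ler_wpM2l h1.
  by rewrite mulr_ge0 ?exprn_ge0 ?(ltW m0).
have sQ : (size (P \Po ('X + (x0%:C)%:P)) <= n.+1)%N.
  by rewrite size_comp_poly2// size_XaddC.
have BG := bernstein_growth dd0 sQ Bn.
pose s := d / n.+1%:R; have s0 : 0 < s by rewrite divr_gt0.
have Bs w : normc (w - x0%:C) <= s -> normc P.[w] <= 2 ^+ k * m * expR 1.
  move=> ws; have := BG (w - x0%:C); rewrite horner_comp hornerD hornerX hornerC subrK => /le_trans; apply.
  apply: ler_wpM2l; first by rewrite mulr_ge0 ?exprn_ge0 ?(ltW m0).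
  rewrite ler_expR.
  apply: (@le_trans _ _ (n%:R * (s / d))).
    by apply: ler_wpM2l; [exact: ler0n|rewrite ler_pM2r ?invr_gt0].
  rewrite /s mulrAC divff ?gt_eqF// mul1r ler_pdivrMr// mul1r ler_nat.
  exact: leqnSn.
have LP := poly_lipschitz s0 Bs.
pose h := s / (4 * expR 1 * 2 ^+ k).
have e40 : 0 < 4 * expR 1 * 2 ^+ k :> R by rewrite mulr_gt0 ?exprn_gt0// mulr_gt0// expR_gt0.
have h0 : 0 < h by rewrite divr_gt0.
have hs : h <= s.
  rewrite ler_pdivrMr// ler_peMr ?(ltW s0)// -[leLHS]mulr1 ler_pM//; last by rewrite exprn_ege1// ler1n.
  have := @expR_ge1Dx R 1; lra.
have sd : s <= d.
  by rewrite ler_pdivrMr// ler_peMr ?(ltW dd0)// ler1n.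
have low x : `|x - x0| <= h -> m / 2 <= normc P.[x%:C].
  move=> xh; have E : x%:C - x0%:C = (x - x0)%:C by rewrite rmorphB.
  have := LP x%:C; rewrite E normc_real => /(_ (le_trans xh hs)).
  have -> : 2 * (2 ^+ k * m * expR 1) / s * `|x - x0| = (m / 2) * (`|x - x0| / h).
    by rewrite /h; field; rewrite !gt_eqF ?exprn_gt0 ?expR_gt0.
  have : (m / 2) * (`|x - x0| / h) <= m / 2.
    by rewrite ler_piMr ?divr_ge0 ?(ltW m0)// ler_pdivrMr// mul1r.
  have := normc_triB P.[x0%:C] P.[x%:C]; rewrite normc_distC -/m; lra.
have D1 x : x0 - h <= x <= x0 + h -> `|x - x0| <= h by rewrite ler_norml; lra.
have E1 : (((m / 2) `^ r)%:E * (2 * h)%:E <= (A `^ r)%:E)%E.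
  have /(LpP_fin _ _ r0 A0) := HA; apply: le_trans.
  pose J := `[x0 - h, x0 + h]%classic : set T.
  have mJ : lset J by exact: lset_itv.
  have -> : (((m / 2) `^ r)%:E * (2 * h)%:E = \int[mu]_(x in J) ((m / 2) `^ r)%:E)%E.
    have hh : x0 - h <= x0 + h by lra.
    rewrite (integral_cst mu mJ) [X in _ = (_ * X)%E](mu_itv hh).
    by rewrite (_ : x0 + h - (x0 - h) = 2 * h)//; ring.
  rewrite integral_mkcond /energy.
  have mc : measurable_fun [set: T] ((fun=> (m / 2) `^ r) \_ J : T -> R).
    by apply/(measurable_restrictT _ mJ); exact: measurable_cst.
  apply: (@le_trans _ _ (\int[mu]_x (((fun=> (m / 2) `^ r) \_ J) x)%:E)%E).
    rewrite le_eqVlt; apply/orP; left; apply/eqP.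
    by apply: eq_integral => x _; rewrite !patchE; case: ifP.
  apply: int_homo; [exact: lset_setT|exact: mc| | |].
  - by apply: m_truncX; [exact: lset_itv|exact: horner_lmeas].
  - by move=> x _; rewrite patchE; case: ifP => // _; exact: powR_ge0.
  - move=> x _; rewrite patchE; case: ifP => [|_]; last exact: powR_ge0.
    rewrite inE /J /= in_itv /= => /D1 xh; rewrite truncE.
    have [xb _] := near x (le_trans xh (le_trans hs sd)).
    rewrite mem_set /=; last by rewrite in_itv.
    by apply: powR_homo => //; [lra|exact: low].
rewrite -EFinM lee_fin in E1.
have P1 : phi x0 `^ r <= K1 * A `^ r.
  have F1 : phi x0 `^ r <= m `^ r * rho x0.
    rewrite /phi -/m powRM ?exprn_ge0 ?(ltW m0)// ler_wpM2l ?powR_ge0//.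
    by rewrite -powR_mulrn// -powRrM; apply: ge1r_powR; rewrite ?rp.
  apply: (le_trans F1).
  have E2 : 2 * h = b * rho x0 / (c * n.+1%:R).
    by rewrite /h /s /d /c; field; rewrite !gt_eqF ?exprn_gt0 ?expR_gt0.
  have E3 : (m / 2) `^ r = m `^ r / 2 `^ r.
    have p2 : 2 `^ r != 0 :> R by rewrite gt_eqF// powR_gt0.
    have i2 : 0 <= 2^-1 :> R by rewrite invr_ge0.
    rewrite (powRM r (ltW m0) i2); congr (_ * _); apply: (mulfI p2).
    by rewrite -powRM// !divff ?powR1.
  move: E1; rewrite E2 E3.
  have p2 : 0 < 2 `^ r :> R by rewrite powR_gt0.
  have n0 : 0 < n.+1%:R :> R by [].
  have -> : m `^ r / 2 `^ r * (b * rho x0 / (c * n.+1%:R)) =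
      (m `^ r * rho x0) * b / (2 `^ r * c * n.+1%:R).
    by field; rewrite !gt_eqF.
  rewrite ler_pdivrMr ?mulr_gt0// => E1.
  rewrite -(ler_pM2r b0) (le_trans E1)// [leRHS]mulrAC [leRHS]mulrC.
  rewrite ler_wpM2l ?powR_ge0// /K1 -[leRHS]mulrA.
  apply: ler_wpM2l; first by rewrite mulr_ge0 ?(ltW p2) ?(ltW c0).
  by rewrite mulrDl mul1r -natr1; lra.
have p0 : 0 <= phi x0 by rewrite mulr_ge0 ?normc_ge0// exprn_ge0.
have -> : phi x0 = (phi x0 `^ r) `^ r^-1 by rewrite -powRrM divff ?gt_eqF// powRr1.
have -> : A = (A `^ r) `^ r^-1 by rewrite -powRrM divff ?gt_eqF// powRr1.
rewrite -powRM ?powR_ge0//; apply: powR_homo; rewrite ?invr_gt0 ?powR_ge0//.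
Qed.

(** Nikolskii type inequality away from the end points: as long as the
    degree is at most a fixed multiple of the length of the interval, the
    constant is uniform. *)
Theorem lp_interior p (delta Lam : R) : (0 < p)%E -> 0 < delta -> delta < 1 -> 0 < Lam ->
  exists2 K, 0 <= K & forall n b (P : {poly R[i]}) A, 1 <= b -> n%:R <= Lam * b ->
  (size P <= n.+1)%N -> 0 <= A ->
  (Lp_norm p `[(- b)%R, b] (fun x => P.[x%:C]) <= A%:E)%E ->
  forall x : R, `|x| <= (1 - delta) * b -> normc P.[x%:C] <= K * A.
Proof.
case: p => [r| |//]; first by rewrite lte_fin; exact: nikolskii_fin.
move=> _ d0 d1 L0; exists 1 => // n b P A b1 _ _ A0 /(LpP_oo _ _ A0) HA x xd.
rewrite mul1r; apply/ler_addgt0Pr => e e0.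
have := continuous_normc_real (ccontinuous_horner P) (x := x) => /cvgrPdist_le /(_ e e0).
move=> /nbhs_ballP [s /= s0 Hs].
have xb : `|x| < b by rewrite (le_lt_trans xd)// gtr_pMl//; lra.
move: xb; rewrite ltr_norml => /andP[h1 h2].
pose t := Num.min (s / 2) (b - x).
have t0 : 0 < t by rewrite lt_min divr_gt0// subr_gt0.
have ts : t <= s / 2 by rewrite ge_min lexx.
have tb : t <= b - x by rewrite ge_min lexx orbT.
have xt : x < x + t by rewrite ltrDl.
have [y /andP[y1 y2]] := ae_interval xt HA.
rewrite truncE mem_set; last by rewrite /= in_itv /=; apply/andP; split; lra.
have := Hs y; rewrite /ball /= => Hy HyA.
have : `|normc P.[x%:C] - normc P.[y%:C]| <= e.
  by apply: Hy; rewrite distrC ger0_norm; lra.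
by rewrite ler_norml; lra.
Qed.

End LpLimits.

(** * Continuity of dilations in the mean *)

Section Dilation.
Context {R : realType}.
Implicit Types (r : R).
Local Notation T := (lebesgueType R).
Local Notation mu := (@completed_lebesgue_measure R).

(** The completed measure and the Borel one integrate continuous functions in
    the same way, so that the change of variables formula transfers. *)
Lemma int_completed (h : R -> R) : continuous h -> (forall x, 0 <= h x) ->
  (\int[mu]_x (h x)%:E = \int[@lebesgue_measure R]_x (h x)%:E)%E.
Proof.
move=> ch h0.
pose phi : T -> measurableTypeR R := fun x => x.
have mphi : measurable_fun [set: T] phi.
  by move=> _ Y mY; rewrite setTI; exact: lset_borel.
have mh : measurable_fun [set: measurableTypeR R] (fun x => (h x)%:E).
  by apply/measurable_EFinP; exact: continuous_measurable_fun.
have H := @ge0_integral_pushforward _ _ _ _ R phi mphi mu setT (fun x => (h x)%:E)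
  measurableT mh (fun x _ => h0 x).
rewrite preimage_setT in H; rewrite -[LHS]H.
by apply: eq_measure_integral.
Qed.

Lemma int_dilation (h : R -> R) (rho : R) : 0 < rho -> continuous h -> (forall x, 0 <= h x) ->
  (\int[mu]_x (h (rho * x))%:E = rho^-1%:E * \int[mu]_x (h x)%:E)%E.
Proof.
move=> rho0 ch h0.
have crho : continuous (fun x : R => rho * x) by move=> x; apply: cvgM; [exact: cvg_cst|exact: cvg_id].
have chr : continuous (fun x => h (rho * x)).
  by move=> x; apply: continuous_comp; [exact: crho|exact: ch].
rewrite !int_completed//.
have D (x : R) : is_derive x 1 (fun x : R => rho * x) rho.
  by apply: (is_derive_eq (is_deriveZ rho (is_derive_id x 1))); rewrite /GRing.scale /= mulr1.
have D1 : (fun x : R => rho * x)^`()%classic = fun=> rho.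
  by apply/funext => x; rewrite derive1E; case: (D x).
have -> : (\int[@lebesgue_measure R]_x (h x)%:E =
   \int[@lebesgue_measure R]_x (((h \o (fun x : R => rho * x)) * (fun x : R => rho * x)^`()%classic)%R x)%:E)%E.
  apply: increasing_ge0_integration_by_substitutionT => //.
  - by move=> x y xy; rewrite ltr_pM2l.
  - by rewrite D1 => x; exact: cvg_cst.
  - by rewrite D1; exact: is_cvg_cst.
  - by rewrite D1; exact: is_cvg_cst.
  - exact: (gt0_cvgMrNy rho0 (@cvg_id _ _)).
  - exact: (gt0_cvgMry rho0 (@cvg_id _ _)).
rewrite D1.
have m1 : measurable_fun [set: measurableTypeR R] (fun x => (h (rho * x))%:E).
  by apply/measurable_EFinP; exact: continuous_measurable_fun.
have hE : (\int[@lebesgue_measure R]_x (((h \o (fun x : R => rho * x)) * (fun=> rho))%R x)%:E =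
    rho%:E * \int[@lebesgue_measure R]_x (h (rho * x)%R)%:E)%E.
  rewrite -(ge0_integralZl _ measurableT m1); last by rewrite lee_fin ltW.
    by apply: eq_integral => x _; rewrite -EFinM mulrC.
  by move=> x _; rewrite lee_fin.
by rewrite hE muleA -EFinM mulVf ?gt_eqF// mul1e.
Qed.

Lemma continuous_normcX r (g : R[i] -> R[i]) : 0 < r -> ccontinuous g ->
  continuous (fun x : R => normc (g x%:C) `^ r).
Proof.
move=> r0 cg x; apply: powR_cvg => //; first by move=> y; exact: normc_ge0.
  exact: normc_ge0.
exact: continuous_normc_real.
Qed.

(** Riesz-Scheffe argument: the norms of the dilates converge, so pointwise
    convergence upgrades to convergence in norm by Fatou. *)
Theorem dilation_cont r (g : R[i] -> R[i]) (s eta : R) : 0 < r -> ccontinuous g ->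
  (Lp_norm r%:E setT (fun x => g x%:C) < +oo)%E -> s < 1 -> 0 < eta ->
  exists2 rho, s < rho < 1 &
    (Lp_norm r%:E setT (fun x => g (rho * x)%:C - g x%:C)%R <= eta%:E)%E.
Proof.
move=> r0 cg gfin s1 eta0.
pose u (x : R) := normc (g x%:C) `^ r.
have cu : continuous u by exact: continuous_normcX.
have u0 x : 0 <= u x by exact: powR_ge0.
have truncT F (x : T) : trunc setT F x = normc (F x) by rewrite truncE in_setT.
have [N N0 NE] : exists2 N : R, 0 <= N & (\int[mu]_x (u x)%:E = N%:E)%E.
  have : (energy r setT (fun x => g x%:C) < +oo)%E.
    move: gfin; rewrite Lp_fin => /lty_poweRy; apply.
    by rewrite invr_eq0 gt_eqF.
  have -> : energy r setT (fun x => g x%:C) = (\int[mu]_x (u x)%:E)%E.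
    by apply: eq_integral => x _; rewrite truncT.
  have : (0 <= \int[mu]_x (u x)%:E)%E by apply: integral_ge0 => x _; rewrite lee_fin.
  by case: (\int[mu]_x _)%E => // N N0 _; exists N.
have [K K0 HK] := powR_quasi r0 ltr01.
pose c := Num.max 2 K.
have c0 : 0 < c by rewrite lt_max ltr0n.
have Hc (x y : R) : 0 <= x -> 0 <= y -> (x + y) `^ r <= c * (x `^ r + y `^ r).
  move=> x0 y0; apply: le_trans (HK x y x0 y0) _; rewrite mulrDr lerD//.
    by rewrite ler_wpM2r ?powR_ge0// le_max lexx.
  by rewrite ler_wpM2r ?powR_ge0// le_max lexx orbT.
pose M : R := Num.max s 0.
pose rho (j : nat) : R := 1 - (1 - M) / j.+2%:R.
have ms : M < 1 by rewrite /M gt_max s1 ltr01.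
have ms0 : 0 <= M by rewrite /M le_max lexx orbT.
have rho_s j : M < rho j < 1.
  have d1 : (1 - M) / j.+2%:R < 1 - M.
    by rewrite ltr_pdivrMr// ltr_pMr ?subr_gt0// ltr1n.
  have d2 : 0 < (1 - M) / j.+2%:R by rewrite divr_gt0// subr_gt0.
  apply/andP; split; first by rewrite /rho ltrBrDr -ltrBrDl.
  by rewrite /rho ltrBlDr ltrDl.
have rho_gt0 j : 0 < rho j by have /andP[h _] := rho_s j; exact: le_lt_trans ms0 h.
have rho1 : rho j @[j --> \oo] --> (1 : R).
  rewrite -[X in _ --> X]subr0; apply: cvgB; first exact: cvg_cst.
  rewrite -[X in _ --> X](mulr0 (1 - M)); apply: cvgM; first exact: cvg_cst.
  by have := @cvg_harmonic R; rewrite -cvg_shiftS; apply: cvg_trans; apply: near_eq_cvg; exact: nearW.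
apply: contrapT => H.
have HI j : ((eta `^ r)%:E <= \int[mu]_x (normc (g (rho j * x)%:C - g x%:C) `^ r)%R%:E)%E.
  have /andP[h1 h2] := rho_s j.
  rewrite leNgt; apply/negP => h; apply: H; exists (rho j).
    by rewrite h2 (le_lt_trans _ h1)// /M le_max lexx.
  apply/(LpP_fin _ _ r0 (ltW eta0)); apply: le_trans (ltW h).
  by rewrite le_eqVlt; apply/orP; left; apply/eqP; apply: eq_integral => x _; rewrite truncT.
pose w j (x : R) := normc (g (rho j * x)%:C - g x%:C) `^ r.
(* nonnegative, with integrals known up to that of [w]; Fatou applies to [hj] *)
pose hj j (x : R) := c * (u (rho j * x) + u x) - w j x.
have wc j x : w j x <= c * (u (rho j * x) + u x).
  apply: le_trans (Hc _ _ (normc_ge0 _) (normc_ge0 _)).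
  by apply: powR_homo (normc_ge0 _) (normcB _ _).
have hj0 j x : 0 <= hj j x by rewrite subr_ge0.
have crho j : continuous (fun x : R => rho j * x) by move=> x; apply: cvgM; [exact: cvg_cst|exact: cvg_id].
have cud j : continuous (fun x => u (rho j * x)).
  by move=> x; apply: continuous_comp; [exact: crho|exact: cu].
have pw j : ccontinuous (fun z => g ((rho j)%:C * z) - g z).
  move=> z; apply: ccontB => // e e0; have [d d0 Hd] := cg ((rho j)%:C * z) e e0.
  exists d => // h hd; rewrite mulrDr; apply: Hd.
  rewrite Normc.normcM normc_real gtr0_norm// (le_lt_trans _ hd)// ler_piMl ?normc_ge0//.
  by have /andP[_ /ltW] := rho_s j.
have cw j : continuous (w j).
  rewrite (_ : w j = fun x => normc ((fun z => g ((rho j)%:C * z) - g z) x%:C) `^ r).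
    exact: (@continuous_normcX r (fun z => g ((rho j)%:C * z) - g z) r0 (pw j)).
  by apply/funext => x; rewrite /w rmorphM.
have csum j : continuous (fun x => c * (u (rho j * x) + u x)).
  by move=> x; apply: cvgM; [exact: cvg_cst|apply: cvgD; [exact: cud|exact: cu]].
have mE (h : R -> R) : continuous h -> measurable_fun [set: T] (fun x : T => (h x)%:E).
  by move=> ch; apply/measurable_EFinP; exact: continuous_lmeas.
have chj j : continuous (hj j) by move=> x; apply: cvgB; [exact: csum|exact: cw].
have p0 (h : R -> R) : (forall x, 0 <= h x) -> forall x : T, setT x -> (0 <= (h x)%:E)%E.
  by move=> h0 x _; rewrite lee_fin.
have w0 j x : 0 <= w j x by exact: powR_ge0.
have Isum j : (\int[mu]_x (hj j x)%:E + \int[mu]_x (w j x)%:E = (c * (((rho j)^-1 + 1) * N))%:E)%E.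
  rewrite -(ge0_integralD mu lset_setT (p0 _ (hj0 j)) (mE _ (chj j)) (p0 _ (w0 j)) (mE _ (cw j))).
  transitivity (\int[mu]_x (c%:E * ((u (rho j * x))%:E + (u x)%:E)))%E.
    by apply: eq_integral => x _; rewrite -!EFinD -EFinM /hj subrK.
  have ud0 x : 0 <= u (rho j * x) by exact: u0.
  rewrite (ge0_integralZl mu lset_setT); last 3 first.
  - by apply: emeasurable_funD; exact: mE.
  - by move=> x _; rewrite -EFinD lee_fin addr_ge0.
  - by rewrite lee_fin ltW.
  rewrite (ge0_integralD mu lset_setT (p0 _ ud0) (mE _ (cud j)) (p0 _ u0) (mE _ cu)).
  rewrite (int_dilation (rho_gt0 j) cu u0) NE.
  by rewrite EFinM; congr (_ * _)%E; rewrite mulrDl mul1r EFinD EFinM.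
pose kap := eta `^ r; have kap0 : 0 < kap by rewrite powR_gt0.
have Ih j : (\int[mu]_x (hj j x)%:E <= (c * (((rho j)^-1 + 1) * N) - kap)%:E)%E.
  have := HI j; rewrite -/(w j) -/kap => h.
  have : (\int[mu]_x (hj j x)%:E + kap%:E <= (c * (((rho j)^-1 + 1) * N))%:E)%E.
    by rewrite -Isum leeD2l.
  by rewrite EFinB -leeBrDr.
have V1 : c * (((rho j)^-1 + 1) * N) @[j --> \oo] --> c * ((1^-1 + 1) * N).
  apply: cvgM; first exact: cvg_cst; apply: cvgM; last exact: cvg_cst.
  by apply: cvgD; [apply: cvgV => //; exact: oner_neq0|exact: cvg_cst].
have k20 : 0 < kap / 2 by rewrite divr_gt0.
have /cvgrPdist_le /(_ _ k20) [n0 _ Hn0] := V1.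
have := fatou mu lset_setT (fun n => mE _ (chj (n + n0)%N)) (fun n => p0 _ (hj0 (n + n0)%N)).
have -> : (\int[mu]_x limn_einf (fun n => (hj (n + n0)%N x)%:E) = (2 * c * N)%:E)%E.
  rewrite EFinM -NE -(ge0_integralZl mu lset_setT (mE _ cu) (p0 _ u0)); last first.
    by rewrite lee_fin mulr_ge0// ltW.
  apply: eq_integral => x _.
  have ul : u (rho j * x) @[j --> \oo] --> u x.
    apply: (@continuous_cvg _ _ _ _ _ (fun j => rho j * x) u x); first exact: cu.
    by rewrite -[X in _ --> X]mul1r; apply: cvgM; [exact: rho1|exact: cvg_cst].
  have wl : w j x @[j --> \oo] --> (0 : R).
    rewrite -[X in _ --> X](powR0 (lt0r_neq0 r0)).
    apply: powR_cvg => //; first by move=> j; exact: normc_ge0.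
    apply/cvgrPdist_le => e e0; have [d d0 Hd] := cg x%:C e e0.
    have rx : rho j * x @[j --> \oo] --> x.
      by rewrite -[X in _ --> X]mul1r; apply: cvgM; [exact: rho1|exact: cvg_cst].
    have /cvgrPdist_lt /(_ _ d0) := rx; apply: filterS => j hd.
    rewrite sub0r normrN ger0_norm ?normc_ge0//.
    have := Hd (rho j * x - x)%:C; rewrite normc_real distrC => /(_ hd).
    by rewrite -rmorphD /= [x + _]addrC subrK.
  have hl : (hj (n + n0)%N x)%:E @[n --> \oo] --> (2 * c * u x)%:E.
    apply: cvg_EFin; first exact: nearW.
    rewrite (cvg_shiftn n0 (fun j => hj j x)).
    rewrite (_ : 2 * c * u x = c * (u x + u x) - 0); last by ring.
    by apply: cvgB => //; apply: cvgM; [exact: cvg_cst|apply: cvgD => //; exact: cvg_cst].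
  by rewrite (cvg_limn_einf_sup hl).1 EFinM.
rewrite leNgt => /negP; apply.
apply: (@le_lt_trans _ _ (2 * c * N - kap / 2)%:E); last by rewrite lte_fin; lra.
apply: limn_einf_le => n; apply: le_trans (Ih _) _; rewrite lee_fin.
have := Hn0 (n + n0)%N (leq_addl _ _); rewrite /= invr1 ler_norml; lra.
Qed.

End Dilation.

(** * Geometric approximation on growing intervals *)

Section IntervalApprox.
Context {R : realType}.
Implicit Types (g : R[i] -> R[i]) (p : \bar R) (r t b x : R) (n m : nat).
Local Notation lmeas := (@lebesgue_measurable_fun R).

Lemma natX_expR_bound m (c : R) : 0 < c -> exists2 K : R, 0 < K &
  forall n, (n%:R + 1) ^+ m <= K * expR (c * n%:R).
Proof.
move=> c0; case: m => [|m].
  by exists 1 => // n; rewrite expr0 mul1r -expR0 ler_expR mulr_ge0// ltW.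
pose A : R := 1 + m.+1%:R / c.
have mc : 0 < m.+1%:R / c :> R by rewrite divr_gt0.
exists (A ^+ m.+1); first by rewrite exprn_gt0// /A; lra.
move=> n; have -> : c * n%:R = m.+1%:R * (c * n%:R / m.+1%:R) by field.
rewrite expRM_natl -exprMn lerXn2r ?nnegrE ?mulr_ge0 ?expR_ge0 ?addr_ge0//; first by rewrite /A; lra.
apply: (@le_trans _ _ (A * (1 + c * n%:R / m.+1%:R))).
  have -> : A * (1 + c * n%:R / m.+1%:R) = n%:R + 1 + (m.+1%:R / c + c * n%:R / m.+1%:R).
    have : 0 < m.+1%:R :> R by [].
    by rewrite /A; move: (m.+1%:R : R) => M M0; field; rewrite !gt_eqF.
  by rewrite lerDl addr_ge0 ?(ltW mc)// divr_ge0// mulr_ge0// ltW.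
by rewrite ler_wpM2l ?expR_ge1Dx// /A; lra.
Qed.

(** Exponentially small errors, both uniform and in [L_p], on all intervals of
    half-length at most [(n + C) / s]; the margin [C] absorbs the distance
    between [a_n] and [n]. *)
Definition interval_approx p g s (C : R) := exists K c : R, [/\ 0 < K, 0 < c &
  forall n b, 0 < b -> b <= (n%:R + C) / s -> exists P : {poly R[i]}, [/\ (size P <= n.+1)%N,
    forall x, `|x| <= b -> normc (g x%:C - P.[x%:C]) <= K * expR (- (c * n%:R)) &
    (Lp_norm p `[(- b)%R, b] (fun x => g x%:C - P.[x%:C])%R <= (K * expR (- (c * n%:R)))%:E)%E]].

(** Geometric polynomial approximation on the intervals [-b, b], with [b] at
    most [(n + C) / s]: the ellipse with parameter [r] loses [expR (k * b)] and
    gains [r ^+ n], so [k / s < ln r] leaves an exponential gain, which absorbs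
    the passage from the supremum to the [Lp] norm. *)
Theorem geometric_approx p g r (B k s C : R) : (0 < p)%E -> ccontinuous g -> polyapp g ->
  1 < r -> 0 < B -> 0 <= k -> 0 < s -> 0 <= C -> k / s < ln r ->
  (forall b z, 0 < b -> normc z = r -> normc (g (jouk b z)) <= B * expR (k * b)) ->
  interval_approx p g s C.
Proof.
move=> p0 cg ag r1 B0 k0 s0 C0 kr HB.
have [m Hm] := Lp_sup_bound p0.
have r0 : 0 < r by lra.
have q1 : r^-1 < 1 by rewrite invf_lt1.
pose c1 := ln r - k / s; have c10 : 0 < c1 by rewrite subr_gt0.
pose c := c1 / 2; have c0 : 0 < c by rewrite divr_gt0.
pose K1 := (1 + 4 / (1 - r^-1)) * B * expR (k * C / s).
have K10 : 0 < K1.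
  by rewrite mulr_gt0 ?expR_gt0// mulr_gt0// addr_gt0// divr_gt0// subr_gt0.
have [K2 K20 HK2] := natX_expR_bound m c0.
pose A := 1 + 2 * (1 + C) / s.
have A1 : 1 <= A by rewrite /A lerDl divr_ge0 ?(ltW s0)//; lra.
have A0 : 0 < A by lra.
pose K := K1 * (1 + A ^+ m * K2).
have AK : 0 < A ^+ m * K2 by rewrite mulr_gt0 ?exprn_gt0.
exists K, c; split => //; first by rewrite mulr_gt0//; lra.
move=> n b b0 bn.
have S0 : 0 < B * expR (k * b) by rewrite mulr_gt0 ?expR_gt0.
have [P sP HP] := ellipse_approx n ag b0 r1 S0 (fun z => HB b z b0).
have HP1 x : `|x| <= b -> normc (g x%:C - P.[x%:C]) <= K1 * expR (- (c1 * n%:R)).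
  move=> /HP /le_trans; apply.
  have -> : r ^+ n = expR (ln r * n%:R) by rewrite mulrC expRM_natl lnK// posrE.
  rewrite -expRN /K1 -!mulrA; apply: ler_wpM2l.
    by rewrite addr_ge0// divr_ge0// subr_ge0 ltW.
  rewrite ler_pM2l// -!expRD ler_expR /c1.
  have : k * b <= k * ((n%:R + C) / s) by rewrite ler_wpM2l.
  have -> : k * ((n%:R + C) / s) = k / s * n%:R + k * C / s by ring.
  by rewrite -!mulrA; lra.
have ec : expR (- (c1 * n%:R)) = expR (- (c * n%:R)) * expR (- (c * n%:R)).
  by rewrite -expRD; congr expR; rewrite /c; field.
have e1 : expR (- (c * n%:R)) <= 1 by rewrite -expR0 ler_expR oppr_le0 mulr_ge0// ltW.
exists P; split => //.
- move=> x /HP1 /le_trans; apply; rewrite ec /K -[leRHS]mulrA ler_pM2l//.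
  by apply: ler_wpM2r; [exact: expR_ge0|lra].
- have mF : lmeas (fun x => g x%:C - P.[x%:C]).
    by apply: lmeasB; [exact: lmeas_ccontinuous|exact: horner_lmeas].
  have E0 : 0 <= K1 * expR (- (c1 * n%:R)) by rewrite mulr_ge0 ?expR_ge0// ltW.
  apply: le_trans (Hm b _ _ (ltW b0) E0 mF HP1) _; rewrite lee_fin.
  have An : 1 + 2 * b <= A * (n%:R + 1).
    have : 2 * b <= 2 * ((n%:R + C) / s) by rewrite ler_pM2l.
    have : 2 * ((n%:R + C) / s) <= 2 * (1 + C) / s * (n%:R + 1).
      have -> : 2 * ((n%:R + C) / s) = 2 * (n%:R + C) / s by ring.
      have -> : 2 * (1 + C) / s * (n%:R + 1) = 2 * ((1 + C) * (n%:R + 1)) / s by ring.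
      rewrite ler_pM2r ?invr_gt0// ler_pM2l//.
      have : 0 <= C * n%:R :> R by rewrite mulr_ge0.
      by have : 0 <= n%:R :> R by []; lra.
    by rewrite /A; have : 0 <= n%:R :> R by []; lra.
  have h1 : (1 + 2 * b) ^+ m <= A ^+ m * (K2 * expR (c * n%:R)).
    apply: (@le_trans _ _ ((A * (n%:R + 1)) ^+ m)).
      by rewrite lerXn2r ?nnegrE//; [lra|rewrite mulr_ge0 ?(ltW A0)// addr_ge0].
    by rewrite exprMn ler_wpM2l ?HK2// exprn_ge0// ltW.
  apply: (le_trans (ler_wpM2l E0 h1)); rewrite ec.
  have -> : K1 * (expR (- (c * n%:R)) * expR (- (c * n%:R))) * (A ^+ m * (K2 * expR (c * n%:R))) =
    K1 * (A ^+ m * K2) * expR (- (c * n%:R)).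
    by rewrite expRN; field; rewrite gt_eqF// expR_gt0.
  by rewrite ler_wpM2r ?expR_ge0// /K ler_pM2l//; lra.
Qed.

Lemma normc_jouk_le b z r : 0 < b -> normc z = r -> 0 < r ->
  normc (jouk b z) <= b * ((r + r^-1) / 2).
Proof.
move=> b0 zr r0; rewrite /jouk Normc.normcM.
have -> : normc (b%:C / 2) = b / 2.
  rewrite Normc.normcM Normc.normcV normc_real gtr0_norm//.
  by rewrite (_ : 2 = 2%:C) ?normc_real ?ger0_norm// rmorph_nat.
rewrite [(r + r^-1) / 2]mulrC mulrA; apply: ler_wpM2l; first by rewrite divr_ge0// ltW.
by rewrite (le_trans (le_normcD _ _))// Normc.normcV zr.
Qed.

Lemma Im_jouk_le b z r : 0 < b -> normc z = r -> 1 < r ->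
  `|complex.Im (jouk b z)| <= b * ((r - r^-1) / 2).
Proof.
move=> b0 zr r1; have r0 : 0 < r by lra.
have zE : z^-1 = (r ^- 2)%:C * z^*%C.
  by rewrite invc_norm normcRE zr -rmorphXn -fmorphV.
rewrite /jouk zE; have ri2 : r ^- 2 <= 1 by rewrite invf_le1 ?exprn_gt0// exprn_ege1// ltW.
have -> : complex.Im (b%:C / 2 * (z + (r ^- 2)%:C * z^*%C)) = b / 2 * ((1 - r ^- 2) * complex.Im z).
  have -> : b%:C / 2 = (b / 2)%:C :> R[i] by rewrite rmorphM /= fmorphV rmorph_nat.
  by case: (z) => u v /=; ring.
have b2 : 0 < b / 2 by rewrite divr_gt0.
have q0 : 0 <= 1 - r ^- 2 by rewrite subr_ge0.
rewrite normrM (gtr0_norm b2) normrM (ger0_norm q0).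
have -> : b * ((r - r^-1) / 2) = b / 2 * ((1 - r ^- 2) * r) by field; rewrite gt_eqF.
apply: ler_wpM2l; first exact: ltW.
by apply: ler_wpM2l => //; rewrite -zr Im_normc.
Qed.

End IntervalApprox.

(** * Functions of exponential type *)

Section ExponentialType.
Context {R : realType}.
Implicit Types (g h : R[i] -> R[i]) (p : \bar R) (r t s b x l : R) (n m : nat).
Local Notation lmeas := (@lebesgue_measurable_fun R).

(** The radius [r] minimises [(r + r^-1) / (2 * ln r)]: with [r = expR u] this is
    [cosh u / u], critical where [coth u = u], and then equal to
    [sinh u = m]. Since [coth u > 1] and [sinh u >= u], also [m > 1]. *)
Lemma mu_radius (m : R) : 0 < m ->
  Num.sqrt (m ^+ 2 + 1) / m = ln (Num.sqrt (m ^+ 2 + 1) + m) ->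
  1 < m /\ exists r, [/\ 1 < r & (r + r^-1) / 2 = m * ln r].
Proof.
move=> m0 E; set S := Num.sqrt _ in E.
have S2 : S ^+ 2 = m ^+ 2 + 1 by rewrite sqr_sqrtr// addr_ge0// sqr_ge0.
have Sm : m < S by rewrite -(ltr_pXn2r (n:=2))// ?nnegrE ?sqrtr_ge0 ?(ltW m0)// S2 ltrDl.
have r0 : 0 < S + m by lra.
have rV : (S + m)^-1 = S - m.
  apply: (mulfI (lt0r_neq0 r0)); rewrite divff ?gt_eqF//.
  by rewrite (_ : (S + m) * (S - m) = S ^+ 2 - m ^+ 2); [rewrite S2; ring|ring].
have u1 : 1 < ln (S + m) by rewrite -E ltr_pdivlMr// mul1r.
have um : ln (S + m) <= m.
  have := sinh_ge (ltW (lt_trans ltr01 u1)); rewrite expRN lnK ?posrE// rV; lra.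
split; first by lra.
exists (S + m); split; first by rewrite -ltr_ln ?posrE// ln1 (lt_trans _ u1).
by rewrite rV -E; field; rewrite gt_eqF.
Qed.

Lemma expo_growth g t t' : expo_type t g -> t < t' ->
  exists2 B, 0 < B & forall z, normc (g z) <= B * expR (t' * normc z).
Proof.
move=> [_ Hg] tt'; have d0 : 0 < t' - t by lra.
have [C HC] := Hg _ d0; exists (Num.max C 1); first by rewrite lt_max ltr01 orbT.
move=> z; apply: le_trans (HC z) _; rewrite (_ : t + (t' - t) = t'); last by ring.
by rewrite ler_wpM2r ?expR_ge0// le_max lexx.
Qed.

Lemma entire_ccontinuous g : entire g -> ccontinuous g.
Proof. by move=> eg z; apply: dv_ccont; exact: eg. Qed.

Lemma expo_type_le t t' g : t <= t' -> expo_type t g -> expo_type t' g.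
Proof.
move=> tt [eg Hg]; split => // e e0; have [C HC] := Hg e e0; exists (Num.max C 0) => z.
apply: le_trans (HC z) _; apply: (@le_trans _ _ (Num.max C 0 * expR ((t + e) * normc z))).
  by rewrite ler_wpM2r ?expR_ge0// le_max lexx.
by rewrite ler_wpM2l ?le_max ?lexx ?orbT// ler_expR ler_wpM2r ?normc_ge0// lerD2r.
Qed.

Lemma expo_typeB t g h : expo_type t g -> expo_type t h -> expo_type t (fun z => g z - h z).
Proof.
move=> [eg Hg] [eh Hh]; split => [z|e e0]; first by apply: dvB; [exact: eg|exact: eh].
have [C HC] := Hg e e0; have [D HD] := Hh e e0; exists (C + D) => z.
by rewrite (le_trans (normcB _ _))// mulrDl lerD.
Qed.

(** On the ellipse of parameter [r] a function of exponential type [t] is only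
    controlled by the largest modulus, [b * (r + r^-1) / 2]; the optimal [r] gives
    the constant in the theorem. *)
Lemma expo_interval_approx p g t s (C r : R) : (0 < p)%E -> expo_type t g -> 0 <= t ->
  1 < r -> t * ((r + r^-1) / 2) < s * ln r -> 0 < s -> 0 <= C -> interval_approx p g s C.
Proof.
move=> p0 tg t0 r1 H s0 C0; have r0 : 0 < r by lra.
pose A := (r + r^-1) / 2; have A0 : 0 < A by rewrite divr_gt0// addr_gt0 ?invr_gt0.
pose t' := (t + s * ln r / A) / 2.
have tt : t < s * ln r / A by rewrite ltr_pdivlMr.
have tt' : t < t' by rewrite /t'; lra.
have ts : t' * A < s * ln r by rewrite -ltr_pdivlMr// /t'; lra.
have [B B0 HB] := expo_growth tg tt'.
have t'0 : 0 <= t' by lra.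
have [eg _] := tg.
apply: (@geometric_approx _ p g r B (t' * A)) => //.
- exact: entire_ccontinuous.
- exact: entire_polyapp.
- by rewrite mulr_ge0// ltW.
- by rewrite ltr_pdivrMr// [ltRHS]mulrC.
move=> b z b0 zr; apply: le_trans (HB _) _; rewrite ler_pM2l// ler_expR -mulrA ler_wpM2l//.
by rewrite [leRHS]mulrC; exact: normc_jouk_le.
Qed.

Lemma sinh_le (e : R) : 0 < e -> exists2 u, 0 < u & expR u - expR (- u) <= 2 * (1 + e) * u.
Proof.
move=> e0; have [d d0 H] := derive_eps (is_derive_expR (0 : R)) e0.
have d2 : 0 < d / 2 by rewrite divr_gt0.
exists (d / 2) => //; have := H (d / 2); have := H (- (d / 2)).
rewrite !add0r expR0 normrN gtr0_norm//.
rewrite !ler_norml => /(_ ltac:(lra)) /andP[h1 _] /(_ ltac:(lra)) /andP[_ h2].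
rewrite mulrN mul1r in h1; rewrite mul1r in h2.
have -> : 2 * (1 + e) * (d / 2) = 2 * (d / 2) + 2 * (e * (d / 2)) by ring.
by move: h1 h2; move: (e * (d / 2)) => y; lra.
Qed.

(** For a function bounded on the real line only the imaginary part matters, and
    [(r - r^-1) / 2] is equivalent to [ln r] as [r] tends to [1]. *)
Lemma bounded_interval_approx p g t s (B C : R) : (0 < p)%E -> entire g -> 0 < B -> 0 < t -> t < s ->
  (forall z, normc (g z) <= B * expR (t * `|complex.Im z|)) -> 0 <= C -> interval_approx p g s C.
Proof.
move=> p0 eg B0 t0 ts HB C0; have s0 : 0 < s by lra.
have e0 : 0 < (s - t) / (2 * t) by rewrite divr_gt0 ?mulr_gt0//; lra.
have [u u0 Hu] := sinh_le e0; pose r := expR u.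
have r1 : 1 < r by rewrite /r -expR0 ltr_expR.
have rV : r^-1 = expR (- u) by rewrite expRN.
have k0 : 0 <= t * ((r - r^-1) / 2).
  by rewrite mulr_ge0 ?(ltW t0)// divr_ge0// rV subr_ge0 ler_expR; lra.
apply: (@geometric_approx _ p g r B (t * ((r - r^-1) / 2))) => //.
- exact: entire_ccontinuous.
- exact: entire_polyapp.
- rewrite ltr_pdivrMr// /r expRK -/r rV.
  apply: (@le_lt_trans _ _ (t * (2 * (1 + (s - t) / (2 * t)) * u / 2))).
    by apply: ler_wpM2l; [exact: ltW|rewrite ler_pM2r ?invr_gt0].
  have -> : t * (2 * (1 + (s - t) / (2 * t)) * u / 2) = (s + t) / 2 * u.
    by field; rewrite gt_eqF.
  by rewrite [ltRHS]mulrC ltr_pM2r//; lra.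
move=> b z b0 zr; apply: le_trans (HB _) _; rewrite ler_pM2l// ler_expR -mulrA ler_pM2l//.
by rewrite [leRHS]mulrC; exact: Im_jouk_le.
Qed.

Lemma trunc_opp (D : set R) (F : R -> R[i]) x : trunc D (fun x => - F x) x = trunc D F x.
Proof. by rewrite !truncE normcN. Qed.

Lemma trunc_sub (D D' : set R) (F : R -> R[i]) x : D `<=` D' -> trunc D F x <= trunc D' F x.
Proof.
move=> DD; rewrite !truncE; case: ifPn => [|_]; last by case: ifP => // _; exact: normc_ge0.
by rewrite inE => /DD /mem_set ->.
Qed.

Lemma Lp_opp p (D : set R) (F : R -> R[i]) l : (0 < p)%E -> 0 <= l -> lset D -> lmeas F ->
  (Lp_norm p D F <= l%:E)%E -> (Lp_norm p D (fun x => - F x)%R <= l%:E)%E.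
Proof.
move=> p0 l0 mD mF; apply: (Lp_le p0 l0 mD mD _ mF) => [|x]; last by rewrite trunc_opp.
rewrite (_ : (fun x => _) = fun x => 0%:C - F x); last by apply/funext => x; rewrite sub0r.
apply: lmeasB mF; apply: (@lmeas_ccontinuous _ (fun=> 0%:C)).
by apply: entire_ccontinuous => z; exact: dv_cst.
Qed.

Lemma Lp_restrict p (D : set R) (F : R -> R[i]) l : (0 < p)%E -> 0 <= l -> lset D -> lmeas F ->
  (Lp_norm p setT F <= l%:E)%E -> (Lp_norm p D F <= l%:E)%E.
Proof.
move=> p0 l0 mD mF; apply: (Lp_le p0 l0 mD lset_setT mF mF) => x; exact: trunc_sub.
Qed.

(** A function of exponential type in [L_p] is bounded on the line: on long
    intervals it is close to a polynomial of comparable degree, whose [L_p] norm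
    controls its interior values. *)
Theorem Lp_expo_bounded p h t : (0 < p)%E -> 0 <= t -> expo_type t h ->
  (Lp_norm p setT (fun x => h x%:C) < +oo)%E -> exists M, forall x, normc (h x%:C) <= M.
Proof.
move=> p0 t0 th hL; have eh := th.1.
(* any [r > 1] would do, the degree may be a large multiple of the length *)
pose r : R := expR 1; have r1 : 1 < r by rewrite /r -expR0 ltr_expR.
pose s := t * ((r + r^-1) / 2) + 1.
have A0 : 0 <= (r + r^-1) / 2 by rewrite divr_ge0// addr_ge0 ?invr_ge0// expR_ge0.
have s0 : 0 < s by rewrite ltr_wpDl// mulr_ge0.
have [|K [c [K0 c0 HK]]] := @expo_interval_approx p h t s 0 r p0 th t0 r1 _ s0 (lexx _).
  by rewrite /r expRK mulr1 -/r /s ltrDl.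
have [A A00 HA] : exists2 A, 0 <= A & (Lp_norm p setT (fun x => h x%:C) <= A%:E)%E.
  have := Lp_ge0 p setT (fun x => h x%:C); case: Lp_norm hL => [A _ A1|//|//].
  by exists A.
have mh : lmeas (fun x => h x%:C) by apply: lmeas_ccontinuous; exact: entire_ccontinuous.
have [D D0 HD] := Lp_bounded_D p0 A00 (ltW K0).
have q0 : 0 < 1 / 2 :> R by lra.
have q1 : 1 / 2 < 1 :> R by lra.
have [Q Q0 HQ] := lp_interior p0 q0 q1 s0.
exists (Q * D + K) => x.
pose n := (Num.bound (s * (1 + 2 * `|x|))).
have nx : s * (1 + 2 * `|x|) < n%:R.
  by rewrite /n archi_boundP// mulr_ge0// ?(ltW s0)// addr_ge0// mulr_ge0.
pose b := n%:R / s; have bn : n%:R = s * b by rewrite /b mulrC divfK// gt_eqF.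
have xb : 1 + 2 * `|x| < b by move: nx; rewrite bn ltr_pM2l.
have b1 : 1 <= b by have := normr_ge0 x; lra.
have b0 : 0 < b by lra.
have [|P [sP P1 P2]] := HK n b b0; first by rewrite addr0.
have e1 : K * expR (- (c * n%:R)) <= K.
  by rewrite ger_pMr// -expR0 ler_expR oppr_le0 mulr_ge0// ltW.
have mP := horner_lmeas P.
have LP : (Lp_norm p `[(- b)%R, b] (fun x => P.[x%:C]) <= D%:E)%E.
  rewrite (_ : (fun x => P.[x%:C]) = fun x => (h x%:C + - (h x%:C - P.[x%:C]))%R); last first.
    by apply/funext => y; ring.
  apply: HD; [exact: lset_itv|exact: mh| | |].
  - rewrite (_ : (fun x => _) = fun x => P.[x%:C] - h x%:C); first exact: lmeasB.
    by apply/funext => y; ring.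
  - exact: (Lp_restrict p0 A00 (lset_itv _ _) mh HA).
  - apply: (Lp_opp p0 (ltW K0) (lset_itv _ _) (lmeasB mh mP)).
    by apply: le_trans P2 _; rewrite lee_fin.
have hx : `|x| <= (1 - 1/2) * b by lra.
have := HQ n b P D b1 _ sP D0 LP x hx; rewrite bn => /(_ (lexx _)) h1.
have xb' : `|x| <= b by lra.
have := P1 x xb'; have := le_normcD (h x%:C - P.[x%:C]) P.[x%:C]; rewrite subrK; lra.
Qed.

Lemma expR_small (K c e : R) : 0 < c -> 0 < e ->
  \forall n \near \oo, K * expR (- (c * n%:R)) <= e.
Proof.
move=> c0 e0; near=> n.
have n1 : K / e / c <= n%:R.
  apply/ltW/(le_lt_trans (ler_norm _)); near: n; exact: nbhs_infty_gtr.
rewrite expRN ler_pdivrMr ?expR_gt0// mulrC -ler_pdivrMr//.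
apply: (@le_trans _ _ (c * n%:R)); first by rewrite [leRHS]mulrC -ler_pdivrMr.
by rewrite (le_trans _ (expR_ge1Dx _))// lerDr.
Unshelve. all: by end_near. Qed.

End ExponentialType.

(** * Upper bound *)

Section Upper.
Context {R : realType}.
Implicit Types (f : R -> R[i]) (g h : R[i] -> R[i]) (p : \bar R) (r t s b x l : R) (n m : nat).
Local Notation lmeas := (@lebesgue_measurable_fun R).

Lemma Lp_fin_bound p (D : set R) F : (Lp_norm p D F < +oo)%E ->
  exists2 A : R, 0 <= A & (Lp_norm p D F <= A%:E)%E.
Proof.
have := Lp_ge0 p D F; case: Lp_norm => [A A1 _|//|//].
by exists A.
Qed.

Lemma lmeas_expo t g : expo_type t g -> lmeas (fun x => g x%:C).
Proof. by move=> [eg _]; apply: lmeas_ccontinuous; exact: entire_ccontinuous. Qed.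

(** [f] itself need not be bounded, nor in [L_p]; but two admissible approximants of
    exponential type differ by a function bounded on the line, so that only the
    first one, of type [s0], has to meet the condition on [r]. *)
Theorem best_poly_upper p f g0 g r s0 t s (a : nat -> R) (C : R) l l' : (0 < p)%E -> lmeas f ->
  1 < r -> 0 <= s0 -> s0 < s -> s0 * ((r + r^-1) / 2) < s * ln r ->
  expo_type s0 g0 -> (Lp_norm p setT (fun x => f x - g0 x%:C)%R < +oo)%E ->
  t < s -> expo_type t g -> 0 <= l -> l < l' ->
  (Lp_norm p setT (fun x => f x - g x%:C)%R <= l%:E)%E ->
  (forall n, (1 <= n)%N -> 0 < a n) -> (forall n, (1 <= n)%N -> `|a n - n%:R| <= C) ->
  \forall n \near \oo, (best_poly_approx n p (a n / s) f <= l'%:E)%E.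
Proof.
move=> p0 mf r1 s00 s0s Hr tg0 L0 ts tg l0 ll' L1 a0 aC.
have s_gt0 : 0 < s by lra.
have C0 : 0 <= C by apply: le_trans (aC 1%N _).
have mg0 := lmeas_expo tg0; have mg := lmeas_expo tg.
have mf0 := lmeasB mf mg0; have mf1 := lmeasB mf mg.
pose t1 := Num.max t s0.
have t1s : t1 < s by rewrite gt_max ts s0s.
have t10 : 0 <= t1 by rewrite le_max s00 orbT.
pose h z := g z - g0 z.
have th : expo_type t1 h.
  by apply: expo_typeB; [apply: expo_type_le tg|apply: expo_type_le tg0]; rewrite le_max lexx ?orbT.
have [A A0 HA] := Lp_fin_bound L0.
have [K K0 HK] := Lp_bounded_D p0 A0 l0.
have [|M HM] := @Lp_expo_bounded _ p h t1 p0 t10 th.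
  apply: (@le_lt_trans _ _ K%:E); last exact: ltry.
  rewrite (_ : (fun x => _) = fun x => ((f x - g0 x%:C) + - (f x - g x%:C))%R); last first.
    by apply/funext => x; rewrite /h; ring.
  apply: HK HA _; [exact: lset_setT|exact: mf0| |].
  - rewrite (_ : (fun x => _) = fun x => g x%:C - f x); first exact: lmeasB.
    by apply/funext => x; ring.
  - exact: Lp_opp p0 l0 lset_setT mf1 L1.
pose d := (s - t1) / 3; have d0 : 0 < d by rewrite divr_gt0//; lra.
have d3 : t1 + d + d + d = s by rewrite /d; field.
have t12 : t1 < t1 + d by lra.
have [D D0 HD] := expo_growth th t12.
have PL := @phragmen_lindelof _ h (t1 + d) (t1 + d + d) D M th.1.
have {PL} HP := PL ltac:(lra) ltac:(lra) D0 HD HM.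
have B0 : 0 < Num.max M D by rewrite lt_max D0 orbT.
have [K1 [c1 [K10 c10 H1]]] := bounded_interval_approx p0 th.1 B0
  (ltac:(lra) : 0 < t1 + d + d) (ltac:(lra) : t1 + d + d < s) HP C0.
have [K2 [c2 [K20 c20 H2]]] := expo_interval_approx p0 tg0 s00 r1 Hr s_gt0 C0.
pose l1 := (l + l') / 2.
have ll1 : l < l1 by rewrite /l1; lra.
have l1l' : l1 < l' by rewrite /l1; lra.
have l10 : 0 <= l1 by lra.
have [e1 e10 E1] := Lp_perturb p0 l0 ll1.
have [e2 e20 E2] := Lp_perturb p0 l10 l1l'.
near=> n.
have n1 : (1 <= n)%N by near: n; exact: nbhs_infty_ge.
have an := a0 n n1; pose b := a n / s.
have b0 : 0 < b by rewrite divr_gt0.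
have bn : b <= (n%:R + C) / s.
  by rewrite ler_pM2r ?invr_gt0//; have := aC n n1; rewrite ler_norml => /andP[_]; lra.
have [P1 [sP1 _ LP1]] := H1 n b b0 bn.
have [P2 [sP2 _ LP2]] := H2 n b b0 bn.
have small1 : K1 * expR (- (c1 * n%:R)) <= e1 by near: n; exact: expR_small.
have small2 : K2 * expR (- (c2 * n%:R)) <= e2 by near: n; exact: expR_small.
have mD : lset `[(- b)%R, b] by exact: lset_itv.
apply: (@le_trans _ _ (Lp_norm p `[(- b)%R, b] (fun x => f x - (P1 + P2).[x%:C])%R)).
  by apply: ereal_inf_lbound; exists (P1 + P2) => //; rewrite /poly_upto /= (leq_trans (size_polyD _ _))// geq_max sP1 sP2.
rewrite (_ : (fun x => _) = fun x => (((f x - g x%:C) + (h x%:C - P1.[x%:C])) + (g0 x%:C - P2.[x%:C]))%R); last first.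
  by apply/funext => x; rewrite hornerD /h; ring.
have mh1 : lmeas (fun x => h x%:C - P1.[x%:C]) := lmeasB (lmeas_expo th) (horner_lmeas P1).
apply: (E2 _ _ _ mD (lmeasD mf1 mh1) (lmeasB mg0 (horner_lmeas P2))).
  apply: (E1 _ _ _ mD mf1 mh1); first exact: (Lp_restrict p0 l0 mD mf1 L1).
  by apply: le_trans LP1 _; rewrite lee_fin.
by apply: le_trans LP2 _; rewrite lee_fin.
Unshelve. all: by end_near. Qed.

End Upper.

(** * Lowering the exponential type *)

Section LeftApprox.
Context {R : realType}.
Implicit Types (f : R -> R[i]) (g h : R[i] -> R[i]) (p : \bar R) (r t s b x l : R) (n m : nat).
Local Notation lmeas := (@lebesgue_measurable_fun R).

Lemma expo_type_dilation t (rho : R) h : 0 < rho -> expo_type t h ->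
  expo_type (rho * t) (fun z => h (rho%:C * z)).
Proof.
move=> rho0 [eh Hh]; split => [z|e e0].
  apply: (@dv_comp _ (fun w => rho%:C * w)); last exact: eh.
  by apply: dvM; [exact: dv_cst|exact: dv_id].
have er : 0 < e / rho by rewrite divr_gt0.
have [C HC] := Hh _ er; exists C => z; apply: le_trans (HC _) _.
rewrite Normc.normcM normc_real gtr0_norm//.
by rewrite (_ : (t + e / rho) * (rho * normc z) = (rho * t + e) * normc z)//; field; rewrite gt_eqF.
Qed.

Lemma expo_typeD t g h : expo_type t g -> expo_type t h -> expo_type t (fun z => g z + h z).
Proof.
move=> tg th; rewrite (_ : (fun z => _) = fun z => g z - (0 - h z)); last first.
  by apply/funext => z; rewrite sub0r opprK.
apply: expo_typeB => //; apply: expo_typeB => //.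
split => [z|e e0]; first exact: dv_cst.
by exists 0 => z; rewrite Normc.normc0 mul0r.
Qed.

(** Dilating the part in [L_p] of an approximant lowers its type at the cost of
    a small error; for [p = +oo] dilations are not continuous in norm. *)
Lemma expo_left_approx r f g0 g s0 s l l' : 0 < r -> lmeas f -> s0 < s -> 0 < s ->
  expo_type s0 g0 -> (Lp_norm r%:E setT (fun x => f x - g0 x%:C)%R < +oo)%E ->
  expo_type s g -> 0 <= l -> l < l' ->
  (Lp_norm r%:E setT (fun x => f x - g x%:C)%R <= l%:E)%E ->
  exists2 t, t < s & exists2 g', expo_type t g' &
    (Lp_norm r%:E setT (fun x => f x - g' x%:C)%R <= l'%:E)%E.
Proof.
move=> r0 mf s0s s_gt0 tg0 L0 tg l0 ll' L1.
have p0 : (0 < r%:E)%E by rewrite lte_fin.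
have mg0 := lmeas_expo tg0; have mg := lmeas_expo tg.
have mf0 := lmeasB mf mg0; have mf1 := lmeasB mf mg.
pose h z := g z - g0 z.
have th : expo_type s h by apply: expo_typeB tg _; apply: expo_type_le tg0; exact: ltW.
have [A A0 HA] := Lp_fin_bound L0.
have [K K0 HK] := Lp_bounded_D p0 A0 l0.
have Lh : (Lp_norm r%:E setT (fun x => h x%:C) < +oo)%E.
  apply: (@le_lt_trans _ _ K%:E); last exact: ltry.
  rewrite (_ : (fun x => _) = fun x => ((f x - g0 x%:C) + - (f x - g x%:C))%R); last first.
    by apply/funext => x; rewrite /h; ring.
  apply: HK HA _; [exact: lset_setT|exact: mf0| |].
  - rewrite (_ : (fun x => _) = fun x => g x%:C - f x); first exact: lmeasB.
    by apply/funext => x; ring.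
  - exact: Lp_opp p0 l0 lset_setT mf1 L1.
have [eta eta0 E] := Lp_perturb p0 l0 ll'.
have half : 1 / 2 < 1 :> R by lra.
have [rho /andP[rho1 rho2] Hrho] := dilation_cont r0 (entire_ccontinuous th.1) Lh half eta0.
have rho0 : 0 < rho by lra.
have th' := expo_type_dilation rho0 th.
exists (Num.max s0 (rho * s)); first by rewrite gt_max s0s gtr_pMl.
exists (fun z => g0 z + h (rho%:C * z)).
  by apply: expo_typeD; [apply: expo_type_le tg0|apply: expo_type_le th']; rewrite le_max lexx ?orbT.
have rE (x : R) : rho%:C * x%:C = (rho * x)%:C :> R[i] by rewrite rmorphM.
have mh' : lmeas (fun x => h (rho * x)%:C).
  by have := lmeas_expo th'; rewrite (_ : (fun x : R => _) = fun x => h (rho * x)%:C)//; apply/funext => x; rewrite rE.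
have mh := lmeas_expo th.
rewrite (_ : (fun x => _) = fun x => ((f x - g x%:C) + - (h (rho * x)%:C - h x%:C))%R); last first.
  by apply/funext => x; rewrite rE /h; ring.
apply: (E _ _ _ lset_setT mf1 _ L1).
- rewrite (_ : (fun x => _) = fun x => h x%:C - h (rho * x)%:C); first exact: lmeasB.
  by apply/funext => x; ring.
- exact: Lp_opp p0 (ltW eta0) lset_setT (lmeasB mh' mh) Hrho.
Qed.

End LeftApprox.

(** * Normal families of polynomials *)

Section Montel.
Context {R : realType}.
Implicit Types (z w : R[i]) (s e S B x : R) (U : set_system nat).

Section UltraLimits.
Context (U : set_system nat) (FU : UltraFilter U).

Definition ulim (u : nat -> R[i]) l := forall e, 0 < e -> \forall j \near U, normc (u j - l) <= e.

Lemma ulim_real (u : nat -> R) B : (\forall j \near U, `|u j| <= B) ->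
  exists l, forall e, 0 < e -> \forall j \near U, `|u j - l| <= e.
Proof.
move=> HB; have := @segment_compact R (- B) B.
rewrite /compact => /(_ (u @ U) _) [|l [_ Hl]].
  by apply: filterS HB => j; rewrite /= in_itv /= ler_norml.
exists l => e e0; have [//|H] := in_ultra_setVsetC [set j | `|u j - l| <= e] FU.
have H' : \forall j \near U, e < `|u j - l|.
  by apply: filterS H => j /= Hj; rewrite ltNge; apply/negP.
have [y [/= h1 h2]] := Hl [set y | e < `|y - l|] (ball l e) H' (nbhsx_ballx l e e0).
by move: h2; rewrite /ball /= distrC => /(lt_trans h1); rewrite ltxx.
Qed.

Lemma ulim_ex (u : nat -> R[i]) B : (\forall j \near U, normc (u j) <= B) -> exists l, ulim u l.
Proof.
move=> HB; have HR : \forall j \near U, `|complex.Re (u j)| <= B.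
  by apply: filterS HB => j; apply: le_trans; exact: Re_normc.
have HI : \forall j \near U, `|complex.Im (u j)| <= B.
  by apply: filterS HB => j; apply: le_trans; exact: Im_normc.
have [a Ha] := ulim_real HR; have [b Hb] := ulim_real HI.
exists (a +i* b) => e e0; have e2 : 0 < e / 2 by rewrite divr_gt0.
apply: filterS2 (Ha _ e2) (Hb _ e2) => j h1 h2.
apply: le_trans (normc_ReIm _) _; rewrite [e]splitr; apply: lerD.
  by move: h1; case: (u j).
by move: h2; case: (u j).
Qed.

Lemma ulim_le (u : nat -> R[i]) l B : ulim u l -> (\forall j \near U, normc (u j) <= B) -> normc l <= B.
Proof.
move=> ul HB; apply/ler_addgt0Pr => e e0.
have [j [h1 h2]] := filter_ex (filterI HB (ul e e0)).
have := normc_triB l (u j); rewrite normc_distC; lra.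
Qed.

Lemma ulimD (u v : nat -> R[i]) a b : ulim u a -> ulim v b -> ulim (fun j => u j + v j) (a + b).
Proof.
move=> ua vb e e0; have e2 : 0 < e / 2 by rewrite divr_gt0.
apply: filterS2 (ua _ e2) (vb _ e2) => j h1 h2.
rewrite opprD addrACA (le_trans (le_normcD _ _))//; lra.
Qed.

Lemma ulimM (u : nat -> R[i]) a w : ulim u a -> ulim (fun j => w * u j) (w * a).
Proof.
move=> ua e e0; have w0 : 0 < normc w + 1 by rewrite ltr_wpDl// normc_ge0.
have e2 : 0 < e / (normc w + 1) by rewrite divr_gt0.
apply: filterS (ua _ e2) => j h.
rewrite -mulrBr Normc.normcM; apply: (@le_trans _ _ ((normc w + 1) * normc (u j - a))).
  by rewrite ler_wpM2r ?normc_ge0// lerDl.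
by rewrite mulrC -ler_pdivlMr.
Qed.

Lemma ulimB (u v : nat -> R[i]) a b : ulim u a -> ulim v b -> ulim (fun j => u j - v j) (a - b).
Proof.
move=> ua /(ulimM (-1)) vb; rewrite -mulN1r; apply: (ulimD ua).
by move: vb; rewrite (_ : (fun j => -1 * v j) = fun j => - v j)//; apply/funext => j; rewrite mulN1r.
Qed.

End UltraLimits.

(** Normal families without diagonal extraction: limits along an ultrafilter
    exist at every point, for the values and for the derivatives alike, and
    Taylor estimates pass to the limit. *)
Theorem poly_montel (P : nat -> {poly R[i]}) s :
  (forall e, 0 < e -> exists M : R, \forall j \near \oo, forall z,
    normc (P j).[z] <= M * expR ((s + e) * normc z)) ->
  exists2 g, expo_type s g & exists2 phi : nat -> nat, (forall k, (k <= phi k)%N) &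
    forall x, forall e, 0 < e -> \forall k \near \oo, normc ((P (phi k)).[x%:C] - g x%:C) <= e.
Proof.
move=> HP; have [U [FU sU]] := ultraFilterLemma (@eventually_filter : ProperFilter \oo).
have [M1 HM1] := HP 1 ltr01.
pose M := Num.max M1 0; pose t := Num.max (s + 1) 0.
have M0 : 0 <= M by rewrite le_max lexx orbT.
have t0 : 0 <= t by rewrite le_max lexx orbT.
pose S r := M * expR (t * r).
have S0 r : 0 <= S r by rewrite mulr_ge0// expR_ge0.
have HS : \forall j \near \oo, forall r z, normc z <= r -> normc (P j).[z] <= S r.
  apply: filterS HM1 => j Hj r z zr; apply: le_trans (Hj z) _.
  apply: (@le_trans _ _ (M * expR ((s + 1) * normc z))).
    by rewrite ler_wpM2r ?expR_ge0// le_max lexx.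
  rewrite ler_wpM2l// ler_expR (le_trans (_ : _ <= t * normc z))//.
    by rewrite ler_wpM2r ?normc_ge0// le_max lexx.
  by rewrite ler_wpM2l.
have /choice[g Hg] : forall z, exists l, ulim U (fun j => (P j).[z]) l.
  by move=> z; apply: (@ulim_ex _ FU _ (S (normc z))); apply: filterS (sU _ HS) => j; apply.
have disc z h : normc h <= 1 -> normc (z + h) <= normc z + 1.
  by move=> h1; rewrite (le_trans (le_normcD _ _))// lerD2l.
have disc' z w : normc (w - z) <= 1 -> normc w <= normc z + 1.
  by move=> /(disc z); rewrite addrC subrK.
have eg : entire g.
  move=> z; apply/dvP; pose S1 := S (normc z + 1); have S10 : 0 <= S1 := S0 _.
  have S41 : 0 < 4 * S1 + 1 by rewrite ltr_wpDl// mulr_ge0.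
  have /choice[d Hd] : forall j, exists d : R[i], (forall r z, normc z <= r -> normc (P j).[z] <= S r) ->
      normc d <= 2 * S1 /\ forall h, normc h <= 1 ->
      normc ((P j).[z + h] - (P j).[z] - d * h) <= 4 * S1 * normc h ^+ 2.
    move=> j; have [Hj|Hj] := pselect (forall r z, normc z <= r -> normc (P j).[z] <= S r); last by exists 0 => /Hj.
    have [d d1 d2] := @poly_taylor2 _ (P j) z 1 S1 ltr01 (fun w h => Hj _ _ (disc' z w h)).
    exists d => _; split; first by rewrite -[leRHS]divr1.
    by move=> h /d2; rewrite expr1n divr1.
  have [|D HD] := @ulim_ex _ FU d (2 * S1).
    by apply: filterS (sU _ HS) => j /Hd[].
  exists D => e e0; exists (Num.min 1 (e / (4 * S1 + 1))).
    by rewrite lt_min ltr01 divr_gt0.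
  move=> h; rewrite lt_min => /andP[h1 he].
  apply: (@le_trans _ _ (4 * S1 * normc h ^+ 2)).
    apply: (@ulim_le _ FU (fun j => (P j).[z + h] - (P j).[z] - h * d j)).
      by rewrite [D * h]mulrC; apply: ulimB (ulimM FU h HD); apply: (ulimB FU); exact: Hg.
    by apply: filterS (sU _ HS) => j /Hd[_ Hj]; rewrite [h * d j]mulrC Hj// ltW.
  rewrite expr2 mulrA ler_wpM2r ?normc_ge0//.
  move: he; rewrite ltr_pdivlMr// => he; apply/ltW/(le_lt_trans _ he).
  by rewrite mulrC ler_wpM2l ?normc_ge0// lerDl.
exists g.
  split=> // e e0; have [M2 HM2] := HP e e0; exists M2 => z.
  by apply: (@ulim_le _ FU _ _ _ (Hg z)); apply: filterS (sU _ HM2) => j; apply.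
(* A grid of step [1 / (k + 1)] on [[-k, k]] is finite, so one index [phi k] is
   good at all of its points; uniform Lipschitz bounds handle the others. *)
pose pt k i : R := i%:R / k.+1%:R - k%:R.
have /choice[phi Hphi] : forall k, exists n, [/\ (k <= n)%N, (forall r z, normc z <= r -> normc (P n).[z] <= S r) &
    forall i : 'I_(2 * k * k.+1).+1, normc ((P n).[(pt k i)%:C] - g (pt k i)%:C) <= k.+1%:R^-1].
  move=> k; have k0 : 0 < k.+1%:R^-1 :> R by rewrite invr_gt0.
  have H1 : \forall n \near U, (k <= n)%N by apply: sU; exact: nbhs_infty_ge.
  have H2 : \forall n \near U, forall i : 'I_(2 * k * k.+1).+1,
      normc ((P n).[(pt k i)%:C] - g (pt k i)%:C) <= k.+1%:R^-1.
    by apply: filter_forall => i; exact: Hg.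
  have [n [h1 [h2 h3]]] := filter_ex (filterI H1 (filterI (sU _ HS) H2)).
  by exists n.
have nxy (x y : R) : normc (x%:C - y%:C) = `|x - y| by rewrite -normc_real rmorphB.
have glip x y : `|x - y| <= 1 -> normc (g x%:C - g y%:C) <= 2 * S (normc y%:C + 1) * `|x - y|.
  move=> xy; apply: (@ulim_le _ FU (fun j => (P j).[x%:C] - (P j).[y%:C])); first by apply: (ulimB FU); exact: Hg.
  apply: filterS (sU _ HS) => j Hj.
  have := @poly_lipschitz _ (P j) y%:C 1 (S (normc y%:C + 1)) ltr01 (fun w h => Hj _ _ (disc' _ w h)) x%:C.
  by rewrite nxy divr1; apply.
have plip k x y : `|x - y| <= 1 -> normc ((P (phi k)).[x%:C] - (P (phi k)).[y%:C]) <= 2 * S (normc y%:C + 1) * `|x - y|.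
  move=> xy; have [_ Hj _] := Hphi k.
  have := @poly_lipschitz _ (P (phi k)) y%:C 1 (S (normc y%:C + 1)) ltr01 (fun w h => Hj _ _ (disc' _ w h)) x%:C.
  by rewrite nxy divr1; apply.
exists phi => [k|x e e0]; first by have [] := Hphi k.
pose S2 := S (`|x| + 1).
near=> k.
have xk : `|x| <= k%:R by apply: ltW; near: k; exact: nbhs_infty_gtr.
have ke : (4 * S2 + 1) / e <= k%:R by apply: ltW; near: k; exact: nbhs_infty_gtr.
have k1 : 0 < k.+1%:R :> R by [].
have [_ _ Hk] := Hphi k.
pose v := (x + k%:R) * k.+1%:R; pose i := Num.truncn v.
have v0 : 0 <= v by rewrite mulr_ge0//; move: xk; rewrite ler_norml; lra.
have /andP[i1 i2] := archimedean.Num.Theory.truncn_itv v0; rewrite -/i in i1 i2.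
have ik : (i < (2 * k * k.+1).+1)%N.
  rewrite ltnS -(ler_nat R) (le_trans i1)// !natrM /v ler_wpM2r//.
  by move: xk; rewrite ler_norml; lra.
have := Hk (Ordinal ik); rewrite /=; set y := pt k i => Hy.
have xy : `|x - y| <= k.+1%:R^-1.
  have -> : x - y = (v - i%:R) / k.+1%:R by rewrite /v /y /pt; field; rewrite gt_eqF.
  rewrite normrM normfV (gtr0_norm k1) ler_piMl ?invr_ge0// ler_norml.
  by rewrite -natr1 in i2; lra.
have kle1 : k.+1%:R^-1 <= 1 :> R by rewrite invf_le1// ler1n.
have yx : `|y - x| <= 1 by rewrite distrC (le_trans xy).
have h1 := glip _ _ yx; have h2 := plip k _ _ yx.
rewrite normc_real -/S2 distrC in h1 h2.
have S20 : 0 <= 2 * S2 by apply: mulr_ge0 => //; exact: S0.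
have h3 := ler_wpM2l S20 xy.
have := normc_dist3 (P (phi k)).[x%:C] (g x%:C) (P (phi k)).[y%:C].
have := normc_dist3 (P (phi k)).[y%:C] (g x%:C) (g y%:C).
rewrite [normc ((P (phi k)).[x%:C] - (P (phi k)).[y%:C])]normc_distC.
have : (4 * S2 + 1) * k.+1%:R^-1 <= e.
  by rewrite ler_pdivrMr// [leRHS]mulrC -ler_pdivrMr// (le_trans ke)// ler_nat.
move: h1 h2 h3 Hy; move: (k.+1%:R^-1) => q; rewrite [y%:C]/=; lra.
Unshelve. all: by end_near. Qed.

End Montel.

(** * Lower bound *)

Section Lower.
Context {R : realType}.
Implicit Types (f : R -> R[i]) (g : R[i] -> R[i]) (p : \bar R) (r s b e x l : R) (n : nat).
Local Notation lmeas := (@lebesgue_measurable_fun R).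

Lemma normc_dist (u v : R[i]) : `|normc u - normc v| <= normc (u - v).
Proof.
by rewrite ler_norml normc_triB andbT lerNl opprB normc_distC normc_triB.
Qed.

(** The ratio of degree to half-length is asymptotically at most [s], so Bernstein's estimate
    applied on a slightly shorter interval gives exponential type [s] in the
    limit. *)
Lemma poly_growth p s (C A : R) (P : nat -> {poly R[i]}) (n : nat -> nat) (b : nat -> R) :
  (0 < p)%E -> 0 < s -> 0 <= C -> 0 <= A ->
  (forall j, (size (P j) <= (n j).+1)%N) -> (forall j, (n j)%:R <= s * b j + C) ->
  (forall B : R, \forall j \near \oo, B <= b j) ->
  (forall j, (Lp_norm p `[(- b j)%R, b j] (fun x => (P j).[x%:C]) <= A%:E)%E) ->
  forall e, 0 < e -> exists M : R, \forall j \near \oo, forall z,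
    normc (P j).[z] <= M * expR ((s + e) * normc z).
Proof.
move=> p0 s0 C0 A0 sP nb bT HL e e0.
have se0 : 0 < s + e by lra.
pose d := e / (2 * (s + e)).
have d0 : 0 < d by rewrite divr_gt0// mulr_gt0.
have d1 : d < 1 by rewrite ltr_pdivrMr ?mulr_gt0//; lra.
(* [d] is chosen for this identity, leaving [e / 2] for the shift by [C] *)
have dE : (1 - d) * (s + e) = s + e / 2 by rewrite /d; field; rewrite gt_eqF.
have L0 : 0 < s + 1 by lra.
have [K K0 HK] := lp_interior p0 d0 d1 L0.
exists (K * A); near=> j => z.
have b1 : 1 <= b j by near: j; exact: bT.
have bC : C <= b j by near: j; exact: bT.
have bCe : 2 * C / e <= b j by near: j; exact: bT.
have b0 : 0 < b j by lra.
have db0 : 0 < (1 - d) * b j by rewrite mulr_gt0//; lra.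
have nL : (n j)%:R <= (s + 1) * b j by have := nb j; rewrite mulrDl mul1r; lra.
have HI := HK (n j) (b j) (P j) A b1 nL (sP j) A0 (HL j).
apply: le_trans (bernstein_growth db0 (sP j) HI z) _.
rewrite ler_wpM2l ?mulr_ge0// ler_expR mulrCA [leLHS]mulrC ler_wpM2r ?normc_ge0//.
rewrite ler_pdivrMr// mulrCA mulrA dE.
have : 2 * C <= b j * e by rewrite -ler_pdivrMr.
have -> : (s + e / 2) * b j = s * b j + b j * e / 2 by field.
by have := nb j; lra.
Unshelve. all: by end_near. Qed.

(** A limit of polynomials with error less than [l] is an approximant of
    exponential type on the whole line. Subtracting geometric approximants of
    [g0] first leaves polynomials bounded in [L_p], hence a normal family. *)
Theorem best_expo_lower p f g0 s0 s (a : nat -> R) (C : R) l : (0 < p)%E -> lmeas f ->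
  s0 <= s -> 0 < s -> interval_approx p g0 s C ->
  expo_type s0 g0 -> (Lp_norm p setT (fun x => f x - g0 x%:C)%R < +oo)%E ->
  (forall n, (1 <= n)%N -> 0 < a n) -> (forall n, (1 <= n)%N -> `|a n - n%:R| <= C) ->
  (forall N, exists2 n, (N <= n)%N & (best_poly_approx n p (a n / s) f < l%:E)%E) ->
  (best_expo_approx s p f <= l%:E)%E.
Proof.
move=> p0 mf s0s s_gt0 [K [c [K0 c0 HK]]] tg0 L0 a0 aC Hn.
have C0 : 0 <= C by apply: le_trans (aC 1%N _).
have l0 : 0 <= l.
  have [n _ h] := Hn 0%N; rewrite -lee_fin; apply: le_trans (ltW h).
  by apply: le_ereal_inf_tmp => _ [P _ <-]; exact: Lp_ge0.
have mg0 := lmeas_expo tg0; have mf0 := lmeasB mf mg0.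
have /choice[n Hn'] : forall j, exists n, (j.+1 <= n)%N /\ (best_poly_approx n p (a n / s) f < l%:E)%E.
  by move=> j; have [n n1 n2] := Hn j.+1; exists n.
have n1 j : (1 <= n j)%N by have [h _] := Hn' j; exact: leq_trans h.
have nj j : (j <= n j)%N by have [h _] := Hn' j; exact: ltnW.
pose b j := a (n j) / s.
have b0 j : 0 < b j by rewrite divr_gt0// a0.
have an j : a (n j) = s * b j by rewrite /b mulrC divfK// gt_eqF.
have bn j : b j <= ((n j)%:R + C) / s.
  by rewrite ler_pM2r ?invr_gt0//; have := aC _ (n1 j); rewrite ler_norml => /andP[_]; lra.
have nb j : (n j)%:R <= s * b j + C.
  by rewrite -an; have := aC _ (n1 j); rewrite ler_norml => /andP[]; lra.
have bT B : \forall j \near \oo, B <= b j.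
  near=> j; have h : s * B + C <= j%:R by apply: ltW; near: j; exact: nbhs_infty_gtr.
  have h2 : j%:R <= (n j)%:R :> R by rewrite ler_nat.
  by rewrite -(ler_pM2l s_gt0); have := nb j; lra.
have /choice[P HP] : forall j, exists P : {poly R[i]}, (size P <= (n j).+1)%N /\
    (Lp_norm p `[(- b j)%R, b j] (fun x => f x - P.[x%:C])%R <= l%:E)%E.
  move=> j; have [_ /ereal_inf_lt [_ [P sP <-] /ltW hP]] := Hn' j.
  by exists P.
have /choice[Q HQ] : forall j, exists Q : {poly R[i]}, [/\ (size Q <= (n j).+1)%N,
    forall x, `|x| <= b j -> normc (g0 x%:C - Q.[x%:C]) <= K * expR (- (c * (n j)%:R)) &
    (Lp_norm p `[(- b j)%R, b j] (fun x => g0 x%:C - Q.[x%:C])%R <= (K * expR (- (c * (n j)%:R)))%:E)%E].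
  by move=> j; exact: HK.
have [A A0 HA] := Lp_fin_bound L0.
have [K1 K10 HK1] := Lp_bounded_D p0 A0 (ltW K0).
have [K2 K20 HK2] := Lp_bounded_D p0 K10 l0.
pose Rj j := P j - Q j.
have mfP j : lmeas (fun x => f x - (P j).[x%:C]) := lmeasB mf (horner_lmeas (P j)).
have mgQ j : lmeas (fun x => g0 x%:C - (Q j).[x%:C]) := lmeasB mg0 (horner_lmeas (Q j)).
have LR j : (Lp_norm p `[(- b j)%R, b j] (fun x => (Rj j).[x%:C]) <= K2%:E)%E.
  rewrite (_ : (fun x => _) = fun x => (((f x - g0 x%:C) + (g0 x%:C - (Q j).[x%:C])) +
     - (f x - (P j).[x%:C]))%R); last by apply/funext => x; rewrite /Rj hornerD hornerN; ring.
  have mD : lset `[(- b j)%R, b j] by exact: lset_itv.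
  apply: (HK2 _ _ _ mD (lmeasD mf0 (mgQ j))).
  - rewrite (_ : (fun x => _) = fun x => (P j).[x%:C] - f x); first exact: lmeasB (horner_lmeas _) mf.
    by apply/funext => x; ring.
  - apply: (HK1 _ _ _ mD mf0 (mgQ j)); first exact: (Lp_restrict p0 A0 mD mf0 HA).
    have [_ _ h] := HQ j; apply: le_trans h _; rewrite lee_fin ger_pMr// -expR0 ler_expR.
    by rewrite oppr_le0 mulr_ge0// ltW.
  - by apply: (Lp_opp p0 l0 mD (mfP j)); have [_ h] := HP j.
have sR j : (size (Rj j) <= (n j).+1)%N.
  have [h1 _] := HP j; have [h2 _ _] := HQ j.
  by rewrite /Rj (leq_trans (size_polyD _ _))// size_polyN geq_max h1 h2.
have [g1 tg1 [phi phik Hphi]] := poly_montel (poly_growth p0 s_gt0 C0 K20 sR nb bT LR).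
have tg : expo_type s (fun z => g1 z + g0 z) by apply: expo_typeD tg1 (expo_type_le s0s tg0).
apply: (@le_trans _ _ (Lp_norm p setT (fun x => f x - (g1 x%:C + g0 x%:C))%R)).
  by apply: ereal_inf_lbound; exists (fun z => g1 z + g0 z).
have phiT (S : set nat) : (\forall j \near \oo, S j) -> \forall k \near \oo, S (phi k).
  by move=> [N _ HN]; exists N => // k /= Nk; apply: HN; rewrite /= (leq_trans Nk).
have lsc := @Lp_lsc _ p l (fun k x => f x - (P (phi k)).[x%:C])
  (fun k => `[(- b (phi k))%R, b (phi k)]%classic) (fun x => f x - (g1 x%:C + g0 x%:C)) p0 l0.
apply: lsc.
- by move=> k; exact: lset_itv.
- by move=> k; exact: mfP.
- exact: lmeasB mf (lmeas_expo tg).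
- move=> x; apply: filterS (phiT _ (bT `|x|)) => k.
  by rewrite /= in_itv /= -ler_norml.
- move=> x; apply/cvgrPdist_le => e e0.
  have e2 : 0 < e / 2 by rewrite divr_gt0.
  have H1 := phiT _ (bT `|x|).
  have H2 : \forall k \near \oo, K * expR (- (c * (n (phi k))%:R)) <= e / 2.
    have [N _ HN] := expR_small K c0 e2.
    by exists N => // k /= Nk; apply: HN; rewrite /= (leq_trans Nk)// (leq_trans (phik k)).
  apply: filterS3 H1 H2 (Hphi x _ e2) => k h1 h2 h3.
  have [_ h4 _] := HQ (phi k); have {h4} := h4 x h1 => h4.
  apply: le_trans (normc_dist _ _) _.
  rewrite (_ : _ - _ = ((Rj (phi k)).[x%:C] - g1 x%:C) - (g0 x%:C - (Q (phi k)).[x%:C])); last first.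
    by rewrite /Rj hornerD hornerN; ring.
  by rewrite (le_trans (normcB _ _))//; lra.
- by move=> k; have [_] := HP (phi k).
Unshelve. all: by end_near. Qed.

End Lower.

(** * Lower and upper limits of the best approximations *)

Section Limits.
Context {R : realType}.
Implicit Types (x y : \bar R) (u : nat -> \bar R) (l : R).
Local Open Scope ereal_scope.

Lemma lee_real_above x y : (forall l, y < l%:E -> x <= l%:E) -> x <= y.
Proof.
case: y => [y| |] H; last 2 first.
- exact: leey.
- case: x H => [x| |] H; [|have := H 0%R (ltNyr _); by []|by []].
  by have := H (x - 1)%R (ltNyr _); rewrite lee_fin lerBrDr gerDl ler10.
- apply/lee_addgt0Pr => e e0; apply: H.
  by rewrite lte_fin ltrDl.
Qed.

Lemma limn_esup_le u x : (\forall n \near \oo, u n <= x) -> limn_esup u <= x.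
Proof.
move=> [N _ HN]; rewrite limn_esup_lim; apply: lime_le; first exact: is_cvg_esups.
exists N => // n /= Nn; apply: ge_ereal_sup => _ [k /= nk <-].
by apply: HN => /=; exact: leq_trans nk.
Qed.

(** The form in which the lower bound is used: a level [l] above the lower limit
    is undercut by infinitely many terms. *)
Lemma limn_einf_ge u x : (forall l, (forall N, exists2 n, (N <= n)%N & u n < l%:E) -> x <= l%:E) ->
  x <= limn_einf u.
Proof.
move=> H; apply: lee_real_above => l ul; apply: H => N.
have /ereal_inf_lt[_ [n /= Nn <-] unl] : ereal_inf (sdrop u N) < l%:E.
  apply: le_lt_trans ul; rewrite limn_einf_lim.
  apply: lime_ge; first exact: is_cvg_einfs.
  exists N => // n /= Nn; exact: nondecreasing_einfs.
by exists n.
Qed.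

Lemma cvg_of_einf_esup u x : x <= limn_einf u -> limn_esup u <= x -> u @ \oo --> x.
Proof.
move=> h1 h2; have h3 := limn_einf_sup u.
have e1 : limn_einf u = x by apply/eqP; rewrite eq_le h1 (le_trans h3 h2).
have e2 : limn_esup u = x by apply/eqP; rewrite eq_le h2 (le_trans h1 h3).
have c1 : einfs u @ \oo --> x by rewrite -e1 limn_einf_lim; exact: is_cvg_einfs.
have c2 : esups u @ \oo --> x by rewrite -e2 limn_esup_lim; exact: is_cvg_esups.
apply: squeeze_cvge c1 c2; apply: nearW => n; apply/andP; split.
  by apply: ereal_inf_lbound; exists n => //=.
by apply: ereal_sup_ubound; exists n => //=.
Qed.

Lemma nonincreasing_left_cvge (F : R -> \bar R) (a : R) : {homo F : s t / (s <= t)%R >-> t <= s} ->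
  cvg (F x @[x --> a^'-]).
Proof.
move=> nF; have /cvg_ex[/= l Fl] : cvg ((F \o -%R) x @[x --> (- a)%R^'+]).
  apply: nondecreasing_at_right_is_cvge; apply: nearW => x s t _ _ st.
  by apply: nF; rewrite lerN2.
by apply/cvg_ex; exists l; exact/cvg_at_leftNP.
Qed.

End Limits.

Section BestApprox.
Context {R : realType}.
Implicit Types (f : R -> R[i]) (g : R[i] -> R[i]) (p : \bar R) (r s t x l : R) (n : nat).
Local Notation lmeas := (@lebesgue_measurable_fun R).

Lemma best_expo_le p f t t' : t <= t' -> (best_expo_approx t' p f <= best_expo_approx t p f)%E.
Proof.
move=> tt; apply: le_ereal_inf_tmp => _ [g tg <-]; apply: ereal_inf_lbound.
by exists g => //; exact: expo_type_le tg.
Qed.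

Lemma limn_esup_best_poly p f g0 g r s0 t s (a : nat -> R) (C : R) : (0 < p)%E -> lmeas f ->
  1 < r -> 0 <= s0 -> s0 < s -> s0 * ((r + r^-1) / 2) < s * ln r ->
  expo_type s0 g0 -> (Lp_norm p setT (fun x => f x - g0 x%:C)%R < +oo)%E ->
  t < s -> expo_type t g ->
  (forall n, (1 <= n)%N -> 0 < a n) -> (forall n, (1 <= n)%N -> `|a n - n%:R| <= C) ->
  (limn_esup (fun n => best_poly_approx n p (a n / s) f) <= Lp_norm p setT (fun x => f x - g x%:C)%R)%E.
Proof.
move=> p0 mf r1 s00 s0s Hr tg0 L0 ts tg a0 aC; apply: lee_real_above => l' ll'.
have [l l0 ll] : exists2 l : R, 0 <= l & (Lp_norm p setT (fun x => f x - g x%:C)%R = l%:E)%E.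
  have := Lp_ge0 p setT (fun x => f x - g x%:C); case: Lp_norm ll' => [l _ l0|//|//].
  by exists l.
apply: limn_esup_le; apply: (best_poly_upper p0 mf r1 s00 s0s Hr tg0 L0 ts tg l0 _ _ a0 aC).
  by rewrite -lte_fin -ll.
by rewrite ll.
Qed.

End BestApprox.

Theorem theorem1p3 (R : realType) (a : nat -> R) (C : R)
    (a_gt0 : forall n : nat, (1 <= n)%N -> 0 < a n)
    (a_near : forall n : nat, (1 <= n)%N -> `|a n - n%:R| <= C)
    (mu : R) (mu_gt0 : 0 < mu)
    (mu_eq : Num.sqrt (mu ^+ 2 + 1) / mu = ln (Num.sqrt (mu ^+ 2 + 1) + mu))
    (p : \bar R) (p_gt0 : (0 < p)%E)
    (sigma0 : R) (sigma0_gt0 : 0 < sigma0)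
    (f : R -> complex R) (f_meas : lebesgue_measurable_fun f)
    (f_approx : (best_expo_approx sigma0 p f < +oo)%E)
    (sigma : R) (sigma_gt : mu * sigma0 < sigma) :
  (p = +oo%E ->
     [/\ (best_expo_approx sigma p f <=
            limn_einf (fun n => best_poly_approx n p (a n / sigma) f))%E,
         (limn_einf (fun n => best_poly_approx n p (a n / sigma) f) <=
            limn_esup (fun n => best_poly_approx n p (a n / sigma) f))%E &
         (limn_esup (fun n => best_poly_approx n p (a n / sigma) f) <=
            best_expo_approx_left sigma p f)%E]) /\
  ((p < +oo)%E ->
     best_poly_approx n p (a n / sigma) f @[n --> \oo] -->
       best_expo_approx sigma p f).
Proof.
have C0 : 0 <= C by apply: le_trans (a_near 1%N _).
have [mu1 [r [r1 rE]]] := mu_radius mu_gt0 mu_eq.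
have lnr0 : 0 < ln r by rewrite ln_gt0.
have s0s : sigma0 < sigma.
  by apply: le_lt_trans sigma_gt; rewrite ler_peMl// ltW.
have s_gt0 : 0 < sigma by lra.
have Hr : sigma0 * ((r + r^-1) / 2) < sigma * ln r by rewrite rE mulrA ltr_pM2r// mulrC.
have [_ [g0 tg0 <-] L0] := ereal_inf_lt f_approx.
have s00 := ltW sigma0_gt0.
have HI := expo_interval_approx p_gt0 tg0 s00 r1 Hr s_gt0 C0.
have lower : (best_expo_approx sigma p f <= limn_einf (fun n => best_poly_approx n p (a n / sigma) f))%E.
  by apply: limn_einf_ge => l; exact: (best_expo_lower p_gt0 f_meas (ltW s0s) s_gt0 HI tg0 L0 a_gt0 a_near).
have upper t g (ts : t < sigma) (tg : expo_type t g) :=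
  limn_esup_best_poly p_gt0 f_meas r1 s00 s0s Hr tg0 L0 ts tg a_gt0 a_near.
split=> [_|pfin].
  split => //; first exact: limn_einf_sup.
  apply: lime_ge; first by apply: nonincreasing_left_cvge => s t; exact: best_expo_le.
  near=> t; have ts : t < sigma by near: t; exact: nbhs_left_lt.
  by apply: le_ereal_inf_tmp => _ [g tg <-]; exact: upper ts tg.
apply: cvg_of_einf_esup => //; apply: lee_real_above => l /ereal_inf_lt[_ [g tg <-] gl].
case: p p_gt0 pfin {f_approx HI} L0 lower upper gl => [q| |]//; rewrite lte_fin => q0 _ L0 _ upper gl.
have [k k0 kE] : exists2 k : R, 0 <= k & (Lp_norm q%:E setT (fun x => f x - g x%:C)%R = k%:E)%E.
  have := Lp_ge0 q%:E setT (fun x => f x - g x%:C); case: Lp_norm gl => [k _ k0|//|//].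
  by exists k.
rewrite kE lte_fin in gl; have Lk : (Lp_norm q%:E setT (fun x => f x - g x%:C)%R <= k%:E)%E by rewrite kE.
have [t ts [g' tg' Hg']] := expo_left_approx q0 f_meas s0s s_gt0 tg0 L0 tg k0 gl Lk.
exact: le_trans (upper t g' ts tg') Hg'.
Unshelve. all: by end_near. Qed.
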